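(* Let $2\le k\le 4$. For a tuple of real numbers $\lambda=(\lambda_{pq})_{1\le p<q\le k}$ define the quaternionic hermitian matrix $$M_\lambda=\begin{pmatrix}1&\lambda_{12}\mathbf i\\-\lambda_{12}\mathbf i&1\end{pmatrix}\ (k=2),\qquad M_\lambda=\begin{pmatrix}1&\lambda_{12}\mathbf i&\lambda_{13}\mathbf j\\-\lambda_{12}\mathbf i&1&-\lambda_{23}\mathbf k\\-\lambda_{13}\mathbf j&\lambda_{23}\mathbf k&1\end{pmatrix}\ (k=3),$$ $$M_\lambda=\begin{pmatrix}1&\lambda_{12}\mathbf i&\lambda_{13}\mathbf j&\lambda_{14}\mathbf k\\-\lambda_{12}\mathbf i&1&-\lambda_{23}\mathbf k&\lambda_{24}\mathbf j\\-\lambda_{13}\mathbf j&\lambda_{23}\mathbf k&1&-\lambda_{34}\mathbf i\\-\lambda_{14}\mathbf k&-\lambda_{24}\mathbf j&\lambda_{34}\mathbf i&1\end{pmatrix}\ (k=4).$$ Let $\mathbb Z_2^k=\{\pm1\}^k$ and the permutation group $\mathcal S_k$ act on such tuples by $(\epsilon\cdot\lambda)_{pq}=\epsilon_p\epsilon_q\lambda_{pq}$ for $\epsilon\in\mathbb Z_2^k$, and $(\sigma\cdot\lambda)_{pq}=\lambda_{\sigma(p)\sigma(q)}=\lambda_{\sigma(q)\sigma(p)}$ for $\sigma\in\mathcal S_k$. Let $$X_k=\{(\lambda_{pq})_{1\le p<q\le k}:\ \lambda_{pq}\in[-1,1],\ \operatorname{rank}M_\lambda\le 2\}/\sim,$$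 where $\sim$ is the equivalence relation generated by the actions of $\mathbb Z_2^k$ and $\mathcal S_k$, and rank means Moore rank. Then the quotient $\mathrm{Gr}_k/\mathrm{Sp}(2)\mathrm{Sp}(1)$ has dimension $k-1$ and there is a homeomorphism between $X_k$ and $\mathrm{Gr}_k/\mathrm{Sp}(2)\mathrm{Sp}(1)$ such that the orbit corresponding to $[\lambda]\in X_k$ contains a plane $V$ admitting a basis $v_1,\dots,v_k$ with $$K(v_i,v_j)=(M_\lambda)_{i,j},\qquad i,j=1,\dots,k.$$
   Context: $\mathbb H$ denotes the quaternions with units $\mathbf i,\mathbf j,\mathbf k$ ($\mathbf i^2=\mathbf j^2=\mathbf k^2=\mathbf i\mathbf j\mathbf k=-1$). $\mathbb H^2$ is a right $\mathbb H$-vector space with quaternionic hermitian product $K(v,w)=\bar v_1w_1+\bar v_2w_2$. $\mathrm{Sp}(2)$ is the group of quaternionic $2\times2$ matrices $A$ with $A^*A=\mathrm{Id}$, acting by left multiplication; $\mathrm{Sp}(1)$ is the group of unit quaternions, acting by right multiplication; $\mathrm{Sp}(2)\mathrm{Sp}(1)=(\mathrm{Sp}(2)\times\mathrm{Sp}(1))/\{\pm(\mathrm{Id},1)\}$ is the resulting group of transformations of $\mathbb H^2\cong\mathbb R^8$. $\mathrm{Gr}_k=\mathrm{Gr}_k(\mathbb H^2)$ is the Grassmann manifold of real $k$-dimensional linear subspaces of $\mathbb H^2\cong\mathbb R^8$. The Moore rank of a hyperhermitian ($Q^*=Q$) quaternionic $k\times k$ matrix $Q$ is the quaternionic dimension of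 the image of $Q:\mathbb H^k\to\mathbb H^k$ (left multiplication on the right $\mathbb H$-space $\mathbb H^k$). Quotients carry the quotient topology. *)

(* Defs.v *)
From Stdlib Require Import Relation_Operators.
From HB Require Import structures.
From mathcomp Require Import all_boot all_order all_algebra all_fingroup.
From mathcomp Require Import generic_quotient ring.
From mathcomp Require Import all_classical all_reals topology normedtype.

Set Implicit Arguments.
Unset Strict Implicit.
Unset Printing Implicit Defensive.

Import Order.TTheory GRing.Theory Num.Theory numFieldNormedType.Exports.

Local Open Scope classical_set_scope.
Local Open Scope ring_scope.
Local Open Scope quotient_scope.
Local Open Scope card_scope.

(* [Quat a b c d] is the quaternion a + b i + c j + d k. *)
Record quat (R : realType) := Quat { qre : R; qi : R; qj : R; qk : R }.

Section Quaternions.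
Context {R : realType}.
Implicit Types (x y z : quat R) (a b : R).

Definition quat_coord x : 'rV[R]_4 := \row_l [:: qre x; qi x; qj x; qk x]`_l.
Definition quat_of_coord (u : 'rV[R]_4) : quat R :=
  Quat (u 0 (inord 0)) (u 0 (inord 1)) (u 0 (inord 2)) (u 0 (inord 3)).

Lemma quat_coordK : cancel quat_coord quat_of_coord.
Proof. by case=> a b c d; rewrite /quat_of_coord !mxE !inordK. Qed.

Lemma quat_of_coordK : cancel quat_of_coord quat_coord.
Proof.
move=> u; apply/rowP => l; rewrite mxE /=.
by case: l => [[|[|[|[|//]]]] hl] /=; congr (u _ _); apply/val_inj;
  rewrite /= inordK.
Qed.

HB.instance Definition _ := Choice.copy (quat R) (can_type quat_coordK).

Definition quat_zero : quat R := Quat 0 0 0 0.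
Definition quat_opp x := Quat (- qre x) (- qi x) (- qj x) (- qk x).
Definition quat_add x y :=
  Quat (qre x + qre y) (qi x + qi y) (qj x + qj y) (qk x + qk y).

Lemma quat_addA : associative quat_add.
Proof. by move=> [? ? ? ?] [? ? ? ?] [? ? ? ?]; rewrite /quat_add /= !addrA. Qed.
Lemma quat_addC : commutative quat_add.
Proof.
by move=> [a b c d] [? ? ? ?]; rewrite /quat_add /= (addrC a) (addrC b)
  (addrC c) (addrC d).
Qed.
Lemma quat_add0 : left_id quat_zero quat_add.
Proof. by case=> ? ? ? ?; rewrite /quat_add /= !add0r. Qed.
Lemma quat_addN : left_inverse quat_zero quat_opp quat_add.
Proof. by case=> ? ? ? ?; rewrite /quat_add /= !addNr. Qed.

HB.instance Definition _ :=
  GRing.isZmodule.Build (quat R) quat_addA quat_addC quat_add0 quat_addN.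

Definition quat_one : quat R := Quat 1 0 0 0.
Definition quat_mul x y := Quat
  (qre x * qre y - qi x * qi y - qj x * qj y - qk x * qk y)
  (qre x * qi y + qi x * qre y + qj x * qk y - qk x * qj y)
  (qre x * qj y - qi x * qk y + qj x * qre y + qk x * qi y)
  (qre x * qk y + qi x * qj y - qj x * qi y + qk x * qre y).

Lemma quat_mulA : associative quat_mul.
Proof.
by move=> [? ? ? ?] [? ? ? ?] [? ? ? ?]; rewrite /quat_mul /=; congr Quat; ring.
Qed.
Lemma quat_mul1l : left_id quat_one quat_mul.
Proof. by move=> [? ? ? ?]; rewrite /quat_mul /=; congr Quat; ring. Qed.
Lemma quat_mul1r : right_id quat_one quat_mul.
Proof. by move=> [? ? ? ?]; rewrite /quat_mul /=; congr Quat; ring. Qed.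
Lemma quat_mulDl : left_distributive quat_mul quat_add.
Proof.
by move=> [? ? ? ?] [? ? ? ?] [? ? ? ?]; rewrite /quat_mul /quat_add /=;
  congr Quat; ring.
Qed.
Lemma quat_mulDr : right_distributive quat_mul quat_add.
Proof.
by move=> [? ? ? ?] [? ? ? ?] [? ? ? ?]; rewrite /quat_mul /quat_add /=;
  congr Quat; ring.
Qed.
Lemma quat_1neq0 : quat_one != 0.
Proof. by apply/eqP => -[] /eqP; rewrite oner_eq0. Qed.

HB.instance Definition _ := GRing.Zmodule_isNzRing.Build (quat R)
  quat_mulA quat_mul1l quat_mul1r quat_mulDl quat_mulDr quat_1neq0.

Definition quat_scale a x := Quat (a * qre x) (a * qi x) (a * qj x) (a * qk x).

Lemma quat_scaleA a b x :
  quat_scale a (quat_scale b x) = quat_scale (a * b) x.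
Proof. by rewrite /quat_scale /= !mulrA. Qed.
Lemma quat_scale1 : left_id 1 quat_scale.
Proof. by case=> ? ? ? ?; rewrite /quat_scale /= !mul1r. Qed.
Lemma quat_scaleDr : right_distributive quat_scale +%R.
Proof. by move=> a x y; rewrite /quat_scale /= !mulrDr. Qed.
Lemma quat_scaleDl x : {morph quat_scale^~ x : a b / a + b}.
Proof. by move=> a b; rewrite /quat_scale /= !mulrDl. Qed.

HB.instance Definition _ := GRing.Zmodule_isLmodule.Build R (quat R)
  quat_scaleA quat_scale1 quat_scaleDr quat_scaleDl.

Lemma quat_scaleAl a x y : a *: (x * y) = a *: x * y.
Proof.
case: x y => [? ? ? ?] [? ? ? ?].
by rewrite /GRing.scale /GRing.mul /=/quat_scale /quat_mul /=; congr Quat; ring.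
Qed.
Lemma quat_scaleAr a x y : a *: (x * y) = x * (a *: y).
Proof.
case: x y => [? ? ? ?] [? ? ? ?].
by rewrite /GRing.scale /GRing.mul /=/quat_scale /quat_mul /=; congr Quat; ring.
Qed.

HB.instance Definition _ := GRing.Lmodule_isLalgebra.Build R (quat R) quat_scaleAl.
HB.instance Definition _ := GRing.Lalgebra_isAlgebra.Build R (quat R) quat_scaleAr.

Lemma quat_vect_axiom : Vector.axiom 4 (quat R).
Proof.
exists quat_coord; last by exists quat_of_coord;
  [exact: quat_coordK | exact: quat_of_coordK].
move=> a x y; apply/rowP => l; rewrite !mxE.
by case: l => [[|[|[|[|//]]]] hl].
Qed.

HB.instance Definition _ := Lmodule_hasFinDim.Build R (quat R) quat_vect_axiom.

HB.instance Definition _ :=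
  Topological.copy (quat R) (initial_topology quat_coord).

Definition ii : quat R := Quat 0 1 0 0.
Definition jj : quat R := Quat 0 0 1 0.
Definition kk : quat R := Quat 0 0 0 1.

Definition qconj x : quat R := Quat (qre x) (- qi x) (- qj x) (- qk x).

Definition adjointmx m n (A : 'M[quat R]_(m, n)) : 'M[quat R]_(n, m) :=
  (map_mx qconj A)^T.

End Quaternions.

(* The columns of [B] form a basis of the right H-subspace [W] of H^m:
   [B *m x] is the right linear combination of the columns of [B] with
   coefficients the entries of [x]. *)
Definition right_basis (R : realType) m n (W : set 'cV[quat R]_m)
    (B : 'M[quat R]_(m, n)) :=
  injective (fun x : 'cV[quat R]_n => B *m x) /\
  W = range (fun x : 'cV[quat R]_n => B *m x).

Definition has_qdim (R : realType) m (W : set 'cV[quat R]_m) (n : nat) :=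
  exists B : 'M[quat R]_(m, n), right_basis W B.

Definition has_moore_rank (R : realType) m (Q : 'M[quat R]_m) (r : nat) :=
  has_qdim (range (fun x : 'cV[quat R]_m => Q *m x)) r.

(* H^2, with the product topology and the real vector space structure R^8. *)
Definition H2 (R : realType) := (quat R * quat R)%type.

Definition K (R : realType) (v w : H2 R) : quat R :=
  qconj v.1 * w.1 + qconj v.2 * w.2.

Definition Sp2 (R : realType) : set 'M[quat R]_2 :=
  [set A | adjointmx A *m A = 1%:M].

Definition Sp1 (R : realType) : set (quat R) := [set q | qconj q * q = 1].

Definition spact (R : realType) (A : 'M[quat R]_2) (q : quat R) (v : H2 R) : H2 R :=
  ((A 0 0 * v.1 + A 0 1 * v.2) * q, (A 1 0 * v.1 + A 1 1 * v.2) * q).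

Definition Sp2Sp1 (R : realType) : set (H2 R -> H2 R) :=
  [set g | exists A q, [/\ Sp2 A, Sp1 q & g = spact A q]].

Arguments Sp2 R : clear implicits.
Arguments Sp1 R : clear implicits.
Arguments Sp2Sp1 R : clear implicits.

Section Sp2Sp1Group.
Context {R : realType}.

Lemma qconjM (x y : quat R) : qconj (x * y) = qconj y * qconj x.
Proof.
case: x y => [? ? ? ?] [? ? ? ?].
by rewrite /GRing.mul /= /qconj /quat_mul /=; congr Quat; ring.
Qed.

Lemma qconjD (x y : quat R) : qconj (x + y) = qconj x + qconj y.
Proof.
case: x y => [? ? ? ?] [? ? ? ?].
by rewrite /GRing.add /= /qconj /quat_add /=; congr Quat; rewrite opprD.
Qed.

Lemma qconjK : involutive (@qconj R).
Proof. by case=> ? ? ? ?; rewrite /qconj /= !opprK. Qed.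

Lemma qconj0 : qconj 0 = 0 :> quat R.
Proof. by rewrite /qconj /= oppr0. Qed.

Lemma qconj1 : qconj 1 = 1 :> quat R.
Proof. by rewrite /qconj /= oppr0. Qed.

Lemma qconj_sum I (r : seq I) (P : pred I) (F : I -> quat R) :
  qconj (\sum_(i <- r | P i) F i) = \sum_(i <- r | P i) qconj (F i).
Proof. exact: (big_morph _ qconjD qconj0). Qed.

Lemma qmulVr (q : quat R) : qconj q * q = 1 -> q * qconj q = 1.
Proof.
move=> <-; case: q => [? ? ? ?].
by rewrite /GRing.mul /= /qconj /quat_mul /=; congr Quat; ring.
Qed.

Lemma adjointmxM m n p (A : 'M[quat R]_(m, n)) (B : 'M[quat R]_(n, p)) :
  adjointmx (A *m B) = adjointmx B *m adjointmx A.
Proof.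
apply/matrixP => i j; rewrite !mxE qconj_sum.
by apply: eq_bigr => l _; rewrite !mxE qconjM.
Qed.

Lemma adjointmxK m n (A : 'M[quat R]_(m, n)) : adjointmx (adjointmx A) = A.
Proof. by apply/matrixP => i j; rewrite !mxE qconjK. Qed.

Lemma adjointmx1 n : adjointmx 1%:M = 1%:M :> 'M[quat R]_n.
Proof.
by apply/matrixP => i j; rewrite !mxE eq_sym; case: eqP;
  rewrite ?qconj1 ?qconj0.
Qed.

Lemma spact_is_linear (A : 'M[quat R]_2) q : linear (spact A q).
Proof.
have lin (b c x y x' y' : quat R) a :
    (b * (a *: x + x') + c * (a *: y + y')) * q =
    a *: ((b * x + c * y) * q) + (b * x' + c * y') * q.
  by rewrite !mulrDr -!scalerAr !mulrDl -!scalerAl scalerDr addrACA.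
by move=> a v w; congr (_, _); exact: lin.
Qed.
HB.instance Definition _ A q := GRing.isLinear.Build R (H2 R) (H2 R) _
  (spact A q) (spact_is_linear A q).

Lemma spactM A B q r (v : H2 R) :
  spact A q (spact B r v) = spact (A *m B) (r * q) v.
Proof.
by rewrite /spact /=; congr (_, _); rewrite !mxE !big_ord_recl !big_ord0 /=
  !addr0 !mulrDl !mulrDr !mulrDl !mulrA addrACA;
  rewrite (_ : lift ord0 ord0 = 1) //; apply/val_inj.
Qed.

Lemma spact1 (v : H2 R) : spact 1%:M 1 v = v.
Proof.
by case: v => a b; rewrite /spact !mxE /= !mulr1 !mul1r !mul0r addr0 add0r.
Qed.

Lemma spact_inj (A B : 'M[quat R]_2) :
  (forall v : H2 R, spact A 1 v = spact B 1 v) -> A = B.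
Proof.
move=> AB; have := AB (1, 0); have := AB (0, 1).
rewrite /spact /= !mulr1 !mulr0 !addr0 !add0r => -[A01 A11] [A00 A10].
apply/matrixP => i j.
have two (l : 'I_2) : l = 0 \/ l = 1.
  by case: l => [[|[|//]] hl]; [left|right]; apply/val_inj.
by case: (two i) => ->; case: (two j) => ->.
Qed.

Lemma Sp2_adjoint A : Sp2 R A -> Sp2 R (adjointmx A).
Proof.
rewrite /Sp2 /= adjointmxK => AA; apply: spact_inj => v.
pose f := linfun (spact A 1 : H2 R -> H2 R).
pose g := linfun (spact (adjointmx A) 1 : H2 R -> H2 R).
have gf w : g (f w) = w by rewrite !lfunE /= spactM AA mulr1 spact1.
have kerf : lker f == 0%VS.
  apply/lker0P => u w fuw; by rewrite -(gf u) -(gf w) fuw.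
have fgE : f (g v) = v.
  have [w ->] : exists w, v = f w.
    exists ((f^-1)%VF v); by rewrite (lker0_lfunVK kerf).
  by rewrite gf.
by move: fgE; rewrite !lfunE /= spactM mulr1 => ->; rewrite spact1.
Qed.

End Sp2Sp1Group.

Definition Gr (R : realType) (k : nat) := {V : {vspace H2 R} | \dim V == k}.

Section Grassmannian.
Context (R : realType) (k : nat).

HB.instance Definition _ := Choice.on (Gr R k).

Definition frame : set {ptws 'I_k -> H2 R} := [set F | free (codom F)].

Lemma dim_span_frame (F : frame) : \dim <<codom (set_val F)>>%VS == k.
Proof.
have /set_mem : set_val F \in frame := valP F.
by rewrite /frame /= /free => /eqP ->; rewrite size_codom card_ord.
Qed.

Definition frame_span (F : frame) : Gr R k := 
  exist (fun V : {vspace H2 R} => \dim V == k) _ (dim_span_frame F).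

(* The usual topology of the Grassmannian: the final topology for the map
   sending a linearly independent k-tuple of vectors of R^8 to its span. *)
Definition Gr_open : set (set (Gr R k)) :=
  [set U | open (frame_span @^-1` U)].

Lemma Gr_openT : Gr_open setT.
Proof. by rewrite /Gr_open /= preimage_setT; exact: openT. Qed.
Lemma Gr_openI (U V : set (Gr R k)) : Gr_open U -> Gr_open V -> Gr_open (U `&` V).
Proof. exact: openI. Qed.
Lemma Gr_open_bigU (I : Type) (f : I -> set (Gr R k)) :
  (forall i, Gr_open (f i)) -> Gr_open (\bigcup_i f i).
Proof. by move=> fo; apply: bigcup_open => i _; exact: fo. Qed.

HB.instance Definition _ :=
  isOpenTopological.Build (Gr R k) Gr_openT Gr_openI Gr_open_bigU.

Definition same_orbit (V W : Gr R k) : bool :=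
  `[< exists2 g, Sp2Sp1 R g & [set` \val W] = g @` [set` \val V] >].

Lemma same_orbit_refl : reflexive same_orbit.
Proof.
move=> V; apply/asboolP; exists (spact 1%:M 1).
  by exists 1%:M, 1; split=> //; rewrite /Sp2 /Sp1 /= ?adjointmx1 ?mulmx1
    ?qconj1 ?mulr1.
by under eq_imagel do rewrite spact1; rewrite image_id.
Qed.

Lemma same_orbit_implsym (V W : Gr R k) : same_orbit V W -> same_orbit W V.
Proof.
move=> /asboolP[_ [A [q [AA qq ->]]] WE]; apply/asboolP.
exists (spact (adjointmx A) (qconj q)).
  exists (adjointmx A), (qconj q); split=> //; first exact: Sp2_adjoint.
  by rewrite /Sp1 /= qconjK; exact: qmulVr.
have inv v : spact (adjointmx A) (qconj q) (spact A q v) = v.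
  by rewrite spactM AA (qmulVr qq) spact1.
rewrite WE image_comp.
by under eq_imagel do rewrite /= inv; rewrite image_id.
Qed.

Lemma same_orbit_sym : symmetric same_orbit.
Proof. by move=> V W; apply/idP/idP; exact: same_orbit_implsym. Qed.

Lemma same_orbit_trans : transitive same_orbit.
Proof.
move=> V U W /asboolP[_ [A [q [AA qq ->]]] VE].
move=> /asboolP[_ [B [r [BB rr ->]]] WE]; apply/asboolP.
exists (spact (B *m A) (q * r)).
  exists (B *m A), (q * r); split=> //.
    by rewrite /Sp2 /= adjointmxM mulmxA -(mulmxA _ _ B) BB mulmx1 AA.
  by rewrite /Sp1 /= qconjM mulrA -(mulrA _ _ q) qq mulr1 rr.
rewrite WE VE image_comp.
by under eq_imagel do rewrite /= spactM.
Qed.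

Canonical same_orbit_equiv :=
  EquivRel same_orbit same_orbit_refl same_orbit_sym same_orbit_trans.

Definition Gr_orbits := quotient_topology {eq_quot same_orbit_equiv}.

End Grassmannian.

Arguments frame R k : clear implicits.

(* Real tuples (lam_pq) indexed by the pairs p < q; [lam_at lam p q] is lam_pq
   with the convention lam_qp = lam_pq (and 0 on the diagonal). *)
Definition pairs (k : nat) := {pq : 'I_k * 'I_k | (pq.1 < pq.2)%N}.

Definition lam_at (R : realType) (k : nat) (lam : pairs k -> R) (p q : 'I_k) : R :=
  oapp lam (oapp lam 0 (insub (q, p))) (insub (p, q)).

(* The quaternion unit in row p and column q of M_lam; indices start at 0. *)
Definition M_unit (R : realType) (p q : nat) : quat R :=
  match p, q with
  | 0%N, 1%N => ii   | 0%N, 2%N => jj   | 0%N, 3%N => kk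
  | 1%N, 0%N => - ii | 1%N, 2%N => - kk | 1%N, 3%N => jj
  | 2%N, 0%N => - jj | 2%N, 1%N => kk   | 2%N, 3%N => - ii
  | 3%N, 0%N => - kk | 3%N, 1%N => - jj | 3%N, 2%N => ii
  | _, _ => 0
  end.

(* Meaningful for k <= 4; for k = 2 and k = 3 the matrix is the leading
   principal block of the one for k = 4. *)
Definition M_lam (R : realType) (k : nat) (lam : pairs k -> R) : 'M[quat R]_k :=
  \matrix_(p, q) if p == q then 1 else lam_at lam p q *: M_unit R p q.

Definition sgn_act (R : realType) (k : nat) (eps : {ffun 'I_k -> bool})
    (lam : pairs k -> R) : pairs k -> R :=
  fun pq => (-1) ^+ eps (val pq).1 * (-1) ^+ eps (val pq).2 * lam pq.

Definition perm_act (R : realType) (k : nat) (s : 'S_k)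
    (lam : pairs k -> R) : pairs k -> R :=
  fun pq => lam_at lam (s (val pq).1) (s (val pq).2).

Section ParameterSpace.
Context (R : realType) (k : nat).

Definition Lam : set {ptws pairs k -> R} :=
  [set lam | (forall pq, -1 <= lam pq <= 1) /\
             exists2 r, has_moore_rank (M_lam lam) r & (r <= 2)%N].

Definition lam_step (x y : Lam) : Prop :=
  (exists eps, set_val y = sgn_act eps (set_val x)) \/
  (exists s, set_val y = perm_act s (set_val x)).

Definition lam_equiv (x y : Lam) : bool :=
  `[< clos_refl_sym_trans Lam lam_step x y >].

Lemma lam_equiv_refl : reflexive lam_equiv.
Proof. by move=> x; apply/asboolP; exact: rst_refl. Qed.
Lemma lam_equiv_sym : symmetric lam_equiv.
Proof. by move=> x y; apply/idP/idP => /asboolP h; apply/asboolP; exact: rst_sym. Qed.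
Lemma lam_equiv_trans : transitive lam_equiv.
Proof.
move=> y x z /asboolP xy /asboolP yz; apply/asboolP; exact: rst_trans xy yz.
Qed.

Canonical lam_equivrel :=
  EquivRel lam_equiv lam_equiv_refl lam_equiv_sym lam_equiv_trans.

Definition X := quotient_topology {eq_quot lam_equivrel}.

End ParameterSpace.

Arguments Lam R k : clear implicits.

Definition homeomorphism (S T : topologicalType) (f : S -> T) :=
  continuous f /\ exists g : T -> S, [/\ continuous g, cancel f g & cancel g f].

Definition open_cover (T : topologicalType) (C : set (set T)) :=
  C `<=` open /\ \bigcup_(U in C) U = setT.

(* Lebesgue covering dimension at most n: every open cover has an open
   refinement such that each point lies in at most n + 1 of its members. *)
Definition covering_dim_le (T : topologicalType) (n : nat) :=
  forall C : set (set T), open_cover C ->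
  exists D : set (set T),
    [/\ open_cover D,
        forall V, D V -> exists2 U, C U & V `<=` U &
        forall x, [set V | D V /\ V x] #<= `I_n.+1].

(* For nonempty spaces (the empty space would get dimension 0 here). *)
Definition covering_dim (T : topologicalType) (n : nat) :=
  covering_dim_le T n /\ forall m, (m < n)%N -> ~ covering_dim_le T m.

(* Main.v *)
Require Import Defs.
From Stdlib Require Import Relation_Operators.
From HB Require Import structures.
From mathcomp Require Import all_boot all_order all_algebra all_fingroup.
From mathcomp Require Import generic_quotient ring lra zify.
From mathcomp Require Import all_classical all_reals topology normedtype.
From mathcomp Require Import mxpoly derive trigo.

Set Implicit Arguments.
Unset Strict Implicit.
Unset Printing Implicit Defensive.

Import Order.TTheory GRing.Theory Num.Theory numFieldNormedType.Exports.

Local Open Scope classical_set_scope.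
Local Open Scope ring_scope.
Local Open Scope quotient_scope.

(** Both spaces are quotients of the space of angle tuples t = (t_0, ..., t_(k-1)).
    Write e_0, ..., e_3 for the units 1, i, j, k. A tuple t gives the point
    lam_pq = cos (t_p - t_q) of X_k, and it gives the normal plane spanned by
    the orthonormal vectors v_p = (cos t_p e_p, sin t_p e_p). These satisfy
    K (v_p, v_q) = cos (t_p - t_q) conj(e_p) e_q, which is the entry (p, q) of
    M_lam. So it suffices to show that t |-> [lam] and t |-> (orbit of the
    normal plane) are both quotient maps with the same fibres, namely the
    classes of angle tuples modulo permutations, a common sign, a common
    translation, and multiples of pi in each entry ([angle_equiv]). The notion
    [orbit_map] expresses this, [cos_class_orbit_map] and
    [normal_class_orbit_map] are the two instances, and [orbit_map_transfer]
    gives the homeomorphism.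

    For X_k: conjugating M_lam by the diagonal matrix of the e_p gives the real
    symmetric matrix with entries lam_pq and diagonal 1. If the Moore rank is at
    most two, the real 3 x 3 minors vanish, and with |lam_pq| <= 1 the matrix is
    the Gram matrix of unit vectors of the Euclidean plane, hence consists of
    cosines of differences ([lam_angles]). The fibres are as claimed since the
    numbers cos (t_p - t_q)^2 determine t up to the equivalence
    ([angle_equiv_of_cos2]).

    For the Grassmannian, surjectivity is a variational argument. Pair a plane
    with the fixed test vectors (e_r, r e_r); if the matrix of inner products is
    nonsingular, move the plane by the compact group so that the square of its
    determinant is maximal. The derivative vanishes along the rotations generated
    by left multiplication by S u (S a symmetric real involution, u an imaginary
    unit) and by right multiplication by u ([trace_critical]); these linear
    equations force the basis dual to the test vectors to consist of multiples of
    vectors (cos t_p e_p, sin t_p e_p) ([exists_normal]). Planes congruent to a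
    normal plane form a closed set because the group is compact, and frames with
    nonsingular pairing are dense, so every plane is congruent to a normal plane.
    The same compactness shows that the map is a quotient map. For the fibres
    ([normal_class_inj]), let G_a be the matrices of the four real components of
    K (v_p, v_q). The matrix sum_a G_a G_a^T is conjugated by a change of
    orthonormal basis and unchanged by the group, and for a normal plane it is
    diagonal with entries sum_r cos (t_p - t_r)^2. With z_p = e^(2 i t_p) and
    e = sum_p z_p, its eigenvalues are affine functions of the inner products
    <z_p, e>; if e <> 0 these determine the configuration of the z_p for k <= 4.
    If e = 0 the configuration is rigid for k = 2 and k = 3, and for k = 4 it is
    determined by the eigenvalues of the 3 x 3 matrix with entries
    tr (G_a G_b^T), a and b imaginary.

    For the dimension, the equivalence acts by symmetries of the triangulation
    of R^k / R (1, ..., 1) by the hyperplanes t_i - t_j = pi m / N. The images of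
    the open stars of its vertices form a cover of multiplicity k, because
    vertices of one simplex have different types modulo k and the symmetries
    identify stars consistently ([covering_dim_le_orbit]). Conversely, a
    (k - 1)-dimensional cube of angles is embedded so that its coordinates are
    read off by invariant functions, and a cover of smaller multiplicity would
    contradict the Knaster-Kuratowski-Mazurkiewicz lemma, which follows from
    Sperner's lemma ([covering_dim_gt_orbit]). *)

(** * Sperner's lemma on a cubical grid *)

Section Sperner.
Local Open Scope nat_scope.

Definition rainbow m (L : nat -> nat) :=
  perm_eq [seq L j | j <- iota 0 m] (iota 0 m).

Lemma iota0S n : iota 0 n.+1 = iota 0 n ++ [:: n].
Proof. by rewrite -addn1 iotaD. Qed.

(** Dropping the value at [j] lists the others along [bump j]: a simplex is a vertex
    together with the opposite facet. *)
Lemma perm_bump (L : nat -> nat) M j : j <= M ->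
  perm_eq [seq L i | i <- iota 0 M.+1] (L j :: [seq L (bump j i) | i <- iota 0 M]).
Proof.
move=> jM; rewrite (map_comp L (bump j)) -map_cons; apply: perm_map.
apply: uniq_perm; first exact: iota_uniq.
  rewrite /= map_inj_uniq ?iota_uniq ?andbT; last exact: can_inj (bumpK _).
  by apply/mapP => -[i _ jE]; have := neq_bump j i; rewrite -jE eqxx.
move=> i; rewrite mem_iota inE /=; apply/idP/orP.
  move=> iM; case: (eqVneq i j) => [->|ij]; [by left | right].
  apply/mapP; exists (unbump j i); last by rewrite unbumpK // inE.
  by rewrite mem_iota /= add0n /unbump; move: ij iM jM; case: ltngtP; lia.
case=> [/eqP->|/mapP[l]]; first by rewrite add0n ltnS.
by rewrite mem_iota /bump !add0n /= => lM ->; lia.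
Qed.

Lemma addb_count (L : nat -> nat) x n :
  \big[addb/false]_(j < n) (L j == x) = odd (count_mem x [seq L j | j <- iota 0 n]).
Proof.
elim: n => [|n IH]; first by rewrite big_ord0.
rewrite big_ord_recr iota0S map_cat count_cat oddD IH /= addn0.
by case: (_ == _).
Qed.

(** The local step of Sperner's parity argument. A rainbow simplex has exactly one
    rainbow facet, the one opposite the vertex with label [M]. A simplex that is not
    rainbow but has a rainbow facet repeats one label, and then has exactly two such
    facets. So modulo 2 the rainbow facets count the rainbow simplices. *)
Lemma rainbow_facets M (L : nat -> nat) : (forall j, j <= M -> L j <= M) ->
  rainbow M.+1 L = \big[addb/false]_(j < M.+1) rainbow M (fun i => L (bump j i)).
Proof.
move=> LM; rewrite {1}/rainbow; set s := map _ _.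
have [/existsP[j0 fj0]|] := boolP [exists j : 'I_M.+1, rainbow M (fun i => L (bump j i))].
  set x := L j0.
  have sx : perm_eq s (x :: iota 0 M).
    by rewrite (perm_trans (perm_bump L (leq_ord j0))) // perm_cons.
  under eq_bigr => j _.
    rewrite (_ : rainbow _ _ = (L j == x)); first over.
    rewrite /rainbow -(perm_cons (L j)) -(permPl (perm_bump L (leq_ord j))).
    rewrite -/s (permPl sx); apply/idP/eqP => [|->]; last exact: perm_refl.
    move=> /seq.permP/(_ (pred1 x)) /=; rewrite eqxx; case: eqP => //= _.
    by rewrite add1n => /esym/n_Sn.
  rewrite addb_count (seq.permP sx) [RHS]/= eqxx add1n /= count_uniq_mem ?iota_uniq //.
  rewrite mem_iota add0n [0 <= x]leq0n andTb [RHS]/= oddb -leqNgt.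
  rewrite -[0 :: iota 1 M]/(iota 0 M.+1) (permPl sx) iota0S -cat1s perm_sym perm_catC perm_sym.
  have xM : x <= M by rewrite LM // leq_ord.
  rewrite perm_cat2r; apply/idP/idP => [|Mx].
    by move=> /perm_mem/(_ x); rewrite !inE eqxx => /esym/eqP ->.
  have -> : x = M by apply/eqP; rewrite eqn_leq xM Mx.
  exact: perm_refl.
rewrite negb_exists => /forallP nf; rewrite big1 => [|j _]; last exact: negbTE.
apply/negbTE/negP => ss.
have : M \in s by rewrite (perm_mem ss) mem_iota add0n /=.
move=> /mapP[j]; rewrite mem_iota add0n /= => jM LjM.
have := nf (Ordinal jM); rewrite /rainbow /=; case/negP.
rewrite -(perm_cons (L j)) -(permPl (perm_bump L _)) -1?ltnS // -/s.
rewrite (permPl ss) -LjM iota0S perm_catC cat1s.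
exact: perm_refl.
Qed.

(** The [j]-th vertex of the Freudenthal simplex with lowest corner [y] and order of
    directions [s]: from one vertex to the next, one coordinate grows by one. Coordinates
    beyond the first [M] are zero, so this is also a simplex of the face spanned by the
    first [M] directions. *)
Definition grid_vertex M N (y : {ffun 'I_M -> 'I_N}) (s : 'S_M) (j i : nat) : nat :=
  if insub i is Some i' then (y i' : nat) + (s i' < j) else 0.

(** Multiplication by an odd involution pairs even with odd permutations. *)
Lemma addb_involution (M : nat) (s0 : 'S_M) (F : 'S_M -> bool) :
  (s0 * s0 = 1)%g -> odd_perm s0 -> (forall s, F (s * s0)%g = F s) ->
  \big[addb/false]_s F s = false.
Proof.
move=> s0s0 odd0 Fs; rewrite (bigID (fun s : 'S_M => odd_perm s)) /=.
rewrite (reindex_inj (mulIg s0)) /=.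
under eq_big => [s|s _] do [rewrite odd_permM odd0 addbT|rewrite Fs].
by rewrite addbb.
Qed.

Section Labelling.
Variables (n N : nat) (l : (nat -> nat) -> nat).
Definition in_grid (x : nat -> nat) := forall i, x i <= N.+1.
Hypothesis l_le : forall x, in_grid x -> l x <= n.
Hypothesis l_lo : forall x i, in_grid x -> i < n -> x i = 0 -> l x <> i.+1.
Hypothesis l_hi : forall x i, in_grid x -> i < n -> x i = N.+1 -> l x <> i.

Lemma grid_vertexP M (y : {ffun 'I_M -> 'I_N.+1}) s j : in_grid (grid_vertex y s j).
Proof.
move=> i; rewrite /grid_vertex; case: insubP => // i' _ _.
by have := ltn_ord (y i'); case: (_ < j); lia.
Qed.

Lemma rainbow_mem M L a : rainbow M L -> a < M -> exists2 j, j < M & L j = a.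
Proof.
move=> /perm_mem/(_ a); rewrite mem_iota add0n /= => aE aM; move: aE.
rewrite aM => /mapP[j]; rewrite mem_iota add0n /= => jM ->; by exists j.
Qed.

(** On the face where the coordinates from [M] on vanish, the labels above [M] are
    forbidden. *)
Lemma label_face M (y : {ffun 'I_M -> 'I_N.+1}) s j : M <= n ->
  l (grid_vertex y s j) <= M.
Proof.
move=> Mn; have yP := grid_vertexP y s j; rewrite leqNgt; apply/negP => lM.
set a := l _ in lM; have an : a <= n := l_le yP.
have aE : a = a.-1.+1 by lia.
apply: (@l_lo _ a.-1 yP) => //; first lia.
by rewrite /grid_vertex insubF //; apply/negbTE; rewrite -leqNgt; lia.
Qed.

Definition count_rainbow M :=
  \big[addb/false]_(s : 'S_M) \big[addb/false]_(y : {ffun 'I_M -> 'I_N.+1})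
    rainbow M.+1 (fun j => l (grid_vertex y s j)).

(** The cyclic shift of the directions; it carries a simplex to the neighbour across
    its facet opposite the last vertex. *)
Definition ordSp M : 'S_M.+1 := perm (@ordS_inj M.+1).

(** The facet opposite the last vertex of a simplex is the facet opposite the first vertex of
    the simplex one step below it in the direction that comes last. *)
Lemma shift_facet M (y : {ffun 'I_M.+1 -> 'I_N.+1}) (s : 'S_M.+1) i :
   s i = ord_max ->
  let y' := [ffun i' => if i' == i then ord_pred (y i') else y i'] in
  y i != ord0 ->
  forall j, j <= M -> grid_vertex y' (s * ordSp M)%g j.+1 = grid_vertex y s j.
Proof.
move=> si y' yi0 j jM; apply/funext => a; rewrite /grid_vertex.
case: insubP => // a' _ _; rewrite permM permE /= ffunE.
have [->|a'i] := eqVneq a' i.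
  rewrite si /= modnn ltn0Sn ltnNge jM /= addn0.
  have : 0 < y i by rewrite lt0n; apply: contraNneq yi0 => yi0; apply/eqP/val_inj.
  have := ltn_ord (y i); move: (nat_of_ord (y i)) => b b1 b2.
  by rewrite -subn1 -addnBAC // modnDr modn_small; lia.
have : s a' != ord_max by rewrite -si (inj_eq perm_inj).
rewrite -val_eqE /= => sa'; have := ltn_ord (s a') => sa.
by rewrite modn_small ?ltnS //; lia.
Qed.

(** First and last facets cancel in pairs inside the grid. What remains lies on the boundary
    of the grid in the direction [i] that comes last. The upper boundary carries no rainbow
    facet since label [i] is missing there; on the lower boundary label [i.+1] is missing,
    which rules out a rainbow facet unless [i] is the last direction of all. *)
Lemma ends_cancel M (s : 'S_M.+1) (y : {ffun 'I_M.+1 -> 'I_N.+1}) : M < n ->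
  let i := (s^-1)%g ord_max in
  rainbow M.+1 (fun j => l (grid_vertex
    [ffun i' => if i' == i then ord_pred (y i') else y i'] (s * ordSp M)%g j.+1))
  (+) rainbow M.+1 (fun j => l (grid_vertex y s j)) =
  [&& s ord_max == ord_max, y ord_max == ord0
    & rainbow M.+1 (fun j => l (grid_vertex y s j))].
Proof.
move=> Mn i; have si : s i = ord_max by rewrite permKV.
have -> : (s ord_max == ord_max) = (i == ord_max).
  by rewrite -{2}si (inj_eq perm_inj) eq_sym.
set y' := finfun _.
have valE (z : {ffun 'I_M.+1 -> 'I_N.+1}) (t : 'S_M.+1) j (a : 'I_M.+1) :
  grid_vertex z t j a = z a + (t a < j) by rewrite /grid_vertex valK.
have [yi0|yi0] := boolP (y i == ord0); last first.
  have -> : rainbow M.+1 (fun j => l (grid_vertex y' (s * ordSp M)%g j.+1)) =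
            rainbow M.+1 (fun j => l (grid_vertex y s j)).
    rewrite /rainbow; congr perm_eq; apply/eq_in_map => j.
    rewrite mem_iota add0n /= => jM; congr l; exact: shift_facet.
  rewrite addbb; case: eqP => //= iE; by rewrite iE in yi0; rewrite (negPf yi0).
have -> : rainbow M.+1 (fun j => l (grid_vertex y' (s * ordSp M)%g j.+1)) = false.
  apply/negP => /(fun h => rainbow_mem h (ltn_ord i))[j _].
  apply: (@l_hi _ i); [exact: grid_vertexP|exact: leq_trans (ltn_ord i) Mn|].
  rewrite valE permM permE si /= modnn ltn0Sn addn1 ffunE eqxx (eqP yi0) /=.
  by rewrite modn_small.
case: (eqVneq i ord_max) => [iE|iE] /=; first by rewrite -iE yi0.
apply/negP => rb; have [|j jM] := @rainbow_mem _ _ i.+1 rb.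
  by rewrite ltnS ltn_neqAle -ltnS ltn_ord andbT; exact: iE.
apply: (@l_lo _ i); [exact: grid_vertexP|exact: leq_trans (ltn_ord i) Mn|].
by rewrite valE (eqP yi0) si /= ltnNge -ltnS jM.
Qed.

(** The facets left over on the face where the last coordinate vanishes are the simplices
    of the grid of one dimension less. *)
Lemma face_sum M (F : 'S_M.+1 -> {ffun 'I_M.+1 -> 'I_N.+1} -> bool) :
  let ext (y : {ffun 'I_M -> 'I_N.+1}) : {ffun 'I_M.+1 -> 'I_N.+1} :=
    [ffun i => oapp y ord0 (unlift ord_max i)] in
  \big[addb/false]_(s : 'S_M.+1) \big[addb/false]_(y : {ffun 'I_M.+1 -> 'I_N.+1})
    [&& s ord_max == ord_max, y ord_max == ord0 & F s y] =
  \big[addb/false]_(s : 'S_M) \big[addb/false]_(y : {ffun 'I_M -> 'I_N.+1})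
    F (lift_perm ord_max ord_max s) (ext y).
Proof.
move=> ext; transitivity (\big[addb/false]_(s : 'S_M.+1 | s ord_max == ord_max)
    \big[addb/false]_(y : {ffun 'I_M.+1 -> 'I_N.+1} | y ord_max == ord0) F s y).
  rewrite [RHS]big_mkcond; apply: eq_bigr => s _.
  case: eqP => /= _; last by rewrite big1.
  by rewrite [RHS]big_mkcond; apply: eq_bigr => y _; case: eqP.
rewrite (reindex (lift_perm ord_max ord_max)); last first.
  pose ulsf i (s : 'S_M.+1) k := odflt k (unlift (s i) (s (lift i k))).
  have ulsfK i (s : 'S_M.+1) k: lift (s i) (ulsf i s k) = s (lift i k).
    rewrite /ulsf; have := neq_lift i k.
    by rewrite -(can_eq (permK s)) => /unlift_some[] ? ? ->.
  have inj_ulsf: injective (ulsf ord_max _).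
    move=> s; apply: can_inj (ulsf (s ord_max) s^-1%g) _ => k'.
    by rewrite {1}/ulsf ulsfK !permK liftK.
  exists (fun s => perm (inj_ulsf s)) => [s _ | s].
    by apply/permP=> k'; rewrite permE /ulsf lift_perm_lift lift_perm_id liftK.
  move/(_ s _ =P _) => si0; apply/permP=> k.
  case: (unliftP ord_max k) => [k'|] ->; rewrite ?lift_perm_id ?si0 //.
  by rewrite lift_perm_lift permE -[RHS]ulsfK si0.
apply: eq_big => [s|s _]; first by rewrite lift_perm_id eqxx.
rewrite (reindex ext) /=; last first.
  exists (fun y => [ffun i => y (lift ord_max i)]) => [y _|y].
    by apply/ffunP => i; rewrite !ffunE liftK.
  move=> /(y _ =P _) y0; apply/ffunP => i; rewrite !ffunE.
  by case: unliftP => [i'|] -> //=; rewrite ?ffunE // y0.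
by apply: eq_bigl => y; rewrite ffunE unlift_none /= eqxx.
Qed.

(** Induction on the dimension: modulo 2, rainbow simplices are counted by the rainbow facets
    of all simplices. A facet opposite a middle vertex is shared by two simplices, whose
    orders of directions differ by a transposition; facets opposite the end vertices cancel
    except on the face of one dimension less. *)
Lemma sperner_parity M : M <= n -> count_rainbow M = true.
Proof.
elim: M => [_|M IH Mn].
  rewrite /count_rainbow (big_pred1 1%g) => [|s]; last first.
    by apply/esym/eqP/permP => -[].
  rewrite (big_pred1 [ffun=> ord0]) => [|y]; last by apply/esym/eqP/ffunP => -[].
  set y := finfun _; set s := 1%g; rewrite /rainbow /=; have := label_face y s 0 (leq0n n).
  by rewrite leqn0 => /eqP ->.
rewrite -(IH (ltnW Mn)) /count_rainbow.
transitivity (\big[addb/false]_(s : 'S_M.+1)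
    \big[addb/false]_(y : {ffun 'I_M.+1 -> 'I_N.+1}) \big[addb/false]_(j < M.+2)
    rainbow M.+1 (fun i => l (grid_vertex y s (bump j i)))).
  apply: eq_bigr => s _; apply: eq_bigr => y _; apply: rainbow_facets => j _.
  exact: label_face.
(* Group the facets by the position of the omitted vertex. *)
transitivity (\big[addb/false]_(j < M.+2) \big[addb/false]_(s : 'S_M.+1)
    \big[addb/false]_(y : {ffun 'I_M.+1 -> 'I_N.+1})
    rainbow M.+1 (fun i => l (grid_vertex y s (bump j i)))).
  by rewrite [RHS]exchange_big; apply: eq_bigr => s _; rewrite exchange_big.
rewrite big_ord_recl big_ord_recr /=.
(* Omitting a middle vertex: swapping the two adjacent directions keeps the facet. *)
rewrite [X in _ (+) (X (+) _) = _]big1 ?addFb; last first.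
  move=> j _; have jM := ltn_ord j.
  pose t : 'S_M.+1 := tperm (inord j) (inord j.+1).
  have tN : inord j != inord j.+1 :> 'I_M.+1.
    by rewrite -val_eqE /= !inordK //; [lia|exact: ltnW].
  apply: (@addb_involution _ t); first exact: tperm2.
    by rewrite odd_tperm.
  move=> s; apply: eq_bigr => y _; congr rainbow; apply/funext => i.
  congr l; apply/funext => a; rewrite /grid_vertex; case: insubP => // a' _ _.
  congr (_ + _); rewrite permM /= /bump add1n.
  case: tpermP => [->|->|//]; rewrite !inordK ?ltnS //; last first.
  - exact: ltnW.
  - by case: (ltnP j i) => ji; congr nat_of_bool; lia.
  - exact: ltnW.
  - by case: (ltnP j i) => ji; congr nat_of_bool; lia.
(* Omitting the first or the last vertex. *)
rewrite (reindex_inj (mulIg (ordSp M))) -big_split /=.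
transitivity (\big[addb/false]_(s : 'S_M.+1)
  \big[addb/false]_(y : {ffun 'I_M.+1 -> 'I_N.+1})
   [&& s ord_max == ord_max, y ord_max == ord0
    & rainbow M.+1 (fun j => l (grid_vertex y s j))]).
  apply: eq_bigr => s _.
  pose i := (s^-1)%g ord_max.
  pose h (y : {ffun 'I_M.+1 -> 'I_N.+1}) :=
    [ffun i' => if i' == i then ord_pred (y i') else y i'].
  have h_inj : injective h.
    move=> y z /ffunP hyz; apply/ffunP => a; move: (hyz a); rewrite !ffunE.
    by case: eqP => // _; exact: ord_pred_inj.
  rewrite (reindex_inj h_inj) -big_split /=; apply: eq_bigr => y _.
  rewrite -ends_cancel //; congr (_ (+) _).
  rewrite /rainbow; congr perm_eq; apply/eq_in_map => j.
  by rewrite mem_iota add0n /= => jM; congr l; rewrite /bump leqNgt jM.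
rewrite face_sum; apply: eq_bigr => s _; apply: eq_bigr => y _.
rewrite /rainbow; congr perm_eq; apply/eq_in_map => j.
rewrite mem_iota add0n /= => jM; congr l; apply/funext => a.
rewrite /grid_vertex; case: insubP => [a' aM aE|aM].
  rewrite ffunE; case: unliftP => [b|] a'E.
    have aE' : a = b by rewrite -aE a'E; exact: lift_max.
    rewrite insubT; first by rewrite aE' ltn_ord.
    move=> aM'; rewrite a'E lift_perm_lift.
    have bumpE (c : 'I_M) : bump M c = c by rewrite /bump leqNgt ltn_ord.
    have -> : Sub a aM' = b by apply/val_inj.
    by rewrite /= bumpE.
  rewrite /= insubF; last by rewrite -aE a'E /= ltnn.
  by rewrite add0n a'E lift_perm_id /= ltnNge -ltnS jM.
by rewrite insubF //; apply: contraNF aM => /ltnW.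
Qed.

(** The vertices of a rainbow simplex, written as a corner plus increments of 0 or 1, which
    shows that they are close to each other. *)
Lemma sperner : exists x (dx : nat -> nat -> bool),
  forall a, a <= n -> exists2 j, l (fun i => x i + dx j i) = a &
    in_grid (fun i => x i + dx j i).
Proof.
have := sperner_parity (leqnn n); rewrite /count_rainbow => odd1.
have [/existsP[s /existsP[y ys]]|none] := boolP [exists s, exists y : {ffun 'I_n -> 'I_N.+1},
   rainbow n.+1 (fun j => l (grid_vertex y s j))]; last first.
  move: odd1; rewrite big1 // => s _; rewrite big1 // => y _; apply: contraNF none => ys.
  by apply/existsP; exists s; apply/existsP; exists y.
exists (fun i => oapp (fun i' => y i' : nat) 0 (insub i)).
exists (fun j i => oapp (fun i' => s i' < j) false (insub i)) => a an.
have [j _ <-] := rainbow_mem ys an; exists j.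
  by congr l; apply/funext => i; rewrite /grid_vertex; case: insub.
move=> i; have := grid_vertexP y s j i.
by rewrite /grid_vertex; case: insub.
Qed.

End Labelling.
End Sperner.

(** * A covering lemma on the cube *)

Section KKM.
Context {R : realType}.

Definition cube n : set 'rV[R]_n := [set x | forall i, 0 <= x 0 i <= 1].

Lemma compact_box n (a b : R) :
  compact [set x : 'rV[R]_n | forall i, a <= x 0 i <= b].
Proof.
have := @rV_compact _ n (fun=> `[a, b]%classic) (fun=> @segment_compact _ _ _).
by congr compact; apply/funext => x /=; apply/propext; split => xP i;
  have := xP i; rewrite in_itv.
Qed.

(** Around each point of [A] one radius serves a whole neighbourhood; compactness makes the
    radius uniform. *)
Lemma lebesgue_number (T : pseudoMetricType R) (A : set T) I (U : I -> set T) :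
  compact A -> (forall i, open (U i)) -> (forall x, A x -> exists i, U i x) ->
  \forall e \near 0^'+, forall x, A x -> exists i, ball x e `<=` U i.
Proof.
move=> /compact_near_coveringP cA Uo AU.
apply: (cA R 0^'+ (fun e x => exists i, ball x e `<=` U i)) => x Ax.
have [i Uix] := AU x Ax.
have /nbhs_ballP[r /= r0 rU] : nbhs x (U i) by exact: open_nbhs_nbhs.
have r2 : 0 < r / 2 by rewrite divr_gt0.
near=> x' e.
have er : e <= r / 2 by near: e; exact: nbhs_right_le.
exists i => y x'y; apply: rU.
have xx' : ball x (r / 2) x' by near: x'; exact: nbhsx_ballx.
rewrite [r]splitr; apply: ball_triangle xx' _; exact: le_ball er _ x'y.
Unshelve. all: by end_near. Qed.

(** On a fine grid, label a point by the index of a set that contains the ball around it. The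
    boundary conditions are those of Sperner's lemma, and a rainbow simplex lies in one small
    ball, so its corner belongs to all the sets. *)
Lemma kkm n (U : nat -> set 'rV[R]_n) : (forall a, open (U a)) ->
  (forall x, cube x -> exists2 a, (a <= n)%N & U a x) ->
  (forall x (i : 'I_n), cube x -> x 0 i = 0 -> ~ U i.+1 x) ->
  (forall x (i : 'I_n), cube x -> x 0 i = 1 -> ~ U i x) ->
  exists2 x, cube x & forall a, (a <= n)%N -> U a x.
Proof.
move=> Uo Ucov Ulo Uhi.
have leb : \forall e \near 0^'+, forall x, cube x ->
    exists a : 'I_n.+1, ball x e `<=` U a.
  apply: lebesgue_number; [exact: compact_box|by move=> a; exact: Uo|].
  by move=> x /Ucov[a an Uax]; exists (inord a); rewrite inordK.
have [d d0 dP] : exists2 d : R, 0 < d &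
    forall x, cube x -> exists2 a, (a <= n)%N & ball x d `<=` U a.
  have [d [/= d0 dP]] : exists d : R, 0 < d /\ forall x, cube x ->
      exists a : 'I_n.+1, ball x d `<=` U a.
    have [d [d0 dP]] := filter_ex (filterI (nbhs_right_gt (0 : R)) leb).
    by exists d.
  exists d => // x /dP[a aU]; exists a => //; exact: leq_ord.
have [N Nd] : exists N : nat, N.+1%:R^-1 < d.
  by have [N] := ltr_add_invr d0; rewrite add0r; exists N.
pose pt (x : nat -> nat) : 'rV[R]_n := \row_i ((x i)%:R / N.+1%:R).
have ptE x i : pt x 0 i = (x i)%:R / N.+1%:R by rewrite mxE.
have N0 : 0 < N.+1%:R :> R by rewrite ltr0n.
have ptP x : in_grid N x -> cube (pt x).
  move=> xP i; rewrite ptE divr_ge0 //= ?ler0n //.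
  by rewrite ler_pdivrMr // mul1r ler_nat.
pose l x := xget 0%N [set a | (a <= n)%N /\ ball (pt x) d `<=` U a].
have lP x : in_grid N x -> (l x <= n)%N /\ ball (pt x) d `<=` U (l x).
  move=> /ptP/dP[a an aU]; rewrite /l; case: xgetP => [b _ //|].
  by move=> /(_ a) /not_andP[].
have lU x : in_grid N x -> U (l x) (pt x).
  by move=> /lP[_]; apply; exact: ballxx.
have [||| x [dx xP]] := @sperner n N l.
- by move=> x /lP[].
- move=> x i xg iN xi lxi; apply: (Ulo (pt x) (Ordinal iN)); first exact: ptP.
    by rewrite ptE /= xi mul0r.
  by rewrite /= -lxi; exact: lU.
- move=> x i xg iN xi lxi; apply: (Uhi (pt x) (Ordinal iN)); first exact: ptP.
    by rewrite ptE /= xi divff ?gt_eqF.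
  by rewrite /= -lxi; exact: lU.
exists (pt x).
  have [j _ xg] := xP 0%N isT; apply: ptP => i; exact: leq_trans (leq_addr _ _) (xg i).
move=> a an; have [j <- xg] := xP a an.
apply: (lP _ xg).2; split => // u i; rewrite (ord1 u) !ptE /= -ball_normE /=.
rewrite -mulrBl natrD addrAC subrr add0r normrM.
rewrite [`|N.+1%:R^-1|]gtr0_norm ?invr_gt0 // (le_lt_trans _ Nd) //.
rewrite ler_piMl ?invr_ge0 ?(ltW N0) //.
by case: (dx _ _); rewrite /= ?normr1 ?normr0.
Qed.
End KKM.

(** * Quotients of the space of angles: dimension from above *)

Section OrbitMaps.
Context {R : realType}.

(** Each angle is that of a line, hence counts modulo [pi]; the common sign and translation are
    the isometries of the circle of directions. *)
Definition angle_equiv k (t u : 'rV[R]_k) := exists (s : 'S_k) (b : bool) (c : R) (m : 'I_k -> int),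
  forall p, u 0 p = (-1) ^+ b * t 0 (s p) + c + (m p)%:~R * pi.

(** A quotient map of the space of angles whose fibres are the classes of the equivalence.
    This is all that the two sides of the theorem need to have in common. *)
Definition orbit_map k (T : topologicalType) (f : 'rV[R]_k -> T) :=
  [/\ forall x, exists t, f t = x,
      forall U, open U <-> open (f @^-1` U) &
      forall t u, f t = f u <-> angle_equiv t u].

Section Star.
Variables (k N : nat).
Implicit Types (t u : 'rV[R]_k.+1) (v w : 'I_k.+1 -> int).

(** The open star of the vertex [pi v / (N + 1)] of the triangulation of the space of angles modulo
    common translations by the hyperplanes [t_i - t_j = pi m / (N + 1)]. *)
Definition star v : set 'rV[R]_k.+1 := [set t | forall i j,
  N.+1%:R * (t 0 i - t 0 j) < (1 + (v i - v j)%:~R) * pi].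

Lemma open_star v : open (star v).
Proof.
rewrite openE => t tv; rewrite /interior /=.
suff near_ij i j : \forall u \near (t : 'rV[R]_k.+1),
    N.+1%:R * ((u : 'rV[R]_k.+1) 0 i - (u : 'rV[R]_k.+1) 0 j) < (1 + (v i - v j)%:~R) * pi.
  by apply: filterS (filter_forall _ (fun i => filter_forall _ (near_ij i))).
have c : {for t, continuous (fun u : 'rV[R]_k.+1 => N.+1%:R * (u 0 i - u 0 j))}.
  apply: continuousM; first exact: cst_continuous.
  by apply: continuousB; apply: coord_continuous.
exact: (cvgr_lt _ c _ (tv i j)).
Qed.

Lemma star_floor t : star (fun i => Num.floor (N.+1%:R * t 0 i / pi)) t.
Proof.
move=> i j; set x := t 0 i; set y := t 0 j.
have p0 : 0 < pi :> R := pi_gt0 R.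
rewrite -ltr_pdivrMr // mulrBr mulrBl rmorphB /=.
have := ge_floor (N.+1%:R * y / pi); have := floorD1_gt (N.+1%:R * x / pi).
by rewrite intrD; lra.
Qed.

(** The vertices of one simplex of the triangulation have pairwise different types, the type
    being the sum of the coordinates modulo the number of coordinates. For [v] and [w] in one
    simplex, all differences of coordinates of [w - v] are at most 1. *)
Lemma star_eq v w t : star v t -> star w t ->
  ((\sum_i v i)%R = (\sum_i w i)%R %[mod k.+1])%Z -> star v = star w.
Proof.
move=> vt wt vw; pose u i := w i - v i.
have u1 i j : u i - u j <= 1.
  have h := ltrD (vt i j) (wt j i).
  suff : (0 : int) < 2 - (u i - u j) by lia.
  rewrite -(ltr_int R) -(pmulr_lgt0 _ (pi_gt0 R)).
  have -> : (2 - (u i - u j)) = (1 + (v i - v j)) + (1 + (w j - w i)).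
    by rewrite /u; lia.
  rewrite intrD (intrD _ 1 (v i - v j)) (intrD _ 1 (w j - w i)) mulrDl.
  by apply: le_lt_trans h; rewrite -mulrDr; lra.
suff uE i j : u i = u j.
  apply/funext => x; apply/propext; split => xs i j.
    by have := xs i j; have := uE i j; rewrite /u => ?; rewrite (_ : v i - v j = w i - w j) //; lia.
  by have := xs i j; have := uE i j; rewrite /u => ?; rewrite (_ : v i - v j = w i - w j) //; lia.
wlog uij : i j / u i < u j.
  by move=> wl; case: (ltgtP (u i) (u j)) => // /wl.
exfalso.
(* If u is not constant, every u l is u i or u i + 1 and both values occur, so the sum
   of the u l lies strictly between two consecutive multiples of k+1. *)
have ul l : 0 <= u l - u i <= 1.
  by have := u1 l i; have := u1 j l; lia.
have : (k.+1 %| \sum_l u l)%Z.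
  by rewrite /u sumrB -eqz_mod_dvd; apply/eqP.
move=> /dvdzP[q qE].
have SE : \sum_l (u l - u i) = (q - u i) * k.+1%:Z.
  by rewrite [\sum_l (u l - u i)]sumrB qE sumr_const card_ord -mulr_natr natz -!mulrBl.
have s1 : 1 <= \sum_l (u l - u i).
  rewrite (bigD1 j) //= ler_wpDr ?sumr_ge0 // => [l _|]; last lia.
  by have /andP[] := ul l.
have s2 : \sum_l (u l - u i) <= k.
  rewrite (bigD1 i) //= subrr add0r.
  apply: (@le_trans _ _ (\sum_(l | l != i) 1)).
    by apply: ler_sum => l _; have /andP[] := ul l.
  by rewrite sumr_const (cardC1 i) card_ord /=; lia.
move: s1 s2; rewrite SE; case: (lerP (q - u i) 0) => qu.
  by have := mulr_le0_ge0 qu (isT : 0 <= k.+1%:Z); lia.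
have : k.+1%:Z <= (q - u i) * k.+1%:Z by rewrite ler_peMl //; lia.
lia.
Qed.

(** An element of the group is a symmetry of the triangulation, so it carries the star of one
    vertex around [t] to the star of another around [u]; both have the same image in the
    quotient. *)
Lemma star_angle_equiv v t u : angle_equiv t u -> star v u ->
  exists2 w, star w t & forall (T : Type) (f : 'rV[R]_k.+1 -> T),
    (forall x y, angle_equiv x y -> f x = f y) -> f @` star w = f @` star v.
Proof.
move=> [s [b [c [m uE]]]] vu.
pose act (x : 'rV[R]_k.+1) : 'rV[R]_k.+1 :=
  \row_p ((-1) ^+ b * x 0 (s p) + c + (m p)%:~R * pi).
pose inv (y : 'rV[R]_k.+1) : 'rV[R]_k.+1 :=
  \row_q ((-1) ^+ b * (y 0 ((s^-1)%g q) - c - (m ((s^-1)%g q))%:~R * pi)).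
have invK y : act (inv y) = y.
  apply/rowP => p; rewrite !mxE permK mulrA -expr2 sqrr_sign mul1r; ring.
pose w q : int := (-1) ^+ b * (v ((s^-1)%g q) - N.+1%:Z * m ((s^-1)%g q)).
have wE x : star w x <-> star v (act x).
  have key i j : (N.+1%:R * (act x 0 i - act x 0 j) < (1 + (v i - v j)%:~R) * pi) =
    (N.+1%:R * ((-1) ^+ b * (x 0 (s i) - x 0 (s j))) <
      (1 + ((-1) ^+ b * (w (s i) - w (s j)))%:~R) * pi).
    rewrite !mxE; have -> : (-1) ^+ b * (w (s i) - w (s j)) =
        (v i - N.+1%:Z * m i) - (v j - N.+1%:Z * m j).
      by rewrite /w !permK -[X in _ * X]mulrBr mulrA -expr2 sqrr_sign mul1r.
    rewrite -[LHS]subr_gt0 -[RHS]subr_gt0; congr (0 < _).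
    by rewrite !rmorphB !rmorphM /= !pmulrn; ring.
  split=> xs i j.
    rewrite key; case: (b); rewrite ?expr1 ?expr0 ?mulN1r ?mul1r ?opprB; exact: xs.
  have := xs ((s^-1)%g i) ((s^-1)%g j); have := xs ((s^-1)%g j) ((s^-1)%g i).
  rewrite !key !permKV.
  by case: (b); rewrite ?expr1 ?expr0 ?mulN1r ?mul1r ?opprB.
have act_t : act t = u by apply/rowP => p; rewrite mxE uE.
have angle_equiv_act x : angle_equiv x (act x) by exists s, b, c, m => p; rewrite mxE.
exists w; first by rewrite wE act_t.
move=> T f fP; apply/seteqP; split=> [_ [x xs <-]|_ [y ys <-]].
  by exists (act x); [rewrite -wE|apply/esym/fP].
exists (inv y); first by rewrite wE invK.
by rewrite -[in RHS](invK y); exact/fP.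
Qed.

End Star.

Lemma pi_gt0R : 0 < pi :> R. Proof. exact: pi_gt0. Qed.

Lemma angle_equiv_sym k (t u : 'rV[R]_k) : angle_equiv t u -> angle_equiv u t.
Proof.
move=> [s [b [c [m uE]]]].
exists (s^-1)%g, b, (- (-1) ^+ b * c), (fun p => - (-1) ^+ b * m ((s^-1)%g p)) => p.
rewrite uE permKV rmorphM rmorphN rmorphXn /= rmorphN1.
by case: b {uE}; rewrite ?expr1 ?expr0; ring.
Qed.

(** Images of stars cover the quotient; they refine a given cover as soon as [N] is large, by a
    Lebesgue number on the box [[0, pi]^(k+1)]. Over a point with a chosen preimage [t],
    every star can be moved so as to contain [t], and then it is one of the at most [k + 1] stars
    around [t]. *)
Lemma covering_dim_le_orbit k (T : topologicalType) (f : 'rV[R]_k.+1 -> T) :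
  orbit_map f -> covering_dim_le T k.
Proof.
move=> [fsurj fopen fangle_equiv] C [Co CT].
have fP x y : angle_equiv x y -> f x = f y by move=> xy; apply/fangle_equiv.
pose box : set 'rV[R]_k.+1 := [set t | forall i, 0 <= t 0 i <= pi].
have : \forall e \near 0^'+, forall x, box x ->
    exists U : {U : set T | C U}, ball x e `<=` f @^-1` (sval U).
  apply: lebesgue_number; first exact: compact_box.
    by move=> [U CU] /=; apply/fopen; exact: Co.
  by move=> x _; have : [set: T] (f x) by []; rewrite -CT => -[U CU Ux]; exists (exist _ U CU).
move=> leb; have [e [e0 eP]] := filter_ex (filterI (nbhs_right_gt (0 : R)) leb).
have [N Ne] : exists N : nat, pi / N.+1%:R < e.
  have [N] := ltr_add_invr (divr_gt0 e0 pi_gt0R); rewrite add0r => h; exists N.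
  by rewrite mulrC -ltr_pdivlMr ?pi_gt0R.
have N0 : 0 < N.+1%:R :> R by rewrite ltr0n.
exists [set f @` star N v | v in setT]; split.
- split=> [_ [v _ <-]|].
    apply/fopen; rewrite openE => t [u vu] /fangle_equiv/angle_equiv_sym tu; rewrite /interior.
    have [w wt fE] := star_angle_equiv tu vu; rewrite -(fE _ f fP).
    apply: (@filterS _ _ _ (star N w)); first by move=> x xw; exists x.
    by apply: open_nbhs_nbhs; split=> //; exact: open_star.
  apply/seteqP; split=> // x _; have [t <-] := fsurj x.
  exists (f @` star N (fun i => Num.floor (N.+1%:R * t 0 i / pi))).
    by exists (fun i => Num.floor (N.+1%:R * t 0 i / pi)).
  by exists t => //; exact: star_floor.
- move=> _ [v _ <-].
  have [m [r [vE r0 rN]]] : exists m r : 'I_k.+1 -> int,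
      [/\ forall i, v i = m i * N.+1 + r i, forall i, 0 <= r i & forall i, r i < N.+1].
    exists (fun i => v i %/ N.+1)%Z, (fun i => v i %% N.+1)%Z; split=> i.
    - exact: divz_eq.
    - by rewrite modz_ge0.
    - by rewrite ltz_pmod.
  (* The vertex of the star, translated into the box by multiples of pi. *)
  pose x0 : 'rV[R]_k.+1 := \row_i (pi * (r i)%:~R / N.+1%:R).
  have [|[U CU] /= x0U] := eP x0.
    move=> i; rewrite mxE.
    rewrite divr_ge0 ?mulr_ge0 ?ler0z ?ler0n ?(ltW pi_gt0R) //=.
    rewrite ler_pdivrMr // ler_pM2l ?pi_gt0R //.
    by rewrite (_ : N.+1%:R = (N.+1%:Z)%:~R :> R) // ler_int ltW.
  exists U => // _ [t vt <-].
  pose c := t 0 0 - pi * (v 0)%:~R / N.+1%:R.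
  pose t' : 'rV[R]_k.+1 :=
    \row_i ((-1) ^+ false * t 0 ((1 : 'S_k.+1)%g i) + (- c) + (- m i)%:~R * pi).
  have -> : f t = f t'.
    by apply: fP; exists 1%g, false, (- c), (fun i => - m i) => i; rewrite mxE.
  apply: x0U; split => // u i; rewrite (ord1 u) !mxE perm1 expr0 mul1r -ball_normE /=.
  apply: le_lt_trans Ne.
  have d1 : N.+1%:R * (t 0 i - t 0 0) < (1 + (v i - v 0)%:~R) * pi := vt i 0.
  have d2 : - (N.+1%:R * (t 0 i - t 0 0)) < (1 - (v i - v 0)%:~R) * pi.
    by have := vt 0 i; rewrite -mulrN opprB -[v 0 - v i]opprB rmorphN.
  rewrite -(ler_pM2l N0) [N.+1%:R * (pi / _)]mulrC divfK ?gt_eqF //.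
  rewrite -[in X in X * _](gtr0_norm N0) -normrM.
  have -> : N.+1%:R * (pi * (r i)%:~R / N.+1%:R -
      (t 0 i + - c + (- m i)%:~R * pi)) = pi * (v i - v 0)%:~R - N.+1%:R * (t 0 i - t 0 0).
    rewrite /c !rmorphB /= (vE i) rmorphD rmorphM rmorphN /=.
    rewrite (_ : (N.+1%:Z)%:~R = N.+1%:R :> R) //.
    by move: (N.+1%:R) N0 => n n0; field; rewrite gt_eqF.
  move: d1 d2; set a := _%:~R; set y := _ * _ => d1 d2.
  by rewrite ler_norml; apply/andP; split; lra.
- move=> x; have [t ftx] := fsurj x.
  (* The star around t is determined by its type r. *)
  pose P (r : nat) (v : 'I_k.+1 -> int) := star N v t /\ ((\sum_i v i)%R %% k.+1)%Z = r.
  pose g r := f @` star N (xget (fun=> 0) (P r)).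
  apply: card_le_trans (card_image_le g `I_k.+1).
  apply: subset_card_le => V [[v _ <-] [u vu]]; rewrite -ftx => /fangle_equiv/angle_equiv_sym tu.
  have [w wt fE] := star_angle_equiv tu vu.
  pose r := `|((\sum_i w i)%R %% k.+1)%Z|%N.
  have rE : r = ((\sum_i w i)%R %% k.+1)%Z :> int by rewrite gez0_abs // modz_ge0.
  exists r.
    by rewrite /= -ltz_nat rE ltz_pmod.
  rewrite /g -(fE _ f fP); congr (f @` _).
  have [] : P r (xget (fun=> 0) (P r)) by apply: xgetPex; exists w.
  move=> xt xE; have e1 : ((\sum_i w i)%R = (\sum_i (xget (fun=> 0) (P r)) i)%R %[mod k.+1])%Z.
    by rewrite xE rE.
  exact: esym (star_eq wt xt e1).
Qed.

End OrbitMaps.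

(** * Quotients of the space of angles: dimension from below *)

Section LowerBound.
Context {R : realType}.

Lemma continuous_mx (T U : topologicalType) m n (g : T -> 'M[U]_(m, n)) :
  (forall i j, continuous (fun x => g x i j)) -> continuous g.
Proof.
move=> gc x A [P xP PA]; rewrite /nbhs /=.
apply: filterS (filter_forall _ (fun i =>
  filter_forall _ (fun j => gc i j x _ (xP i j)))) => y yP.
by apply: PA => i j; exact: yP.
Qed.

Section RealValued.
Variable T : topologicalType.
Implicit Types f g : T -> R.

Lemma contC (c : R) : continuous (fun _ : T => c).
Proof. by move=> x; exact: cst_continuous. Qed.
Lemma contD f g : continuous f -> continuous g -> continuous (fun x => f x + g x).
Proof. by move=> fc gc x; apply: continuousD; [exact: fc|exact: gc]. Qed.
Lemma contN f : continuous f -> continuous (fun x => - f x).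
Proof. by move=> fc x; apply: continuousN; exact: fc. Qed.
Lemma contB f g : continuous f -> continuous g -> continuous (fun x => f x - g x).
Proof. by move=> fc gc; apply: contD => //; exact: contN. Qed.
Lemma contM f g : continuous f -> continuous g -> continuous (fun x => f x * g x).
Proof. by move=> fc gc x; apply: continuousM; [exact: fc|exact: gc]. Qed.
Lemma cont_comp (h : R -> R) f :
  continuous h -> continuous f -> continuous (fun x => h (f x)).
Proof. by move=> hc fc x; apply: continuous_comp; [exact: fc|exact: hc]. Qed.
Lemma cont_norm f : continuous f -> continuous (fun x => `|f x|).
Proof. by apply: cont_comp => x; exact: norm_continuous. Qed.
Lemma cont_sum I (r : seq I) (P : pred I) (F : I -> T -> R) :
  (forall i, continuous (F i)) -> continuous (fun x => \sum_(i <- r | P i) F i x).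
Proof.
move=> Fc; elim: r => [|i r IH].
  rewrite (_ : (fun _ => _) = fun=> 0); first exact: contC.
  by apply/funext => x; rewrite big_nil.
case Pi: (P i); last first.
  rewrite (_ : (fun _ => _) = fun x => \sum_(i <- r | P i) F i x); first exact: IH.
  by apply/funext => x; rewrite big_cons Pi.
rewrite (_ : (fun _ => _) = fun x => F i x + \sum_(i <- r | P i) F i x).
  exact: contD.
by apply/funext => x; rewrite big_cons Pi.
Qed.
Lemma cont_coord m n (f : T -> 'M[R]_(m, n)) i j :
  continuous f -> continuous (fun x => f x i j).
Proof.
move=> fc x; apply: (@continuous_comp _ _ _ f (fun M : 'M[R]_(m, n) => M i j)).
  exact: fc.
exact: coord_continuous.
Qed.
End RealValued.

Lemma cont_id (T : topologicalType) : continuous (fun x : T => x).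
Proof. by move=> x; exact: cvg_id. Qed.

(** Applied to the cosine and to the unit vector of a given angle. *)
Lemma antiperiodic (V : zmodType) (f : R -> V) (x : R) (n : int) :
  (forall y, f (y + pi) = - f y) ->
  f (x + n%:~R * pi) = if odd `|n|%N then - f x else f x.
Proof.
move=> f_pi; have nat_case y (l : nat) : f (y + l%:R * pi) = if odd l then - f y else f y.
  elim: l => [|l IH]; first by rewrite mul0r addr0.
  by rewrite -natr1 mulrDl mul1r addrA f_pi IH /=; case: (odd l); rewrite ?opprK.
case: n => n; first by rewrite -pmulrn nat_case.
rewrite NegzE rmorphN abszN /= -[in RHS](subrK (n.+1%:R * pi) x) nat_case mulNr -pmulrn /=.
by case: (odd n); rewrite ?opprK.
Qed.

Lemma cos_int_pi (x : R) (n : int) : `|cos (x + n%:~R * pi)| = `|cos x|.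
Proof. by rewrite antiperiodic; [case: ifP; rewrite ?normrN|exact: cosDpi]. Qed.

Lemma angle_equiv_cos k (t u : 'rV[R]_k) : angle_equiv t u -> exists s : 'S_k,
  forall p q, `|cos (u 0 p - u 0 q)| = `|cos (t 0 (s p) - t 0 (s q))|.
Proof.
move=> [s [b [c [m uE]]]]; exists s => p q; rewrite !uE.
rewrite [_ - _](_ : _ = (-1) ^+ b * (t 0 (s p) - t 0 (s q)) + (m p - m q)%:~R * pi).
  rewrite cos_int_pi; case: b {uE}; first by rewrite expr1 mulN1r cosN.
  by rewrite expr0 mul1r.
by rewrite rmorphB /=; ring.
Qed.

(** The retraction of the line onto [[0, 1]]. *)
Definition clamp (x : R) := (1 + `|x| - `|x - 1|) / 2.

Lemma clamp_continuous : continuous clamp.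
Proof.
apply: contM; last exact: contC.
apply: contB; first by apply: contD; [exact: contC|apply: cont_norm; exact: cont_id].
by apply: cont_norm; apply: contB; [exact: cont_id|exact: contC].
Qed.

Lemma clamp_lo x : x <= 0 -> clamp x = 0.
Proof. by move=> x0; rewrite /clamp ler0_norm // ler0_norm; lra. Qed.
Lemma clamp_hi x : 1 <= x -> clamp x = 1.
Proof. by move=> x0; rewrite /clamp ger0_norm ?ger0_norm; lra. Qed.
Lemma clamp_mid x : 0 <= x <= 1 -> clamp x = x.
Proof. by move=> x0; rewrite /clamp ger0_norm ?ler0_norm; lra. Qed.
Lemma clampP x : 0 <= clamp x <= 1.
Proof.
have [x0|x0] := leP x 0; first by rewrite clamp_lo // lexx ler01.
have [x1|x1] := leP 1 x; first by rewrite clamp_hi // lexx ler01.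
by rewrite clamp_mid; lra.
Qed.

(** A function on the quotient. The truncation makes it sensitive only to pairs with
    [5 |cos (t_p - t_q)|] between [a] and [a + 1]. *)
Definition gauge k a (t : 'rV[R]_k) :=
  \sum_p \sum_q clamp (5 * `|cos (t 0 p - t 0 q)| - a%:R).

Lemma gauge_angle_equiv k a (t u : 'rV[R]_k) : angle_equiv t u -> gauge a t = gauge a u.
Proof.
move=> /angle_equiv_cos[s sE]; rewrite /gauge (reindex_inj (@perm_inj _ s)) /=.
apply: eq_bigr => p _; rewrite (reindex_inj (@perm_inj _ s)) /=.
by apply: eq_bigr => q _; rewrite sE.
Qed.

Lemma gauge_continuous k a : continuous (@gauge k a).
Proof.
apply: cont_sum => p; apply: cont_sum => q.
apply: cont_comp; first exact: clamp_continuous.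
apply: contB; last exact: contC.
apply: contM; first exact: contC.
apply: cont_norm; apply: cont_comp; first exact: continuous_cos.
by apply: contB; apply: coord_continuous.
Qed.

(** A cube of angle tuples: the first angle is zero and the cosine of angle [i + 1] is
    [(i + x_i) / 5], so different coordinates occupy different intervals of cosines. The factor 5
    leaves the cosines at most 3/5 for at most three coordinates. *)
Definition probe k (x : 'rV[R]_k) : 'rV[R]_k.+1 :=
  \row_(p < k.+1) oapp (fun i : 'I_k => acos ((i%:R + clamp (x 0 i)) / 5)) 0
    (unlift ord0 p).

Lemma probe0 k (x : 'rV[R]_k) : probe x 0 ord0 = 0.
Proof. by rewrite mxE unlift_none. Qed.

Lemma probeS k (x : 'rV[R]_k) i :
  probe x 0 (lift ord0 i) = acos ((i%:R + clamp (x 0 i)) / 5).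
Proof. by rewrite mxE liftK. Qed.

Lemma probe_range k (x : 'rV[R]_k) (i : 'I_k) : (k <= 3)%N ->
  0 <= (i%:R + clamp (x 0 i)) / 5 <= 3 / 5.
Proof.
move=> k3; have := clampP (x 0 i); have : i%:R <= 2 :> R.
  by rewrite ler_nat -ltnS (leq_trans (ltn_ord i)).
have : 0 <= i%:R :> R by [].
lra.
Qed.

Lemma probe_continuous k : (k <= 3)%N -> continuous (@probe k).
Proof.
move=> k3; apply: continuous_mx => i j; rewrite /probe.
rewrite (_ : (fun _ => _) = fun x : 'rV[R]_k =>
    oapp (fun i : 'I_k => acos ((i%:R + clamp (x 0 i)) / 5)) 0 (unlift ord0 j)); last first.
  by apply/funext => x; rewrite mxE.
case: unliftP => [l _|_] /=; last exact: cst_continuous.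
move=> x; apply: (@continuous_comp _ _ _
  (fun x : 'rV[R]_k => (l%:R + clamp (x 0 l)) / 5) (@acos R)); last first.
  by apply: continuous_acos; have := probe_range x l k3; lra.
move: x; apply: contM; last exact: contC.
apply: contD; first exact: contC.
by apply: cont_comp; [exact: clamp_continuous|exact: coord_continuous].
Qed.

(** On the cube the gauge reads off one coordinate. The pair of angles [0] and [i + 1] contributes
    0 or 1 if [i <> a] and the coordinate if [i = a]. All other cosines of differences are at
    least [sin sin >= (4/5)^2], so five times them exceeds 3 and they contribute 1. *)
Lemma gauge_probe k (a : 'I_k) (x : 'rV[R]_k) : (k <= 3)%N ->
  gauge a (probe x) =
  1 + 2 * \sum_(i < k) ((a < i)%N)%:R + (k * k)%:R + 2 * clamp (x 0 a).
Proof.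
move=> k3; have a2 : a%:R <= 2 :> R by rewrite ler_nat -ltnS (leq_trans (ltn_ord a)).
have cosP i : cos (probe x 0 (lift ord0 i)) = (i%:R + clamp (x 0 i)) / 5.
  by rewrite probeS acosK // in_itv /=; have := probe_range x i k3; lra.
have sinP i : 4 / 5 <= sin (probe x 0 (lift ord0 i)).
  rewrite probeS sin_acos; last by have := probe_range x i k3; lra.
  have := probe_range x i k3; set c := ((i%:R + _) / 5) => c01.
  have c2 : c * c <= 3 / 5 * (3 / 5) by apply: ler_pM; lra.
  rewrite -[4 / 5]ger0_norm; last lra.
  rewrite -sqrtr_sqr ler_sqrt !expr2; lra.
have S : \sum_(i < k) clamp (5 * `|cos (probe x 0 (lift ord0 i))| - a%:R) =
    \sum_(i < k) ((a < i)%N)%:R + clamp (x 0 a).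
  rewrite (bigD1 a) //= [in RHS](bigD1 a) //= ltnn add0r addrC; congr (_ + _).
    apply: eq_bigr => i ia; rewrite cosP ger0_norm; last first.
      by have := probe_range x i k3; lra.
    have cP := clampP (x 0 i); case: ltngtP => [ai|ai|/val_inj aia]; last first.
    - by rewrite aia eqxx in ia.
    - rewrite clamp_lo //; move: ai; rewrite -(ler_nat R) -natr1; lra.
    - rewrite clamp_hi //; move: ai; rewrite -(ler_nat R) -natr1; lra.
  rewrite cosP ger0_norm; last by have := probe_range x a k3; lra.
  rewrite (_ : 5 * _ - _ = clamp (x 0 a)); first exact: clamp_mid (clampP _).
  by move: (clamp _) => y; field.
rewrite /gauge big_ord_recl big_ord_recl subrr cos0 normr1 clamp_hi; last lra.
under eq_bigr => i _ do rewrite probe0 sub0r cosN.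
rewrite S; under [X in _ + X = _]eq_bigr => i _.
  rewrite big_ord_recl probe0 subr0.
  under eq_bigr => j _.
    rewrite clamp_hi; last first.
      rewrite cosB !cosP; have := sinP i; have := sinP j.
      have := probe_range x i k3; have := probe_range x j k3.
      set c := ((i%:R + _) / 5); set d := ((j%:R + _) / 5) => c0 d0 s1 s2.
      rewrite ger0_norm; nra.
    over.
  rewrite sumr_const card_ord; over.
rewrite big_split /= S sumr_const card_ord -mulrnA; lra.
Qed.

(** Normalized gauges [F_a] on the quotient restrict to the coordinates on the cube. The sets
    [F_(a-1) > 0, F_a < 1] for [a <= k] cover the quotient. Group a refinement by the index of
    a set containing each member, and pull back to the cube: this satisfies the boundary
    conditions of the covering lemma, so some point lies in [k + 1] members. *)
Lemma covering_dim_gt_orbit k m (T : topologicalType) (f : 'rV[R]_k.+1 -> T) :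
  (k <= 3)%N -> (m < k)%N -> orbit_map f -> ~ covering_dim_le T m.
Proof.
move=> k3 mk [fsurj fopen fangle_equiv] dimT.
have [sec secK] := choice fsurj.
have fcont : continuous f by apply/continuousP => U /fopen.
pose base (a : nat) : R := 1 + 2 * \sum_(i < k) ((a < i)%N)%:R + (k * k)%:R.
pose F a y := (gauge a (sec y) - base a) / 2.
have Ff a t : F a (f t) = (gauge a t - base a) / 2.
  by rewrite /F (gauge_angle_equiv a (iffLR (fangle_equiv _ _) (secK (f t)))).
have Fopen a (V : set R) : open V -> open (F a @^-1` V).
  move=> Vo; apply/fopen; rewrite -comp_preimage.
  rewrite (_ : F a \o f = fun t => (gauge a t - base a) / 2); last by apply/funext => t; exact: Ff.
  apply: open_comp => // t _; move: t.
  apply: contM; last exact: contC.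
  by apply: contB; [exact: gauge_continuous|exact: contC].
have Fprobe (a : 'I_k) x : F a (f (probe x)) = clamp (x 0 a).
  by rewrite Ff gauge_probe // /base; lra.
pose O a : set T := [set y | ((a != 0)%N -> 0 < F a.-1 y) /\ (a != k -> F a y < 1)].
have Oopen a : open (O a).
  have -> : O a = (if a != 0%N then F a.-1 @^-1` [set x | 0 < x] else setT) `&`
                  (if a != k then F a @^-1` [set x | x < 1] else setT).
    apply/seteqP; split => y /=.
      by case=> h1 h2; split; case: ifP.
    by case=> h1 h2; split => h; [move: h1|move: h2]; rewrite h.
  by apply: openI; case: ifP => _; [apply: Fopen; exact: open_gt|exact: openT|
    apply: Fopen; exact: open_lt|exact: openT].
(* The least a with F a y < 1, or k if there is none. *)
have Ocov y : exists2 a, (a <= k)%N & O a y.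
  have ex : exists a, (a == k) || (F a y < 1) by exists k; rewrite eqxx.
  have [a aP amin] := ex_minnP ex; exists a; first by apply: amin; rewrite eqxx.
  split; last by move=> ak; move: aP; rewrite (negPf ak).
  case: a aP amin => // a aP amin _ /=; rewrite (lt_le_trans ltr01) //.
  have [//|] := leP 1 (F a y).
  by move=> h; have := amin a; rewrite h orbT => /(_ isT); rewrite ltnn.
have [|D [[Dopen Dcov] Dref Dcard]] := dimT [set O a | a in `I_k.+1].
  split; first by move=> _ [a _ <-].
  apply/seteqP; split=> // y _; have [a ak Oay] := Ocov y.
  by exists (O a) => //; exists a.
pose idx V := xget 0%N [set a | (a <= k)%N /\ V `<=` O a].
have idxP V : D V -> (idx V <= k)%N /\ V `<=` O (idx V).
  move=> /Dref[_ [a /= ak <-] VO]; rewrite /idx; case: xgetP => [b _ //|].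
  by move=> /(_ a) /not_andP[].
pose U a : set 'rV[R]_k := \bigcup_(V in [set V | D V /\ idx V = a])
  ((f \o @probe k) @^-1` V).
have UO a x : U a x -> (a <= k)%N /\ O a (f (probe x)).
  by move=> [V [DV <-] Vx]; have [? VO] := idxP V DV; split=> //; exact: VO.
have [a|x _|x i _ xi /UO[_ [/(_ isT)]]|x i _ xi /UO[_ [_]]|x _ xU] := @kkm R k U.
- apply: bigcup_open => V [DV _]; apply: open_comp; last exact: Dopen.
  by move=> x _; apply: continuous_comp; [exact: probe_continuous|exact: fcont].
- have : [set: T] (f (probe x)) by [].
  rewrite -Dcov => -[V DV Vx]; have [Vk _] := idxP V DV.
  by exists (idx V) => //; exists V.
- by rewrite /= Fprobe xi clamp_lo // ltxx.
- by rewrite Fprobe xi clamp_hi // ltxx; have := ltn_ord i; case: ltngtP => // _ _ /(_ isT).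
have /choice[W WP] : forall a, exists V, (a <= k)%N -> [/\ D V, idx V = a & V (f (probe x))].
  move=> a; case: (leqP a k) => [/xU[V [DV idxV] Vx]|_]; last by exists set0.
  by exists V.
have := Dcard (f (probe x)); apply/negP.
suff : (`I_k.+1 #<= [set V | D V /\ V (f (probe x))])%card.
  by move=> h; apply/negP => /(card_le_trans h); rewrite card_le_II ltnS leqNgt mk.
have Winj : {in `I_k.+1 &, injective W}.
  move=> a b; rewrite !inE /= !ltnS => ak bk Wab.
  by have [_ <- _] := WP a ak; have [_ <- _] := WP b bk; rewrite Wab.
rewrite -(card_le_eql (inj_card_eq Winj)); apply: subset_card_le => _ [a /= ak <-].
by have [] := WP a ak.
Qed.

End LowerBound.

(** * Angles from squared cosines *)

Section Angles.
Context {R : realType}.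

Lemma sqr_normr (x : R) : `|x| ^+ 2 = x ^+ 2.
Proof. by rewrite real_normK ?num_real. Qed.

(** Subtract the multiple of [pi] given by the floor; the sine is positive in the interior of
    the remaining period. *)
Lemma sin_eq0_int (x : R) : sin x = 0 -> exists n : int, x = n%:~R * pi.
Proof.
move=> sx; have p0 : 0 < pi :> R := pi_gt0 R.
pose n := Num.floor (x / pi); pose y := x - n%:~R * pi.
have /andP[n1 n2] : n%:~R <= x / pi < (n + 1)%:~R := floor_itv _.
have y0 : 0 <= y by rewrite subr_ge0 -ler_pdivlMr.
have y1 : y < pi by rewrite ltrBlDr -[X in X + _]mul1r -mulrDl -ltr_pdivrMr // addrC -intrD1.
have cy : cos y ^+ 2 = 1.
  have xE : x = y + n%:~R * pi by rewrite subrK.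
  have : `|cos x| ^+ 2 = `|cos y| ^+ 2 by rewrite {1}xE cos_int_pi.
  by rewrite !sqr_normr => <-; rewrite cos2sin2 sx expr0n subr0.
have sy : sin y = 0 by apply/eqP; rewrite -sqrf_eq0 sin2cos2 cy subrr.
exists n; apply/eqP; rewrite -subr_eq0 -/y; apply/eqP/le_anti; rewrite y0 andbT.
by rewrite leNgt; apply/negP => y2; have := sin_gt0_pi (introT andP (conj y2 y1)); rewrite sy ltxx.
Qed.

Lemma cos_double (x : R) : cos (2 * x) = 2 * cos x ^+ 2 - 1.
Proof. by rewrite mulr_natl cos_mulr2n mulr_natl. Qed.

Lemma cos_sin_sq (x : R) : cos x * cos x + sin x * sin x = 1.
Proof. by rewrite -!expr2 cos2Dsin2. Qed.

(** Doubling the angles turns squared cosines into cosines. With one angle subtracted, unit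
    vectors with equal pairwise inner products and equal first coordinates have the same second
    coordinates up to one common sign. Halving the angles leaves multiples of [pi]. *)
Lemma angle_equiv_of_cos2 k (t u : 'rV[R]_k) :
  (forall p q, cos (u 0 p - u 0 q) ^+ 2 = cos (t 0 p - t 0 q) ^+ 2) -> angle_equiv t u.
Proof.
case: k t u => [|k] t u cosE.
  by exists 1%g, false, 0, (fun=> 0) => -[].
pose a p := 2 * (t 0 p - t 0 0); pose b p := 2 * (u 0 p - u 0 0).
have ab p : cos (b p) = cos (a p) by rewrite /a /b !cos_double cosE.
have abB p q : cos (b p - b q) = cos (a p - a q).
  have -> : b p - b q = 2 * (u 0 p - u 0 q) by rewrite /b; ring.
  have -> : a p - a q = 2 * (t 0 p - t 0 q) by rewrite /a; ring.
  by rewrite !cos_double cosE.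
have sinsin p q : sin (b p) * sin (b q) = sin (a p) * sin (a q).
  by have := abB p q; rewrite !cosB !ab => /addrI.
have [e eE] : exists e : bool, forall p, sin (b p) = (-1) ^+ e * sin (a p).
  have [/forallP s0|/existsP[q qn0]] := boolP [forall p, sin (a p) == 0].
    exists false => p; rewrite (eqP (s0 p)) mulr0; apply/eqP.
    by have := sinsin p p; rewrite (eqP (s0 p)) mul0r => /eqP; rewrite mulf_eq0 orbb.
  have : (sin (b q) - sin (a q)) * (sin (b q) + sin (a q)) = 0.
    by rewrite -subr_sqr !expr2 sinsin subrr.
  move=> /eqP; rewrite mulf_eq0 subr_eq0 addr_eq0 => /orP[]/eqP bq.
    exists false => p; rewrite expr0 mul1r; apply: (mulIf qn0).
    by rewrite -sinsin bq.
  exists true => p; rewrite expr1 mulN1r; apply: (mulIf qn0).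
  by rewrite mulNr -sinsin bq mulrN opprK.
pose d p := (u 0 p - u 0 0) - (-1) ^+ e * (t 0 p - t 0 0).
have sd p : sin (d p) = 0.
  have : cos (2 * d p) = 1.
    rewrite (_ : 2 * d p = b p - (-1) ^+ e * a p); last by rewrite /d /a /b; ring.
    rewrite cosB ab eE; case: (e); rewrite ?expr1 ?expr0 ?mulN1r ?mul1r ?cosN ?sinN ?mulrNN.
      exact: cos_sin_sq.
    exact: cos_sin_sq.
  rewrite cos_double => c2; apply/eqP; rewrite -sqrf_eq0 sin2cos2; lra.
have /choice[m mE] p := sin_eq0_int (sd p).
exists 1%g, e, (u 0 0 - (-1) ^+ e * t 0 0), m => p.
by rewrite perm1 -mE /d; ring.
Qed.

Lemma angle_equivP k (t u : 'rV[R]_k) : angle_equiv t u <-> exists s : 'S_k,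
  forall p q, cos (u 0 p - u 0 q) ^+ 2 = cos (t 0 (s p) - t 0 (s q)) ^+ 2.
Proof.
split=> [/angle_equiv_cos[s sE]|[s sE]].
  by exists s => p q; rewrite -[LHS]sqr_normr sE sqr_normr.
have [|s' [b [c [m uE]]]] := @angle_equiv_of_cos2 _ (\row_p t 0 (s p)) u.
  by move=> p q; rewrite !mxE.
by exists (s' * s)%g, b, c, m => p; rewrite uE mxE permM.
Qed.

Lemma angleP (x y : R) : x ^+ 2 + y ^+ 2 = 1 ->
  exists2 t, - pi <= t <= pi & cos t = x /\ sin t = y.
Proof.
move=> xy1; have x1 : -1 <= x <= 1.
  by rewrite -ler_norml -(@expr_le1 _ 2) // real_normK ?num_real //; have := sqr_ge0 y; lra.
have sE : sin (acos x) = `|y|.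
  by rewrite sin_acos // -sqrtr_sqr; congr Num.sqrt; lra.
have p0 := pi_gt0 R; have a0 := acos_ge0 x1; have a1 := acos_lepi x1.
have cE : cos (acos x) = x by rewrite acosK // in_itv.
have [y0|y0] := leP 0 y; [exists (acos x)|exists (- acos x)]; try lra.
  by rewrite cE sE ger0_norm.
by rewrite cosN sinN cE sE ltr0_norm // opprK.
Qed.

End Angles.

(** * Cosine matrices have Moore rank at most two *)

Section QuaternionCalculus.
Context {R : realType}.
Implicit Types (x y z : quat R) (a : R).

Lemma quatP x y : qre x = qre y -> qi x = qi y -> qj x = qj y -> qk x = qk y -> x = y.
Proof. by case: x y => [? ? ? ?] [? ? ? ?] /= -> -> -> ->. Qed.

Lemma coordD (x y : quat R) : (qre (x + y) = qre x + qre y) * (qi (x + y) = qi x + qi y) *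
  (qj (x + y) = qj x + qj y) * (qk (x + y) = qk x + qk y).
Proof. by []. Qed.
Lemma coordN (x : quat R) : (qre (- x) = - qre x) * (qi (- x) = - qi x) *
  (qj (- x) = - qj x) * (qk (- x) = - qk x).
Proof. by []. Qed.
Lemma coordZ a (x : quat R) : (qre (a *: x) = a * qre x) * (qi (a *: x) = a * qi x) *
  (qj (a *: x) = a * qj x) * (qk (a *: x) = a * qk x).
Proof. by []. Qed.
Lemma coordM (x y : quat R) :
  (qre (x * y) = qre x * qre y - qi x * qi y - qj x * qj y - qk x * qk y) *
  (qi (x * y) = qre x * qi y + qi x * qre y + qj x * qk y - qk x * qj y) *
  (qj (x * y) = qre x * qj y - qi x * qk y + qj x * qre y + qk x * qi y) *
  (qk (x * y) = qre x * qk y + qi x * qj y - qj x * qi y + qk x * qre y).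
Proof. by []. Qed.
Lemma coordC (x : quat R) : (qre (qconj x) = qre x) * (qi (qconj x) = - qi x) *
  (qj (qconj x) = - qj x) * (qk (qconj x) = - qk x).
Proof. by []. Qed.
Lemma coord01 : (qre (0 : quat R) = 0) * (qi (0 : quat R) = 0) * (qj (0 : quat R) = 0) *
  (qk (0 : quat R) = 0) * (qre (1 : quat R) = 1) * (qi (1 : quat R) = 0) *
  (qj (1 : quat R) = 0) * (qk (1 : quat R) = 0).
Proof. by []. Qed.
Definition coordE := (coordD, coordN, coordZ, coordM, coordC, coord01).

Lemma qconjZ a x : qconj (a *: x) = a *: qconj x.
Proof. by apply: quatP; rewrite !coordE ?mulrN. Qed.

(** The orthonormal basis of the quaternions, indexed by position. *)
Definition qunit (n : nat) : quat R :=
  match n with 0%N => 1 | 1%N => ii | 2%N => jj | _ => kk end.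

Lemma ord_small k (i : 'I_k) : (k <= 4)%N ->
  [\/ i = 0 :> nat, i = 1 :> nat, i = 2 :> nat | i = 3 :> nat].
Proof.
move=> k4; case: i => -[|[|[|[|i]]]] /= ik;
  [constructor 1|constructor 2|constructor 3|constructor 4|] => //.
by have := leq_trans ik k4.
Qed.

Lemma ord2P (l : 'I_2) : l = 0 \/ l = 1.
Proof. by case: l => -[|[|//]] hl; [left|right]; apply/val_inj. Qed.

Lemma ord2_liftP (l : 'I_2) : l = ord0 \/ l = lift ord0 ord0.
Proof. by case: l => -[|[|//]] hl; [left|right]; apply/val_inj. Qed.

Lemma ord3_liftP (l : 'I_3) :
  [\/ l = ord0, l = lift ord0 ord0 | l = lift ord0 (lift ord0 ord0)].
Proof.
by case: l => -[|[|[|//]]] hl; [constructor 1|constructor 2|constructor 3]; apply/val_inj.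
Qed.

Lemma qunit_conj n : qconj (qunit n) * qunit n = 1.
Proof. by case: n => [|[|[|n]]]; apply: quatP; rewrite ?coordE /=; ring. Qed.

Lemma qunit_conjr n : qunit n * qconj (qunit n) = 1.
Proof. exact/qmulVr/qunit_conj. Qed.

(** The real symmetric matrix with diagonal 1 that underlies [M_lam]. *)
Definition lam_full k (lam : pairs k -> R) (p q : 'I_k) : R :=
  if p == q then 1 else lam_at lam p q.

(** The units in [M_lam] are products of the basis units, so [M_lam] is conjugate to a real matrix
    by a diagonal matrix of units. *)
Lemma M_lamE k (lam : pairs k -> R) p q : (k <= 4)%N ->
  M_lam lam p q = lam_full lam p q *: (qconj (qunit p) * qunit q).
Proof.
move=> k4; rewrite mxE /lam_full; case: eqVneq => [->|pq].
  by rewrite qunit_conj scale1r.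
congr (_ *: _); move: pq; rewrite -val_eqE /=.
by case: (ord_small p k4) => ->; case: (ord_small q k4) => -> // _;
  apply: quatP; rewrite ?coordE /=; ring.
Qed.

Lemma lam_atC k (lam : pairs k -> R) p q : lam_at lam p q = lam_at lam q p.
Proof.
rewrite /lam_at; case: insubP => [u /= pq _|/= pq]; case: insubP => [v /= qp _|/= qp] //=.
by have := ltn_trans pq qp; rewrite ltnn.
Qed.

Lemma lam_fullC k (lam : pairs k -> R) p q : lam_full lam p q = lam_full lam q p.
Proof. by rewrite /lam_full eq_sym lam_atC. Qed.

Lemma lam_at_lt k (lam : pairs k -> R) (pq : pairs k) :
  lam_at lam (val pq).1 (val pq).2 = lam pq.
Proof. by rewrite /lam_at -surjective_pairing valK. Qed.

Lemma lam_at_in k (P : R -> Prop) (lam : pairs k -> R) p q :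
  p != q -> (forall pq, P (lam pq)) -> P (lam_at lam p q).
Proof.
wlog pq : p q / (p < q)%N.
  move=> wl npq lamP; case: (ltngtP p q) => [pq|pq|/val_inj pq]; first exact: wl.
    by rewrite lam_atC; apply: wl => //; rewrite eq_sym.
  by rewrite pq eqxx in npq.
by move=> _ lamP; rewrite (lam_at_lt lam (exist _ (p, q) pq)); exact: lamP.
Qed.

Definition cos_tuple k (t : 'rV[R]_k) : pairs k -> R :=
  fun pq => cos (t 0 (val pq).1 - t 0 (val pq).2).

Lemma lam_at_cos k (t : 'rV[R]_k) p q :
  p != q -> lam_at (cos_tuple t) p q = cos (t 0 p - t 0 q).
Proof.
wlog pq : p q / (p < q)%N.
  move=> wl npq; case: (ltngtP p q) => [pq|pq|/val_inj pq]; first exact: wl.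
    by rewrite lam_atC -cosN opprB; apply: wl => //; rewrite eq_sym.
  by rewrite pq eqxx in npq.
by move=> _; rewrite (lam_at_lt (cos_tuple t) (exist _ (p, q) pq)).
Qed.

Lemma lam_full_cos k (t : 'rV[R]_k) p q : lam_full (cos_tuple t) p q = cos (t 0 p - t 0 q).
Proof.
by rewrite /lam_full; case: eqVneq => [->|/lam_at_cos //]; rewrite subrr cos0.
Qed.

Lemma moore_rank_factor k r (B : 'M[quat R]_(k, r)) (C : 'M[quat R]_(r, k))
    (B' : 'M[quat R]_(r, k)) (C' : 'M[quat R]_(k, r)) :
  B' *m B = 1%:M -> C *m C' = 1%:M -> has_moore_rank (B *m C) r.
Proof.
move=> B'B CC'; exists B; split=> [x y /(congr1 (mulmx B'))|].
  by rewrite !mulmxA B'B !mul1mx.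
apply/seteqP; split=> [_ [x _ <-]|_ [y _ <-]].
  by exists (C *m x) => //; rewrite mulmxA.
by exists (C' *m y) => //; rewrite mulmxA -(mulmxA B) CC' mulmx1.
Qed.

(** [M = C* C] for [C = W diag (e_p)], and [C] has a right inverse because [W] has one. *)
Lemma real_factor_rank k r (W : 'M[R]_(r, k)) (W' : 'M[R]_(k, r)) (M : 'M[quat R]_k) :
  W *m W' = 1%:M ->
  (forall p q, M p q = (W^T *m W) p q *: (qconj (qunit p) * qunit q)) ->
  has_moore_rank M r.
Proof.
move=> WW' ME.
pose C := \matrix_(i, p) (W i p *: qunit p).
pose C' := \matrix_(p, i) (W' p i *: qconj (qunit p)).
have CC' : C *m C' = 1%:M.
  apply/matrixP => i j; rewrite !mxE.
  transitivity ((W *m W') i j *: (1 : quat R)); last first.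
    by rewrite WW' mxE; case: eqP => _; rewrite ?mulr1n ?mulr0n ?scale1r ?scale0r.
  rewrite mxE scaler_suml; apply: eq_bigr => p _.
  by rewrite !mxE -scalerAl -scalerAr qunit_conjr scalerA.
have -> : M = adjointmx C *m C.
  apply/matrixP => p q; rewrite ME !mxE scaler_suml; apply: eq_bigr => i _.
  by rewrite !mxE qconjZ -scalerAl -scalerAr scalerA.
apply: (moore_rank_factor (B' := adjointmx C') _ CC').
by rewrite -adjointmxM CC' adjointmx1.
Qed.

(** The matrix of cosines of differences is the Gram matrix of the plane unit vectors
    [(cos t_p, sin t_p)]. Its rank is 2 if two of these are independent, and 1 otherwise. *)
Lemma cos_tuple_Lam k (t : 'rV[R]_k.+1) : (k < 4)%N -> Lam R k.+1 (cos_tuple t).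
Proof.
move=> k4; split=> [pq|]; first by rewrite cos_geN1 cos_le1.
have [/existsP[a /existsP[b sab]]|/existsPn s0] :=
    boolP [exists a, exists b, sin (t 0 b - t 0 a) != 0].
  exists 2%N => //.
  pose W : 'M[R]_(2, k.+1) := \matrix_(i, p) if i == 0 then cos (t 0 p) else sin (t 0 p).
  pose s := sin (t 0 b - t 0 a).
  have ab : a != b by apply: contraNneq sab => ->; rewrite subrr sin0.
  (* Inverting the two independent columns a and b of W gives a right inverse of W. *)
  pose W' : 'M[R]_(k.+1, 2) := \matrix_(p, i)
    (if p == a then (if i == 0 then sin (t 0 b) else - cos (t 0 b)) / s else
     if p == b then (if i == 0 then - sin (t 0 a) else cos (t 0 a)) / s else 0).
  apply: (@real_factor_rank _ _ W W').
    apply/matrixP => i j; rewrite mxE (bigD1 a) //= (bigD1 b) ?(eq_sym b) //=.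
    rewrite big1 ?addr0; last first.
      by move=> p /andP[/negPf pa /negPf pb]; rewrite !mxE pa pb mulr0.
    rewrite !mxE eqxx (eq_sym b) (negPf ab) eqxx.
    have sE : s = sin (t 0 b) * cos (t 0 a) - cos (t 0 b) * sin (t 0 a) by rewrite /s sinB.
    by case: (ord2P i) => ->; case: (ord2P j) => -> /=; rewrite !mulrA -mulrDl;
      (apply: (canLR (mulfK sab)); rewrite -/s sE ?mul0r ?mul1r; ring).
  move=> p q; rewrite M_lamE // lam_full_cos; congr (_ *: _).
  by rewrite !mxE big_ord_recl big_ord1 !mxE /= cosB.
exists 1%N => //.
have s0' p q : sin (t 0 p - t 0 q) = 0.
  by have := s0 q; rewrite negb_exists => /forallP/(_ p); rewrite negbK => /eqP.
apply: (@real_factor_rank _ _ (\row_p cos (t 0 p - t 0 0)) (delta_mx 0 0)).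
  apply/matrixP => i j; rewrite mxE (bigD1 0) //= big1 ?addr0; last first.
    by move=> p p0; rewrite !mxE (negPf p0) mulr0.
  by rewrite !mxE !ord1 /= subrr cos0 mulr1.
move=> p q; rewrite M_lamE // lam_full_cos; congr (_ *: _).
rewrite !mxE big_ord1 !mxE.
rewrite (_ : t 0 p - t 0 q = (t 0 p - t 0 0) - (t 0 q - t 0 0)); last by ring.
by rewrite cosB s0' mul0r addr0.
Qed.

End QuaternionCalculus.

(** * Moore rank at most two forces cosines *)

Section LamAngles.
Context {R : realType}.

(** A left inverse makes the quaternionic matrix injective on vectors; compare real
    dimensions. *)
Lemma quat_invariant_basis (m r : nat) (B : 'M[quat R]_(m, r)) (C : 'M[quat R]_(r, m)) :
  B *m C = 1%:M -> (m <= r)%N.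
Proof.
move=> BC1.
pose h (x : {ffun 'I_m -> quat R}) : {ffun 'I_r -> quat R} :=
  [ffun i => \sum_j C i j * x j].
have hlin : linear h.
  move=> a x y; apply/ffunP => i; rewrite !ffunE scaler_sumr -big_split /=.
  by apply: eq_bigr => j _; rewrite !ffunE mulrDr -scalerAr.
pose hL := GRing.isLinear.Build _ _ _ _ h hlin.
pose H : {linear {ffun 'I_m -> quat R} -> {ffun 'I_r -> quat R}} := HB.pack h hL.
have kerH : lker (linfun H) = 0%VS.
  apply/eqP/lker0P => x y; rewrite !lfunE /= => hxy; apply/ffunP => l.
  have lE (z : {ffun 'I_m -> quat R}) : z l = \sum_i B l i * (h z) i.
    transitivity (\sum_j (B *m C) l j * z j).
      rewrite BC1 (bigD1 l) //= mxE eqxx mul1r big1 ?addr0 // => j jl.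
      by rewrite mxE eq_sym (negPf jl) mul0r.
    under eq_bigr do rewrite mxE mulr_suml.
    rewrite exchange_big /=; apply: eq_bigr => i _; rewrite ffunE mulr_sumr.
    by apply: eq_bigr => j _; rewrite mulrA.
  by rewrite (lE x) (lE y) hxy.
have := limg_dim_eq (f := linfun H) (U := fullv); rewrite kerH capv0 => /(_ erefl) dimH.
have := dimvS (subvf (limg (linfun H))); rewrite dimH !dimvf /dim /=.
by rewrite !card_ord leq_pmul2r.
Qed.

Lemma moore_rank_factorization k r (M : 'M[quat R]_k) : has_moore_rank M r ->
  exists (B : 'M[quat R]_(k, r)) (C : 'M[quat R]_(r, k)), M = B *m C.
Proof.
move=> [B [_ MB]]; exists B.
have /choice[c cE] q : exists c : 'cV[quat R]_r, B *m c = M *m delta_mx q 0.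
  have : range (fun x : 'cV[quat R]_k => M *m x) (M *m delta_mx q 0) by exists (delta_mx q 0).
  by rewrite MB => -[c _ <-]; exists c.
exists (\matrix_(i, q) c q i 0); apply/matrixP => p q.
have := congr1 (fun v : 'cV[quat R]_k => v p 0) (cE q); rewrite -colE !mxE => <-.
by apply: eq_bigr => i _; rewrite mxE.
Qed.

Lemma det3 (F : nat -> nat -> R) :
  \det (\matrix_(i < 3, j < 3) F i j) =
    F 0 0 * (F 1 1 * F 2 2 - F 1 2 * F 2 1)
  - F 0 1 * (F 1 0 * F 2 2 - F 1 2 * F 2 0)
  + F 0 2 * (F 1 0 * F 2 1 - F 1 1 * F 2 0).
Proof.
rewrite (expand_det_row _ ord0) !big_ord_recl big_ord0 /cofactor.
rewrite !(expand_det_row _ ord0) !big_ord_recl !big_ord0 /cofactor !det_mx11 !mxE /=.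
rewrite /bump /=; ring.
Qed.

(** If the minor were nonzero, an invertible real 3 x 3 matrix, conjugate by units to a block of
    [M_lam], would factor through at most two quaternionic dimensions. *)
Lemma lam_minor k (lam : pairs k -> R) (f g : nat -> 'I_k) : (k <= 4)%N -> Lam R k lam ->
  \det (\matrix_(i < 3, j < 3) lam_full lam (f i) (g j)) = 0.
Proof.
move=> k4 [_ [r rank_r r2]]; have [B [C MBC]] := moore_rank_factorization rank_r.
set N := \matrix_(i, j) _; apply/eqP; apply: contraTT r2 => detN.
have Nu : N \in unitmx by rewrite unitmxE unitfE.
pose B1 := \matrix_(i < 3, l < r) (qunit (f i) * B (f i) l).
pose C1 := \matrix_(l < r, j < 3) (C l (g j) * qconj (qunit (g j))).
have N_BC : map_mx (in_alg (quat R)) N = B1 *m C1.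
  apply/matrixP => i j; rewrite !mxE.
  transitivity (qunit (f i) * M_lam lam (f i) (g j) * qconj (qunit (g j))).
    rewrite M_lamE // -scalerAr -scalerAl !mulrA qunit_conjr mul1r.
    by rewrite qunit_conjr.
  rewrite MBC mxE mulr_sumr mulr_suml; apply: eq_bigr => l _.
  by rewrite !mxE !mulrA.
rewrite -ltnNge; apply: (@quat_invariant_basis _ _ B1 (C1 *m map_mx (in_alg (quat R)) (invmx N))).
by rewrite mulmxA -N_BC -map_mxM /= mulmxV // map_mx1.
Qed.

(** A real symmetric matrix with diagonal 1, entries at most 1 in absolute value and vanishing
    3 x 3 minors is the Gram matrix of plane vectors. If some [|L a b| < 1], orthonormalize the
    vectors of [a] and [b]; then [L a r] and [(L b r - c L a r) / s], with [c = L a b] and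
    [s^2 = 1 - c^2], must be the coordinates of the vector of [r], and the minor
    on rows [a, b, r] and columns [a, b, q] says that they have the right inner products. If
    all [|L p q| = 1], the minors say that [L p q = L 0 p * L 0 q]. *)
Lemma lam_planar k (lam : pairs k.+1 -> R) : (k < 4)%N -> Lam R k.+1 lam ->
  exists x y : 'I_k.+1 -> R, forall p q, lam_full lam p q = x p * x q + y p * y q.
Proof.
move=> k4 lamP; set L := lam_full lam.
have L1 p : L p p = 1 by rewrite /L /lam_full eqxx.
have LC p q : L p q = L q p by exact: lam_fullC.
have Lsq p q : L p q ^+ 2 <= 1.
  rewrite /L /lam_full; case: eqVneq => [_|pq]; first by rewrite expr1n.
  have := lam_at_in (P := fun x => -1 <= x <= 1) pq (proj1 lamP).
  by rewrite -ler_norml => h; rewrite -sqr_normr expr_le1.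
have minor a b c d e f :
    L a d * (L b e * L c f - L b f * L c e) - L a e * (L b d * L c f - L b f * L c d)
    + L a f * (L b d * L c e - L b e * L c d) = 0.
  have := lam_minor (fun i => nth a [:: a; b; c] i) (fun i => nth a [:: d; e; f] i) k4 lamP.
  by rewrite (det3 (fun i j => L (nth a [:: a; b; c] i) (nth a [:: d; e; f] j))).
have [/existsP[a /existsP[b ab]]|/existsPn L1all] :=
    boolP [exists a, exists b, L a b ^+ 2 != 1].
  set c := L a b in ab *.
  have c1 : 0 < 1 - c ^+ 2 by rewrite subr_gt0 lt_neqAle ab Lsq.
  pose s := Num.sqrt (1 - c ^+ 2).
  have s0 : s != 0 by rewrite gt_eqF // sqrtr_gt0.
  have ss : s * s = 1 - c ^+ 2 by rewrite -expr2 sqr_sqrtr // ltW.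
  exists (L a), (fun r => (L b r - c * L a r) / s) => r q.
  have := minor a b r a b q; rewrite !L1 (LC b a) -/c (LC r a) (LC r b) => h.
  rewrite mulrACA -invfM ss; apply: (mulIf (lt0r_neq0 c1)).
  rewrite mulrDl divfK ?gt_eqF //; move: h; set A := L a r; set B := L b r.
  set A' := L a q; set B' := L b q; set Z := L r q => h; lra.
exists (L ord0), (fun=> 0) => p q; rewrite mulr0 addr0.
have sq1 p' q' : L p' q' ^+ 2 = 1.
  by have := L1all p'; rewrite negb_exists => /forallP/(_ q'); rewrite negbK => /eqP.
have := minor ord0 p q ord0 p q; rewrite !L1 (LC p ord0) (LC q ord0) (LC q p).
have := sq1 ord0 p; have := sq1 ord0 q; have := sq1 p q; rewrite !expr2.
set A := L ord0 p; set B := L ord0 q; set Z := L p q => z2 b2 a2 h.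
have h1 : A * B * Z = 1 by lra.
have : Z = (A * B * Z) * (A * B).
  by rewrite (_ : _ * _ = (A * A) * (B * B) * Z); [rewrite a2 b2 !mul1r|ring].
by rewrite h1 mul1r.
Qed.

Lemma lam_angles k (lam : pairs k.+1 -> R) : (k < 4)%N -> Lam R k.+1 lam ->
  exists2 t : 'rV[R]_k.+1, forall i, - pi <= t 0 i <= pi & lam = cos_tuple t.
Proof.
move=> k4 lamP; have [x [y xyE]] := lam_planar k4 lamP.
have /choice[t tP] p : exists t, - pi <= t <= pi /\ (cos t = x p /\ sin t = y p).
  have [|t tp cs] := @angleP R (x p) (y p); last by exists t.
  by have := xyE p p; rewrite /lam_full eqxx !expr2.
exists (\row_p t p) => [i|]; first by rewrite mxE; have [] := tP i.
apply/funext => pq; rewrite -[LHS]lam_at_lt /cos_tuple !mxE cosB.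
have [_ [-> ->]] := tP (val pq).1; have [_ [-> ->]] := tP (val pq).2.
rewrite -xyE /lam_full; case: eqP => // e; have := valP pq.
by rewrite /= e ltnn.
Qed.

End LamAngles.

(** * The parameter space as a quotient of the space of angles *)

Section Topology.
Context {R : realType}.

Lemma continuous_ptws (T Y : topologicalType) (I : eqType) (g : T -> {ptws I -> Y}) :
  (forall i, continuous (fun x => g x i)) -> continuous g.
Proof.
move=> gc x; apply/cvg_sup => i U [/= _ [[W oW <-]] /= Wg]; move/filterS; apply.
exact: (gc i x W (open_nbhs_nbhs (conj oW Wg))).
Qed.

Lemma ptws_proj_continuous (Y : topologicalType) (I : eqType) (i : I) :
  continuous (fun g : {ptws I -> Y} => g i).
Proof. by move=> g; exact: (@proj_continuous I (fun=> Y) i g). Qed.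

(** Projection along a compact factor is a closed map. *)
Lemma closed_projection (S P : topologicalType) (A : set P) (E : set (S * P)) :
  compact A -> closed E -> closed [set s | exists2 p, A p & E (s, p)].
Proof.
move=> /compact_near_coveringP cA cE; rewrite -openC openE => s0 s0E.
have near_s : \forall s \near s0, A `<=` (fun p => ~ E (s, p)).
  apply: (cA S (nbhs s0) (fun s p => ~ E (s, p))) => p Ap.
  have nE : ~ E (s0, p) by move=> Esp; apply: s0E; exists p.
  have [[/= U V] [Us0 Vp] UV] : nbhs (s0, p) (~` E).
    by apply: open_nbhs_nbhs; split=> //; exact: closed_openC.
  by exists (V, U) => // -[p' s] [/= Vp' Us]; exact: (UV (s, p')).
by apply: filterS near_s => s sE /= [p Ap Esp]; exact: (sE p Ap).
Qed.

Lemma closed_zero (S : topologicalType) (f : S -> R) :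
  continuous f -> closed [set s | f s = 0].
Proof.
by move=> fc; apply: (@preimage_closed _ _ f [set 0]).
Qed.

Lemma continuous_compT (S T U : topologicalType) (f : S -> T) (g : T -> U) :
  continuous f -> continuous g -> continuous (fun x => g (f x)).
Proof. by move=> fc gc x; apply: continuous_comp; [exact: fc|exact: gc]. Qed.

Lemma cont_fst (S T : topologicalType) : continuous (fun x : S * T => x.1).
Proof. by move=> x; exact: cvg_fst. Qed.
Lemma cont_snd (S T : topologicalType) : continuous (fun x : S * T => x.2).
Proof. by move=> x; exact: cvg_snd. Qed.

Section LamOrbits.
Variables (k : nat).
Hypothesis k4 : (k < 4)%N.

Definition cos_point (t : 'rV[R]_k.+1) : Lam R k.+1 :=
  exist _ (cos_tuple t) (mem_set (cos_tuple_Lam t k4)).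

Definition cos_class (t : 'rV[R]_k.+1) : X R k.+1 := \pi_(X R k.+1) (cos_point t).

Lemma cos_point_surj (lam : Lam R k.+1) :
  exists2 t : 'rV[R]_k.+1, forall i, - pi <= t 0 i <= pi & cos_point t = lam.
Proof.
have [t tP lamE] := lam_angles k4 (set_mem (valP lam)).
by exists t => //; apply: val_inj; rewrite /= -lamE.
Qed.

Lemma pi_lam_eq (x y : Lam R k.+1) : \pi_(X R k.+1) x = \pi_(X R k.+1) y <-> lam_equiv x y.
Proof. exact: (rwP (@eqmodP _ (lam_equivrel R k.+1) x y)). Qed.

(** Sign changes do not affect squares. *)
Lemma lam_equiv_perm (x y : Lam R k.+1) : lam_equiv x y ->
  exists s : 'S_k.+1, forall p q, lam_full (set_val y) p q ^+ 2 =
    lam_full (set_val x) (s p) (s q) ^+ 2.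
Proof.
move=> /asboolP; elim=> {x y} [x y [[e yE]|[s yE]]|x|x y _ [s sE]|x y z _ [s sE] _ [s' s'E]].
- exists 1%g => p q; rewrite !perm1 yE /lam_full; case: eqVneq => // pq.
  wlog lpq : p q pq / (p < q)%N.
    move=> wl; case: (ltngtP p q) => [h|h|/val_inj h]; first exact: wl.
      by rewrite lam_atC (lam_atC (set_val x)); apply: wl => //; rewrite eq_sym.
    by rewrite h eqxx in pq.
  have lt (l : pairs k.+1 -> R) := lam_at_lt l (exist _ (p, q) lpq).
  by rewrite !lt /sgn_act /= !exprMn !sqrr_sign !mul1r.
- exists s => p q; rewrite yE /lam_full (inj_eq perm_inj); case: eqVneq => // pq.
  wlog lpq : p q pq / (p < q)%N.
    move=> wl; case: (ltngtP p q) => [h|h|/val_inj h]; first exact: wl.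
      by rewrite lam_atC (lam_atC (set_val x)); apply: wl => //; rewrite eq_sym.
    by rewrite h eqxx in pq.
  by have lt (l : pairs k.+1 -> R) := lam_at_lt l (exist _ (p, q) lpq); rewrite !lt.
- by exists 1%g => p q; rewrite !perm1.
- by exists (s^-1)%g => p q; rewrite sE !permKV.
- by exists (s' * s)%g => p q; rewrite s'E sE !permM.
Qed.

(** From left to right, squared cosines are a complete invariant of angles. From right to left, a
    translation by [m_p pi] changes the sign of row and column [p] according to the parity of
    [m_p], and cosine is even. *)
Lemma cos_class_eq (t u : 'rV[R]_k.+1) : cos_class t = cos_class u <-> angle_equiv t u.
Proof.
rewrite pi_lam_eq; split=> [/lam_equiv_perm[s sE]|].
  apply/angle_equivP; exists s => p q.
  by have := sE p q; rewrite /= !lam_full_cos.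
move=> [s [b [c [m uE]]]]; apply/asboolP.
pose t' : 'rV[R]_k.+1 := \row_p t 0 (s p).
apply: (@rst_trans _ _ _ (cos_point t')); apply: rst_step.
  right; exists s; apply/funext => pq.
  change (cos_tuple t' pq = perm_act s (cos_tuple t) pq).
  rewrite /perm_act {1}/cos_tuple !mxE lam_at_cos // (inj_eq perm_inj).
  by have := valP pq; apply: contraTneq => ->; rewrite ltnn.
left; exists [ffun p => odd `|m p|%N]; apply/funext => pq.
change (cos_tuple u pq = sgn_act [ffun p => odd `|m p|%N] (cos_tuple t') pq).
rewrite /sgn_act /cos_tuple !uE !mxE !ffunE.
set p := (val pq).1; set q := (val pq).2.
have cosZ x (n : int) : cos (x + n%:~R * pi) = (-1) ^+ odd `|n|%N * cos x.
  rewrite antiperiodic; last exact: cosDpi.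
  by case: (odd _); rewrite ?expr1 ?expr0 ?mulN1r ?mul1r.
rewrite (_ : _ - _ = ((-1) ^+ b * (t 0 (s p) - t 0 (s q)) + (m p)%:~R * pi) + (- m q)%:~R * pi).
  rewrite !cosZ abszN mulrA [X in X * _ = _]mulrC; congr (_ * _).
  by case: (b); rewrite ?expr1 ?expr0 ?mul1r // mulN1r cosN.
by rewrite rmorphN; ring.
Qed.

Lemma cos_point_continuous : continuous cos_point.
Proof.
apply: continuous_comp_initial; apply: continuous_ptws => pq.
apply: cont_comp; first exact: continuous_cos.
by apply: contB; apply: coord_continuous.
Qed.

(** A set with open preimage is open because the complement of its preimage is the projection of
    a closed set along the compact box of angles. *)
Lemma cos_class_orbit_map : orbit_map cos_class.
Proof.
split=> [x|U|t u]; last exact: cos_class_eq.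
  by have [t _ tE] := cos_point_surj (repr x); exists t; rewrite /cos_class tE reprK.
split=> [Uo|Uo].
  have : open (\pi_(X R k.+1) @^-1` U) by [].
  by apply: open_comp => // t _; exact: cos_point_continuous.
rewrite /open /= /quotient_open -closedC.
pose E : set (Lam R k.+1 * 'rV[R]_k.+1) := [set xt | ~ U (cos_class xt.2)] `&`
  \bigcap_(pq in [set: pairs k.+1]) [set xt : Lam R k.+1 * 'rV[R]_k.+1 |
    set_val xt.1 pq - cos (xt.2 0 (val pq).1 - xt.2 0 (val pq).2) = 0].
rewrite (_ : ~` _ = [set x | exists2 t : 'rV[R]_k.+1, (forall i, - pi <= t 0 i <= pi) & E (x, t)]).
  apply: closed_projection; first exact: compact_box.
  apply: closedI.
    apply: (@preimage_closed _ _ snd [set t | ~ U (cos_class t)]).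
      by move=> x _; exact: cvg_snd.
    exact: (open_closedC Uo).
    apply: closed_bigI => pq _; apply: closed_zero; apply: contB.
      apply: (@continuous_compT _ _ _ fst (fun x : Lam R k.+1 => set_val x pq)).
        exact: cont_fst.
      apply: (@continuous_compT _ _ _ set_val (fun g : {ptws pairs k.+1 -> R} => g pq)).
        exact: initial_continuous.
      exact: ptws_proj_continuous.
    apply: cont_comp; first exact: continuous_cos.
    by apply: contB; apply: cont_coord; exact: cont_snd.
apply/seteqP; split=> [x /= nUx|x /= [t _ [/= nU xE]]].
  have [t tP tE] := cos_point_surj x; exists t => //; split=> /=.
    by rewrite /cos_class tE.
  by move=> pq _; rewrite /= -tE subrr.
rewrite (_ : x = cos_point t) //; apply: val_inj; apply/funext => pq.
by apply/eqP; rewrite -subr_eq0; apply/eqP; exact: (xE pq).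
Qed.

End LamOrbits.
End Topology.

(** * Euclidean geometry of the quaternionic plane *)

Section Geometry.
Context {R : realType}.
Implicit Types (v w : H2 R) (q : quat R) (A : 'M[quat R]_2).

(** The Euclidean inner product of [R^8]. *)
Definition ip v w : R := qre (K v w).

Lemma ipE v w : ip v w =
  qre v.1 * qre w.1 + qi v.1 * qi w.1 + qj v.1 * qj w.1 + qk v.1 * qk w.1 +
  (qre v.2 * qre w.2 + qi v.2 * qi w.2 + qj v.2 * qj w.2 + qk v.2 * qk w.2).
Proof. by rewrite /ip /K !coordE /=; ring. Qed.

Lemma ipC v w : ip v w = ip w v.
Proof. by rewrite !ipE; ring. Qed.
Lemma ipDl u v w : ip (u + v) w = ip u w + ip v w.
Proof.
by rewrite !ipE -[(u + v).1]/(u.1 + v.1) -[(u + v).2]/(u.2 + v.2) !coordD; ring.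
Qed.
Lemma ipZl a v w : ip (a *: v) w = a * ip v w.
Proof.
by rewrite !ipE -[(a *: v).1]/(a *: v.1) -[(a *: v).2]/(a *: v.2) !coordZ; ring.
Qed.
Lemma ip0l w : ip 0 w = 0.
Proof. by rewrite !ipE /=; ring. Qed.
Lemma ip_suml I (r : seq I) (P : pred I) (F : I -> H2 R) w :
  ip (\sum_(i <- r | P i) F i) w = \sum_(i <- r | P i) ip (F i) w.
Proof. by apply: (big_morph (ip^~ w)) => [u v|]; [exact: ipDl|exact: ip0l]. Qed.

Definition colH2 v : 'cV[quat R]_2 := \col_i (if i == 0 then v.1 else v.2).

(** [K] in matrix form, so that [A* A = 1] can be used. *)
Lemma K_mx v w : K v w = (adjointmx (colH2 v) *m colH2 w) 0 0.
Proof. by rewrite mxE big_ord_recl big_ord1 !mxE. Qed.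

Lemma colH2_spact A v : colH2 (spact A 1 v) = A *m colH2 v.
Proof.
apply/matrixP => i j; rewrite !mxE big_ord_recl big_ord1 !mxE /= !mulr1.
have l1 : lift ord0 ord0 = 1 :> 'I_2 by apply/val_inj.
rewrite l1; case: eqP => [->//|i0]; suff -> : i = 1 by [].
by case: i i0 => -[|[|//]] hi i0; [case: i0|]; apply/val_inj.
Qed.

Lemma KspactE A q v w : Sp2 R A -> K (spact A q v) (spact A q w) = qconj q * K v w * q.
Proof.
move=> AA; have -> : spact A q v = ((spact A 1 v).1 * q, (spact A 1 v).2 * q).
  by rewrite /spact /= !mulr1.
have -> : spact A q w = ((spact A 1 w).1 * q, (spact A 1 w).2 * q).
  by rewrite /spact /= !mulr1.
have <- : K (spact A 1 v) (spact A 1 w) = K v w.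
  rewrite !K_mx !colH2_spact adjointmxM mulmxA -(mulmxA _ _ A).
  by have -> : adjointmx A *m A = 1%:M; [exact: AA|rewrite mulmx1].
by rewrite /K /= !qconjM mulrDr mulrDl !mulrA.
Qed.

Lemma ip_spact A q v w : Sp2 R A -> Sp1 R q -> ip (spact A q v) (spact A q w) = ip v w.
Proof.
move=> AA qq; rewrite /ip KspactE //.
have conj_re (x : quat R) : qre (qconj q * x * q) = qre (qconj q * q) * qre x.
  by rewrite !coordE /=; ring.
by rewrite conj_re qq mul1r.
Qed.

Lemma spact_cancel A q : Sp2 R A -> Sp1 R q ->
  cancel (spact A q) (spact (adjointmx A) (qconj q)).
Proof. by move=> AA qq v; rewrite spactM AA (qmulVr qq) spact1. Qed.

Lemma codom_freeP k (F : 'I_k -> H2 R) :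
  reflect (forall c : 'I_k -> R, \sum_i c i *: F i = 0 -> forall i, c i = 0) (free (codom F)).
Proof.
have -> : codom F = [tuple F i | i < k] by [].
have nthE (i : 'I_k) : [tuple F i | i < k]`_i = F i by rewrite -tnth_nth tnth_mktuple.
have sumE (c : 'I_k -> R) : \sum_i c i *: [tuple F i | i < k]`_i = \sum_i c i *: F i.
  by apply: eq_bigr => i _; rewrite nthE.
by apply: (iffP freeP) => h c; have := h c; rewrite sumE.
Qed.

Lemma span_codomP k (F : 'I_k -> H2 R) v :
  reflect (exists c : 'I_k -> R, v = \sum_i c i *: F i) (v \in <<codom F>>%VS).
Proof.
have -> : codom F = [tuple F i | i < k] by [].
have nthE (i : 'I_k) : [tuple F i | i < k]`_i = F i by rewrite -tnth_nth tnth_mktuple.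
apply: (iffP idP) => [/coord_span ->|[c ->]].
  by exists (fun i => coord [tuple F i | i < k] i v); apply: eq_bigr => i _; rewrite nthE.
apply: memv_suml => i _; apply: memvZ; apply: memv_span.
by apply/tnthP; exists i; rewrite tnth_mktuple.
Qed.

Definition orthonormal k (F : 'I_k -> H2 R) := forall p r, ip (F p) (F r) = (p == r)%:R.

Lemma orthonormal_coef k (F : 'I_k -> H2 R) (c : 'I_k -> R) p : orthonormal F ->
  ip (\sum_i c i *: F i) (F p) = c p.
Proof.
move=> orF; rewrite ip_suml (bigD1 p) //= big1 ?addr0.
  by rewrite ipZl orF eqxx mulr1.
by move=> i ne; rewrite ipZl orF (negPf ne) mulr0.
Qed.

Lemma orthonormal_free k (F : 'I_k -> H2 R) : orthonormal F -> free (codom F).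
Proof.
by move=> orF; apply/codom_freeP => c c0 i; rewrite -(orthonormal_coef c i orF) c0 ip0l.
Qed.

(** Membership in the span becomes an equation, which is a closed condition. *)
Lemma orthonormal_span k (F : 'I_k -> H2 R) v : orthonormal F ->
  (v \in <<codom F>>%VS) <-> v = \sum_i ip v (F i) *: F i.
Proof.
move=> orF; split=> [/span_codomP[c ->]|->].
  by apply: eq_bigr => i _; rewrite orthonormal_coef.
by apply/span_codomP; exists (fun i => ip v (F i)).
Qed.

(** A motion that sends one frame into the span of the other maps span onto span since the
    dimensions agree. *)
Lemma orbit_eqP k (F G : frame R k) :
  \pi_(Gr_orbits R k) (frame_span F) = \pi_(Gr_orbits R k) (frame_span G) <->
  exists A q, [/\ Sp2 R A, Sp1 R q &
    forall p, spact A q (set_val F p) \in <<codom (set_val G)>>%VS].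
Proof.
have -> : (\pi_(Gr_orbits R k) (frame_span F) = \pi_(Gr_orbits R k) (frame_span G)) <->
    same_orbit (frame_span F) (frame_span G).
  exact: (rwP (@eqmodP _ (same_orbit_equiv R k) _ _)).
split=> [/asboolP[_ [A [q [AA qq ->]]] WE]|[A [q [AA qq FG]]]].
  exists A, q; split=> // p.
  have : [set` \val (frame_span G)] (spact A q (set_val F p)).
    rewrite WE; exists (set_val F p) => //.
    by apply: memv_span; exact: codom_f.
  by [].
apply/asboolP; exists (spact A q); first by exists A, q.
pose g := linfun (spact A q : H2 R -> H2 R).
have gE v : g v = spact A q v by rewrite lfunE.
have kerg : lker g == 0%VS.
  apply/lker0P => u v; rewrite !gE => uv.
  by rewrite -(spact_cancel AA qq u) uv spact_cancel.
have imE : (g @: <<codom (set_val F)>>)%VS = <<codom (set_val G)>>%VS.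
  apply/eqP; rewrite eqEdim; apply/andP; split.
    rewrite limg_span; apply/span_subvP => _ /mapP[_ /codomP[p ->] ->].
    by rewrite gE.
  rewrite (eqP (dim_span_frame G)) limg_dim_eq ?(eqP (dim_span_frame F)) //.
  by rewrite (eqP kerg) capv0.
apply/seteqP; split=> [v /= |_ [u /= uF <-]].
  rewrite -imE => /memv_imgP[u uF ->]; exists u => //; by rewrite gE.
by rewrite -imE -gE; apply: memv_img.
Qed.

Lemma orbit_frame_surj k (x : Gr_orbits R k) :
  exists F : frame R k, \pi_(Gr_orbits R k) (frame_span F) = x.
Proof.
pose V : Gr R k := repr x.
have sizeV : size (vbasis (val V)) = k by rewrite size_tuple; exact/eqP/(valP V).
pose F (i : 'I_k) : H2 R := (vbasis (val V))`_i.
have codomF : codom F = vbasis (val V).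
  apply: (@eq_from_nth _ 0) => [|i]; rewrite size_codom card_ord ?sizeV // => ik.
  by rewrite (nth_map (Ordinal ik)) ?size_enum_ord // /F nth_enum_ord.
have freeF : frame R k F.
  by rewrite /frame /= codomF; have := vbasisP (val V) => /andP[].
exists (exist _ F (mem_set freeF)).
rewrite -[RHS]reprK; congr (\pi_(Gr_orbits R k) _); apply: val_inj.
change (<<codom F>>%VS = val V).
by rewrite codomF; have := vbasisP (val V) => /andP[/eqP].
Qed.

End Geometry.

(** * Normal planes and their symmetries *)

Section NormalForms.
Context {R : realType}.

(** The unit vector at angle [x] in the real plane [R^2 e_p] inside [H^2]. *)
Definition line_vec (x : R) (p : nat) : H2 R := (cos x *: qunit p, sin x *: qunit p).

(** These are the entries of [M_lam] for [lam = cos_tuple t]. *)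
Lemma K_line_vec (x y : R) p r :
  K (line_vec x p) (line_vec y r) = cos (x - y) *: (qconj (qunit p) * qunit r).
Proof.
by rewrite /K /= !qconjZ -!scalerAl -!scalerAr !scalerA -scalerDl cosB.
Qed.

Lemma qunit_orth (p r : nat) : (p < 4)%N -> (r < 4)%N ->
  qre (qconj (qunit p) * qunit r : quat R) = (p == r)%:R.
Proof.
by case: p => [|[|[|[|//]]]] _; case: r => [|[|[|[|//]]]] _; rewrite !coordE /=; ring.
Qed.

Definition normal_frame k (t : 'rV[R]_k) : {ptws 'I_k -> H2 R} :=
  fun p => line_vec (t 0 p) p.

Lemma normal_frame_orthonormal k (t : 'rV[R]_k) : (k <= 4)%N -> orthonormal (normal_frame t).
Proof.
move=> k4 p r; rewrite /ip K_line_vec coordZ qunit_orth ?(leq_trans (ltn_ord _)) //.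
by rewrite -[(p == r :> nat)]/(p == r); case: eqVneq => [->|_]; rewrite ?subrr ?cos0 ?mul1r ?mulr0.
Qed.

Section Fixed.
Variable k : nat.
Hypothesis k4 : (k <= 4)%N.

Definition normal_point (t : 'rV[R]_k) : frame R k :=
  exist _ (normal_frame t)
    (mem_set (orthonormal_free (normal_frame_orthonormal t k4) : frame R k (normal_frame t))).

Definition normal_class (t : 'rV[R]_k) : Gr_orbits R k :=
  \pi_(Gr_orbits R k) (frame_span (normal_point t)).

Lemma normal_class_eqP t u : normal_class t = normal_class u <->
  exists A q, [/\ Sp2 R A, Sp1 R q & forall p,
    spact A q (line_vec (t 0 p) p) \in <<codom (normal_frame u)>>%VS].
Proof. exact: orbit_eqP. Qed.

Lemma line_vec_int_pi x (n : int) p : exists e : bool,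
  line_vec (x + n%:~R * pi) p = (-1) ^+ e *: line_vec x p.
Proof.
exists (odd `|n|%N); rewrite (@antiperiodic _ _ (line_vec^~ p)) => [|y].
  by case: (odd _); rewrite ?expr1 ?expr0 ?scaleN1r ?scale1r.
by rewrite /line_vec cosDpi sinDpi !scaleNr.
Qed.

Lemma mem_normal_frame (t : 'rV[R]_k) p : line_vec (t 0 p) p \in <<codom (normal_frame t)>>%VS.
Proof. by apply: memv_span; exact: (codom_f (normal_frame t) p). Qed.

(** The rotation of the real plane by [c], composed with a reflection if [b] is odd, is in
    [Sp(2)] and acts in the same way on the angles of all lines. *)
Lemma normal_class_motion (t u : 'rV[R]_k) (b : bool) (c : R) (m : 'I_k -> int) :
  (forall p, u 0 p = (-1) ^+ b * t 0 p + c + (m p)%:~R * pi) ->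
  normal_class t = normal_class u.
Proof.
move=> uE; apply/normal_class_eqP.
pose e : R := (-1) ^+ b.
have ee : e * e = 1 by rewrite /e -expr2 sqrr_sign.
pose A : 'M[quat R]_2 := \matrix_(i, j)
  ((if j == 0 then (if i == 0 then cos c else sin c)
   else (if i == 0 then - e * sin c else e * cos c)) *: 1).
have AE (x y : quat R) : (A 0 0 * x + A 0 1 * y = cos c *: x - (e * sin c) *: y) *
    (A 1 0 * x + A 1 1 * y = sin c *: x + (e * cos c) *: y).
  by rewrite !mxE /= -!scalerAl !mul1r mulNr scaleNr.
exists A, 1; split.
- apply: spact_inj => v; rewrite /spact /= !mulr1.
  have -> : adjointmx A *m A = 1%:M.
    have conjZ a : qconj (a *: 1 : quat R) = a *: 1.
      by apply: quatP; rewrite !coordE /= ?mulr0 ?oppr0.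
    apply/matrixP => i j; rewrite !mxE big_ord_recl big_ord1 !mxE /=.
    have cs := cos_sin_sq c.
    case: (ord2P i) => ->; case: (ord2P j) => -> /=;
      rewrite !conjZ -!scalerAl !mul1r !scalerA -scalerDl ?mulr1n ?mulr0n;
      [rewrite -[RHS]scale1r|rewrite -[RHS](scale0r 1)
      |rewrite -[RHS](scale0r 1)|rewrite -[RHS]scale1r];
      congr (_ *: _); rewrite -?cs; try ring.
    by rewrite -[RHS]mul1r -ee; ring.
  by [].
- by rewrite /Sp1 /= qconj1 mulr1.
- move=> p; suff -> : spact A 1 (line_vec (t 0 p) p) = line_vec (e * t 0 p + c) p.
    have [f fE] := line_vec_int_pi (e * t 0 p + c) (m p) p.
    have -> : line_vec (e * t 0 p + c) p = (-1) ^+ f *: line_vec (u 0 p) p.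
      by rewrite uE fE scalerA -expr2 sqrr_sign scale1r.
    by apply: memvZ; exact: mem_normal_frame.
  have cosE : cos (e * t 0 p) = cos (t 0 p).
    by rewrite /e; case: (b); rewrite ?expr1 ?expr0 ?mul1r // mulN1r cosN.
  have sinE : sin (e * t 0 p) = e * sin (t 0 p).
    by rewrite /e; case: (b); rewrite ?expr1 ?expr0 ?mul1r // !mulN1r sinN.
  rewrite /spact !AE /= !mulr1 !scalerA -scalerBl -scalerDl /line_vec cosD sinD cosE sinE.
  by congr (_ *: _, _ *: _); ring.
Qed.

Lemma qconj_imag (x : quat R) : qre x = 0 -> qconj x = - x.
Proof. by move=> x0; apply: quatP; rewrite !coordE ?x0 ?oppr0. Qed.

Lemma qre_mulC (x y : quat R) : qre (x * y) = qre (y * x).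
Proof. by rewrite !coordE; ring. Qed.

Lemma qunit_anticomm (a b : nat) : (a < 4)%N -> (b < 4)%N -> a != b ->
  (qconj (qunit a) * qunit b = - (qconj (qunit b) * qunit a) :> quat R) *
  (qunit a * qconj (qunit b) = - (qunit b * qconj (qunit a)) :> quat R).
Proof.
move=> a4 b4 ab; split.
  have : qre (qconj (qunit a) * qunit b : quat R) = 0 by rewrite qunit_orth // (negPf ab).
  by move/qconj_imag; rewrite qconjM qconjK => ->; rewrite opprK.
have : qre (qunit a * qconj (qunit b) : quat R) = 0.
  by rewrite qre_mulC qunit_orth // eq_sym (negPf ab).
by move/qconj_imag; rewrite qconjM qconjK => ->; rewrite opprK.
Qed.

(** The map [x |-> (1 + e_b conj(e_a)) x (1 + conj(e_a) e_b) / 2] permutes the basis units up to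
    sign: it sends [e_a] to [e_b] and [e_b] to [- e_a] and fixes the other two. *)
Lemma qunit_swap (a b c : nat) : (a < 4)%N -> (b < 4)%N -> (c < 4)%N -> a != b ->
  (1 + qunit b * qconj (qunit a)) * qunit c * (1 + qconj (qunit a) * qunit b) =
  (2 * (if c == b then -1 else 1)) *:
    (qunit (if c == a then b else if c == b then a else c) : quat R).
Proof.
move=> a4 b4 c4 ab; rewrite mulrDl mul1r mulrDr mulr1.
have bab : qunit b * qconj (qunit a) * qunit b = - qunit a :> quat R.
  by rewrite -mulrA (qunit_anticomm a4 b4 ab) mulrN mulrA qunit_conjr mul1r.
have two (x : quat R) : (2 * 1) *: x = x + x by rewrite mulr1 scaler_nat mulr2n.
case: (eqVneq c a) => [->|ca].
  rewrite (negPf ab) -(mulrA _ _ (qunit a)) qunit_conj mulr1 mulrDl !mulrA.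
  by rewrite qunit_conjr mul1r bab two [X in _ + X = _]addrC addrACA subrr add0r.
case: (eqVneq c b) => [->|cb].
  rewrite bab mulrDl mulrA bab mulNr mulrA qunit_conjr mul1r mulrN1 scaleNr -[2]mulr1 two.
  by rewrite opprD [X in _ + X = _]addrC addrACA subrr add0r.
have ba : b != a by rewrite eq_sym.
have bc : b != c by rewrite eq_sym.
have ac : a != c by rewrite eq_sym.
have swp : qunit b * qconj (qunit a) * qunit c = - (qunit c * qconj (qunit a) * qunit b) :> quat R.
  rewrite -mulrA (qunit_anticomm a4 c4 ac) mulrN mulrA (qunit_anticomm b4 c4 bc) mulNr opprK.
  by rewrite -(mulrA (qunit c) (qconj (qunit b)) (qunit a)) (qunit_anticomm b4 a4 ba).1 mulrN mulrA.
have cbb : qunit c * qconj (qunit a) * qunit b * qconj (qunit a) * qunit b = - qunit c :> quat R.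
  rewrite -!mulrA (mulrA (qunit b) (qconj (qunit a)) (qunit b)) bab mulrN qunit_conj.
  by rewrite mulrN1.
rewrite two mulrDl swp mulNr !mulrA cbb opprK.
by rewrite addrA subrK.
Qed.

(** The units [e_a] and [e_b] are exchanged, up to sign, by multiplying on both sides with unit
    quaternions; the left factor is a scalar matrix in [Sp(2)], the right factor is in [Sp(1)]. *)
Lemma normal_class_tperm (t : 'rV[R]_k) (a b : 'I_k) :
  normal_class (\row_p t 0 (tperm a b p)) = normal_class t.
Proof.
have [<-|ab] := eqVneq a b.
  by congr normal_class; apply/rowP => p; rewrite mxE tperm1 perm1.
apply/normal_class_eqP.
have lt4 (i : 'I_k) : (i < 4)%N by exact: leq_trans (ltn_ord i) k4.
pose r : R := (Num.sqrt 2)^-1.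
have rr : r * r * 2 = 1.
  by rewrite /r -invfM -expr2 sqr_sqrtr ?ler0n // mulVf ?pnatr_eq0.
pose al : quat R := r *: (1 + qunit b * qconj (qunit a)).
pose q : quat R := r *: (1 + qconj (qunit a) * qunit b).
have conjr (u : quat R) : qconj u * u = 1 -> qre u = 0 -> 
  qconj (r *: (1 + u)) * (r *: (1 + u)) = 1.
  move=> uu u0; have nu : qi u * qi u + qj u * qj u + qk u * qk u = 1.
    by have := congr1 (@qre R) uu; rewrite !coordE u0 => <-; ring.
  apply: quatP; rewrite !coordE u0; try ring.
  transitivity (r * r * (1 + (qi u * qi u + qj u * qj u + qk u * qk u))); first ring.
  by rewrite nu -[RHS]rr; ring.
have ab' : (a == b :> nat) = false by apply/negbTE.
have alal : qconj al * al = 1.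
  apply: conjr.
    by rewrite qconjM qconjK mulrA -(mulrA (qunit a)) qunit_conj mulr1 qunit_conjr.
  by rewrite qre_mulC qunit_orth // ab'.
have qq : qconj q * q = 1.
  apply: conjr.
    by rewrite qconjM qconjK mulrA -(mulrA (qconj (qunit b))) qunit_conjr mulr1 qunit_conj.
  by rewrite qunit_orth // ab'.
pose A : 'M[quat R]_2 := \matrix_(i, j) (if i == j then al else 0).
exists A, q; split=> //.
  apply/matrixP => i j; rewrite !mxE (bigD1 i) //= big1 ?addr0.
    rewrite !mxE eqxx; case: eqP => _; first by rewrite alal.
    by rewrite mulr0.
  by move=> l li; rewrite !mxE (negPf li) qconj0 mul0r.
move=> c; rewrite mxE.
have actE (x : R) : spact A q (line_vec x c) =
    (if c == b :> nat then -1 else 1) *: line_vec x (tperm a b c).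
  have act1 (y : R) : al * (y *: qunit c) * q =
      (if c == b :> nat then -1 else 1) *: (y *: qunit (tperm a b c)).
    rewrite /al /q !(=^~ scalerAl, =^~ scalerAr) !scalerA.
    rewrite qunit_swap // scalerA.
    have -> : (if c == a :> nat then b : nat else if c == b :> nat then a : nat else c) =
        tperm a b c.
      have vE (i j : 'I_k) : (i == j :> nat) = (i == j) by [].
      rewrite !vE; case: tpermP => [->|->|/eqP/negPf -> /eqP/negPf -> //].
        by rewrite eqxx.
      by rewrite eqxx eq_sym (negPf ab).
    congr (_ *: _); move: (if _ then _ else _) => s0.
    by rewrite -[RHS]mul1r -[X in _ = X * _]rr; ring.
  by rewrite /spact /= !mxE /= !mul0r addr0 add0r !act1.
by rewrite actE; apply: memvZ; exact: mem_normal_frame.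
Qed.

Lemma normal_class_perm (t : 'rV[R]_k) (s : 'S_k) :
  normal_class (\row_p t 0 (s p)) = normal_class t.
Proof.
have [ts -> _] := prod_tpermP s; elim: ts t => [|[a b] ts IH] t.
  by rewrite big_nil; congr normal_class; apply/rowP => p; rewrite mxE perm1.
rewrite big_cons -[RHS]IH -[RHS](normal_class_tperm _ a b).
by congr normal_class; apply/rowP => p; rewrite !mxE permM.
Qed.

Lemma normal_class_angle_equiv t u : angle_equiv t u -> normal_class t = normal_class u.
Proof.
move=> [s [b [c [m uE]]]]; rewrite -(normal_class_perm t s).
by apply: (@normal_class_motion _ _ b c m) => p; rewrite mxE.
Qed.

End Fixed.
End NormalForms.

(** * Unit vectors in the plane and their inner products *)

Section Planar.
Context {R : realType}.

(** Similar diagonal matrices have the same characteristic polynomial. *)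
Lemma diag_conj_perm n (d e : 'I_n -> R) (P Q : 'M[R]_n) : P *m Q = 1%:M ->
  \matrix_(i, j) (d i *+ (i == j)) = P *m (\matrix_(i, j) (e i *+ (i == j))) *m Q ->
  exists s : 'S_n, forall i, d i = e (s i).
Proof.
move=> PQ dE.
have charE (f : 'I_n -> R) : char_poly (\matrix_(i, j) (f i *+ (i == j))) =
    \prod_(x <- [tuple f i | i < n]) ('X - x%:P).
  rewrite char_poly_trig.
    by rewrite big_tuple; apply: eq_bigr => i _; rewrite mxE eqxx tnth_mktuple mulr1n.
  apply/is_trig_mxP => i j ij; rewrite mxE (_ : (i == j) = false) ?mulr0n //.
  by rewrite -val_eqE /= ltn_eqF.
have simE (A : 'M[R]_n) : char_poly (P *m A *m Q) = char_poly A.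
  pose PP := map_mx (@polyC R) P; pose QQ := map_mx (@polyC R) Q.
  have PPQQ : PP *m QQ = 1%:M by rewrite -map_mxM PQ map_mx1.
  rewrite /char_poly; have -> : char_poly_mx (P *m A *m Q) = PP *m char_poly_mx A *m QQ.
    rewrite /char_poly_mx mulmxBr mulmxBl !map_mxM /=; congr (_ - _).
    by rewrite mul_mx_scalar -scalemxAl PPQQ scalemx1.
  rewrite !det_mulmx mulrAC -det_mulmx PPQQ det1 mul1r //.
have /prod_XsubC_eq/tuple_permP[s sE] : \prod_(x <- [tuple d i | i < n]) ('X - x%:P) =
    \prod_(x <- [tuple e i | i < n]) ('X - x%:P).
  by rewrite -!charE dE simE.
exists s => i; have := congr1 (fun l => nth 0 l i) sE.
by rewrite -!tnth_nth !tnth_mktuple.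
Qed.

(** Vectors [(al_p, be_p)] of equal length, with [be] summing to zero, are determined up to a
    permutation by [al] and by [be] up to signs, when there are at most four of them. Let [D] be the
    set of indices where the sign of [be] changes and [D'] the set where it stays the same, in both
    cases with [be <> 0]. The sum of [be] vanishes over [D] and over [D'], so neither has one
    element. If one is empty the signs are constant. Otherwise both are pairs with opposite [be],
    and [al] is equal or opposite on each pair. It is equal on one of them because
    [al] does not sum to zero, and the exchange of that pair realizes the change of signs,
    up to a common sign. *)
Lemma sign_pattern k (al be be' : 'I_k -> R) (E : R) : (k <= 4)%N ->
  (forall p, be' p ^+ 2 = be p ^+ 2) -> (forall p, al p ^+ 2 + be p ^+ 2 = E) ->
  \sum_p be p = 0 -> \sum_p be' p = 0 -> \sum_p al p != 0 ->
  exists s : 'S_k, (forall p, al (s p) = al p) /\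
    forall p r, be' p * be' r = be (s p) * be (s r).
Proof.
move=> k4 sq abE sb sb' sa.
pose D := [set p | be' p != be p]%SET; pose D' := [set p | be' p != - be p]%SET.
have pm p : be' p = be p \/ be' p = - be p.
  have /eqP := sq p; rewrite -subr_eq0 subr_sqr mulf_eq0 subr_eq0 addr_eq0.
  by case/orP => /eqP; [left|right].
have inD p : p \in D -> be' p = - be p.
  by rewrite inE; case: (pm p) => // ->; rewrite eqxx.
have inD' p : p \in D' -> be' p = be p.
  by rewrite inE; case: (pm p) => // ->; rewrite eqxx.
have sumD : \sum_(p in D) be p = 0.
  have : \sum_p (be p - be' p) = 0 by rewrite sumrB sb sb' subrr.
  rewrite (bigID (mem D)) /= [X in _ + X]big1 ?addr0; last first.
    by move=> p; rewrite inE negbK => /eqP ->; rewrite subrr.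
  rewrite (eq_bigr (fun p => be p *+ 2)) => [|p pD]; last by rewrite inD // opprK mulr2n.
  by rewrite sumrMnl => /eqP; rewrite mulrn_eq0 /= => /eqP.
have sumD' : \sum_(p in D') be p = 0.
  have : \sum_p (be p + be' p) = 0 by rewrite big_split /= sb sb' addr0.
  rewrite (bigID (mem D')) /= [X in _ + X]big1 ?addr0; last first.
    by move=> p; rewrite inE negbK => /eqP ->; rewrite subrr.
  rewrite (eq_bigr (fun p => be p *+ 2)) => [|p pD]; last by rewrite inD' // mulr2n.
  by rewrite sumrMnl => /eqP; rewrite mulrn_eq0 /= => /eqP.
have DD' : D :&: D' = finset.set0.
  apply/finset.setP => p; rewrite [RHS]inE; apply/negbTE/negP; rewrite inE => /andP[pD pD'].
  by move: pD; rewrite inE (inD' p pD') eqxx.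
have nz p : p \in D \/ p \in D' -> be p != 0.
  by rewrite !inE; case: (pm p) => ->; case; rewrite ?eqxx //;
    apply: contra => /eqP ->; rewrite ?oppr0.
have not1 (B : {set 'I_k}) : (forall p, p \in B -> be p != 0) ->
    \sum_(p in B) be p = 0 -> #|B| != 1%N.
  by move=> Bnz; apply: contra_eqN => /cards1P[p BE]; rewrite BE big_set1 Bnz // BE finset.set11.
have cD1 : #|D| != 1%N by apply: not1 => // p pD; apply: nz; left.
have cD'1 : #|D'| != 1%N by apply: not1 => // p pD; apply: nz; right.
have cDD : (#|D| + #|D'| <= k)%N.
  rewrite -cardsUI DD' cards0 addn0; apply: leq_trans (max_card _) _.
  by rewrite card_ord.
have [D0|D0] := eqVneq D finset.set0.
  have b'b p : be' p = be p.
    by have := finset.in_set0 p; rewrite -D0 inE => /negbFE/eqP.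
  by exists 1%g; split=> [p|p r]; rewrite ?perm1 // !b'b.
have [D'0|D'0] := eqVneq D' finset.set0.
  have b'b p : be' p = - be p.
    by have := finset.in_set0 p; rewrite -D'0 inE => /negbFE/eqP.
  by exists 1%g; split=> [p|p r]; rewrite ?perm1 // !b'b mulrNN.
have D2 : #|D| = 2%N by move: D0 D'0; rewrite -!card_gt0; lia.
have D'2 : #|D'| = 2%N by move: D0 D'0; rewrite -!card_gt0; lia.
have cov p : p \in D \/ p \in D'.
  apply/orP; rewrite -finset.in_setU; suff -> : D :|: D' = finset.setT by rewrite inE.
  apply/eqP; rewrite eqEcard finset.subsetT cardsT card_ord /=.
  by have := cardsUI D D'; rewrite DD' cards0 addn0 D2 D'2 => ->.
have [p [q [pq DE]]] := cards2P _ (introT eqP D2).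
have [r [s [rs D'E]]] := cards2P _ (introT eqP D'2).
have pD : p \in D by rewrite DE !inE eqxx.
have qD : q \in D by rewrite DE !inE eqxx orbT.
have rD : r \in D' by rewrite D'E !inE eqxx.
have sD : s \in D' by rewrite D'E !inE eqxx orbT.
have bq : be q = - be p.
  by move: sumD; rewrite DE big_setU1 ?inE //= big_set1 => /eqP; rewrite addrC addr_eq0 => /eqP.
have bs : be s = - be r.
  by move: sumD'; rewrite D'E big_setU1 ?inE //= big_set1 => /eqP; rewrite addrC addr_eq0 => /eqP.
have alpm a b : be b = - be a -> al b = al a \/ al b = - al a.
  move=> ba; have : (al b - al a) * (al b + al a) = 0.
    by rewrite -subr_sqr; have := abE a; have := abE b; rewrite ba sqrrN; lra.
  by move=> /eqP; rewrite mulf_eq0 subr_eq0 addr_eq0 => /orP[] /eqP; [left|right].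
have swap_al a b : al b = al a -> forall l, al (tperm a b l) = al l.
  by move=> ab l; case: tpermP => [->|->|].
have [aq|aq] := alpm _ _ bq.
  exists (tperm p q); split; first exact: swap_al.
  suff bE l : be' l = be (tperm p q l) by move=> l l'; rewrite !bE.
  case: tpermP => [->|->|lp lq]; first by rewrite inD // bq.
    by rewrite inD // bq opprK.
  by case: (cov l) => [|/inD' //]; rewrite DE !inE => /orP[] /eqP ?; [case: lp|case: lq].
have [as_|as_] := alpm _ _ bs.
  exists (tperm r s); split; first exact: swap_al.
  suff bE l : be' l = - be (tperm r s l) by move=> l l'; rewrite !bE mulrNN.
  case: tpermP => [->|->|lp lq]; first by rewrite inD' // bs opprK.
    by rewrite inD' // bs.
  by case: (cov l) => [/inD //|]; rewrite D'E !inE => /orP[] /eqP ?; [case: lp|case: lq].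
case/eqP: sa; rewrite (bigID (mem D)) /= DE big_setU1 ?inE //= big_set1 aq subrr add0r.
have notD l : (l \notin D) = (l \in D').
  apply/idP/idP => [lD|lD']; first by case: (cov l) => // lD2; rewrite lD2 in lD.
  apply/negP => lD; have : l \in D :&: D' by rewrite finset.in_setI lD lD'.
  by rewrite DD' finset.in_set0.
rewrite -DE (eq_bigl _ _ notD).
by rewrite D'E big_setU1 ?inE //= big_set1 as_ subrr.
Qed.

Section Configurations.
Variable k : nat.
Implicit Types (x y : 'I_k -> R).

(** The Gram matrix of the plane vectors [(x_p, y_p)]. *)
Definition dot x y p r := x p * x r + y p * y r.

(** With [e] the sum of the vectors, the row sums are the inner products with [e]. In the
    orthogonal basis of [e] and its rotation by a right angle, the first coordinates are these row
    sums, and the second ones are then known up to sign and sum to zero. *)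
Lemma config_nonzero x y x' y' (s : 'S_k) : (k <= 4)%N ->
  (forall p, dot x y p p = 1) -> (forall p, dot x' y' p p = 1) ->
  (forall p, \sum_r dot x' y' p r = \sum_r dot x y (s p) r) ->
  \sum_p \sum_r dot x y p r != 0 ->
  exists s' : 'S_k, forall p r, dot x' y' p r = dot x y (s' p) (s' r).
Proof.
move=> k4 u u' alE.
pose sX (f : 'I_k -> R) := \sum_r f r.
have sum_dot (f g : 'I_k -> R) p : \sum_r dot f g p r = f p * sX f + g p * sX g.
  by rewrite big_split /= -!mulr_sumr.
have sum2_dot (f g : 'I_k -> R) : \sum_p \sum_r dot f g p r = sX f * sX f + sX g * sX g.
  by under eq_bigr do rewrite sum_dot; rewrite big_split /= -!mulr_suml.
set E := \sum_p _ => E0.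
have E' : \sum_p \sum_r dot x' y' p r = E.
  by rewrite (eq_bigr _ (fun p _ => alE p)) [RHS](reindex_inj (@perm_inj _ s)).
pose al p := \sum_r dot x y (s p) r.
pose be p := sX x * y (s p) - sX y * x (s p).
pose be' p := sX x' * y' p - sX y' * x' p.
(* Inner products expressed in the basis of e and its rotation by a right angle. *)
have dotE (f g : 'I_k -> R) p r : (sX f * sX f + sX g * sX g) * dot f g p r =
    (\sum_l dot f g p l) * (\sum_l dot f g r l) +
    (sX f * g p - sX g * f p) * (sX f * g r - sX g * f r).
  by rewrite !sum_dot /dot; ring.
have EE : sX x * sX x + sX y * sX y = E by rewrite /E sum2_dot.
have EE' : sX x' * sX x' + sX y' * sX y' = E by rewrite -E' sum2_dot.
have abE p : al p ^+ 2 + be p ^+ 2 = E.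
  by rewrite !expr2 /al /be -dotE EE u mulr1.
have sq p : be' p ^+ 2 = be p ^+ 2.
  apply: (@addrI _ (al p ^+ 2)); rewrite abE !expr2 {1 2}/al -alE /be' -dotE.
  by rewrite EE' u' mulr1.
have sum0 (f g : 'I_k -> R) : \sum_p (sX f * g p - sX g * f p) = 0.
  by rewrite sumrB -!mulr_sumr /sX mulrC subrr.
have sb : \sum_p be p = 0.
  have := sum0 x y; rewrite (reindex_inj (@perm_inj _ s)) /=; exact.
have sa : \sum_p al p != 0.
  suff -> : \sum_p al p = E by [].
  by rewrite /E [RHS](reindex_inj (@perm_inj _ s)).
have [s' [als bes]] := sign_pattern k4 sq abE sb (sum0 x' y') sa.
exists (s' * s)%g => p r; apply: (mulfI E0).
rewrite -{1}EE' dotE !alE -[X in _ + X]/(be' p * be' r) bes.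
by rewrite -EE dotE !permM -[X in _ = X * _ + _]/(al (s' p)) -[X in _ = _ * X + _]/(al (s' r)) !als.
Qed.

End Configurations.

Lemma config_zero_sum k (x y : 'I_k -> R) :
  \sum_p \sum_r dot x y p r = 0 -> \sum_p x p = 0 /\ \sum_p y p = 0.
Proof.
have -> : \sum_p \sum_r dot x y p r = (\sum_p x p) ^+ 2 + (\sum_p y p) ^+ 2.
  rewrite !expr2; under eq_bigr do rewrite big_split /= -!mulr_sumr.
  by rewrite big_split /= -!mulr_suml.
move=> /eqP; rewrite paddr_eq0 ?sqr_ge0 // !sqrf_eq0 => /andP[/eqP ? /eqP ?]; by split.
Qed.

Lemma config_zero2 (x y : 'I_2 -> R) : (forall p, dot x y p p = 1) ->
  \sum_p \sum_r dot x y p r = 0 -> forall p r, p != r -> dot x y p r = -1.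
Proof.
move=> u /config_zero_sum; rewrite !big_ord_recl !big_ord0 => -[x0 y0] p r pr.
have := u ord0; move: pr x0 y0; rewrite /dot.
case: (ord2_liftP p) => ->; case: (ord2_liftP r) => ->; rewrite ?eqxx // => _ x0 y0 u0; nra.
Qed.

Lemma config_zero3 (x y : 'I_3 -> R) : (forall p, dot x y p p = 1) ->
  \sum_p \sum_r dot x y p r = 0 -> forall p r, p != r -> dot x y p r = - 2^-1.
Proof.
move=> u /config_zero_sum; rewrite !big_ord_recl !big_ord0 => -[x0 y0] p r pr.
have := u ord0; have := u (lift ord0 ord0); have := u (lift ord0 (lift ord0 ord0)).
move: pr; rewrite /dot; move: x0 y0.
set a := x _; set b := x _; set c := x _; set a' := y _; set b' := y _; set c' := y _.
move=> x0 y0.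
have cE : c = - (a + b) by lra.
have cE' : c' = - (a' + b') by lra.
case: (ord3_liftP p) => ->; case: (ord3_liftP r) => ->; rewrite ?eqxx // => _;
  rewrite -/a -/b -/c -/a' -/b' -/c' cE cE' => u2 u1 u0; lra.
Qed.

(** Four unit vectors with sum zero: expand [|z_0 + z_a + z_b|^2 = 1], the square length of the
    remaining vector. *)
Lemma config_zero4 (x y : 'I_4 -> R) : (forall p, dot x y p p = 1) ->
  \sum_p \sum_r dot x y p r = 0 ->
  forall a b : 'I_3, a != b -> dot x y (lift ord0 a) (lift ord0 b) =
    -1 - dot x y ord0 (lift ord0 a) - dot x y ord0 (lift ord0 b).
Proof.
move=> u /config_zero_sum; rewrite !big_ord_recl !big_ord0 => -[x0 y0] p r pr.
have := u ord0; have := u (lift ord0 ord0); have := u (lift ord0 (lift ord0 ord0)).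
have := u (lift ord0 (lift ord0 (lift ord0 ord0))).
move: pr; rewrite /dot; move: x0 y0.
set a := x _; set b := x _; set c := x _; set d := x _.
set a' := y _; set b' := y _; set c' := y _; set d' := y _.
move=> x0 y0.
have dE : d = - (a + b + c) by lra.
have dE' : d' = - (a' + b' + c') by lra.
case: (ord3_liftP p) => ->; case: (ord3_liftP r) => ->; rewrite ?eqxx // => _;
  rewrite -/a -/b -/c -/d -/a' -/b' -/c' -/d' dE dE' => u3 u2 u1 u0; lra.
Qed.

Lemma config_zero4_perm (x y x' y' : 'I_4 -> R) (s : 'S_3) :
  (forall p, dot x y p p = 1) -> (forall p, dot x' y' p p = 1) ->
  \sum_p \sum_r dot x y p r = 0 -> \sum_p \sum_r dot x' y' p r = 0 ->
  (forall a, dot x' y' ord0 (lift ord0 a) = dot x y ord0 (lift ord0 (s a))) ->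
  exists s' : 'S_4, forall p r, dot x' y' p r = dot x y (s' p) (s' r).
Proof.
move=> u u' e e' sE; exists (lift_perm ord0 ord0 s) => p r.
have dotC (f g : 'I_4 -> R) i j : dot f g i j = dot f g j i by rewrite /dot mulrC (mulrC (g i)).
case: (unliftP ord0 p) => [a|] ->; case: (unliftP ord0 r) => [b|] ->;
  rewrite ?lift_perm_id ?lift_perm_lift ?u ?u' //.
  have [->|ab] := eqVneq a b; first by rewrite u u'.
  by rewrite (config_zero4 u') // (config_zero4 u) ?(inj_eq perm_inj) // !sE.
by rewrite dotC sE dotC.
Qed.

End Planar.

(** * Invariants of quaternionic Gram matrices *)

Section Invariants.
Context {R : realType}.

(** The real coordinates; indices from 4 on give 0. *)
Definition qcomp (a : nat) (x : quat R) : R := [:: qre x; qi x; qj x; qk x]`_a.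

Lemma qcompD a x y : qcomp a (x + y) = qcomp a x + qcomp a y.
Proof. by case: a => [|[|[|[|a]]]] //; rewrite /qcomp /= ?nth_nil addr0. Qed.
Lemma qcompZ a c x : qcomp a (c *: x) = c * qcomp a x.
Proof. by case: a => [|[|[|[|a]]]] //; rewrite /qcomp /= ?nth_nil mulr0. Qed.
Lemma qcomp0 a : qcomp a 0 = 0.
Proof. by rewrite -(scale0r 0) qcompZ mul0r. Qed.
Lemma qcomp_sum a I (r : seq I) (F : I -> quat R) :
  qcomp a (\sum_(i <- r) F i) = \sum_(i <- r) qcomp a (F i).
Proof. exact: (big_morph _ (qcompD a) (qcomp0 a)). Qed.

Lemma KDl (u v w : H2 R) : K (u + v) w = K u w + K v w.
Proof. by rewrite /K /= !qconjD !mulrDl addrACA. Qed.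
Lemma KDr (u v w : H2 R) : K w (u + v) = K w u + K w v.
Proof. by rewrite /K /= !mulrDr addrACA. Qed.
Lemma KZl a (v w : H2 R) : K (a *: v) w = a *: K v w.
Proof. by rewrite /K /= !qconjZ -!scalerAl -scalerDr. Qed.
Lemma KZr a (v w : H2 R) : K w (a *: v) = a *: K w v.
Proof. by rewrite /K /= -!scalerAr -scalerDr. Qed.
Lemma K0l (w : H2 R) : K 0 w = 0.
Proof. by rewrite -(scale0r 0) KZl scale0r. Qed.
Lemma K0r (w : H2 R) : K w 0 = 0.
Proof. by rewrite -(scale0r 0) KZr scale0r. Qed.

Lemma K_sum k (T : 'M[R]_k) (F : 'I_k -> H2 R) p r :
  K (\sum_i T p i *: F i) (\sum_j T r j *: F j) =
  \sum_i \sum_j (T p i * T r j) *: K (F i) (F j).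
Proof.
rewrite (big_morph (fun v : H2 R => K v (\sum_j T r j *: F j)) (fun u v => KDl u v _) (K0l _)).
apply: eq_bigr => i _.
rewrite (big_morph (fun v : H2 R => K (T p i *: F i) v) (fun u v => KDr u v _) (K0r _)).
apply: eq_bigr => j _.
by rewrite KZl KZr scalerA.
Qed.

Definition gram k a (F : 'I_k -> H2 R) : 'M[R]_k := \matrix_(p, r) qcomp a (K (F p) (F r)).

Lemma gram_comb k a (T : 'M[R]_k) (F G : 'I_k -> H2 R) :
  (forall p, G p = \sum_r T p r *: F r) -> gram a G = T *m gram a F *m T^T.
Proof.
move=> GE; apply/matrixP => p r; rewrite !mxE !GE K_sum qcomp_sum.
under [RHS]eq_bigr do rewrite mxE mulr_suml.
rewrite exchange_big /=; apply: eq_bigr => i _; rewrite qcomp_sum; apply: eq_bigr => j _.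
by rewrite qcompZ !mxE; ring.
Qed.

(** The sum of squares [G_a G_a^T] of the four real components of the Gram matrix is invariant
    under conjugation of all entries by a unit quaternion, which acts on them by an
    orthogonal map. *)
Definition gram_square k (F : 'I_k -> H2 R) : 'M[R]_k :=
  \sum_(a < 4) gram a F *m (gram a F)^T.

(** The inner products of the three imaginary components of the Gram matrix: unaffected by a
    change of orthonormal basis, and conjugated by a rotation under the group. *)
Definition gram_moment k (F : 'I_k -> H2 R) : 'M[R]_3 :=
  \matrix_(a, b) \tr (gram a.+1 F *m (gram b.+1 F)^T).

Lemma gram_square_comb k (T : 'M[R]_k) (F G : 'I_k -> H2 R) : T *m T^T = 1%:M ->
  (forall p, G p = \sum_r T p r *: F r) -> gram_square G = T *m gram_square F *m T^T.
Proof.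
move=> TT GE; have T'T := mulmx1C TT.
rewrite /gram_square mulmx_sumr mulmx_suml; apply: eq_bigr => a _.
rewrite (gram_comb a GE) !trmx_mul trmxK !mulmxA; congr (_ *m _ *m _).
by rewrite -!mulmxA T'T mulmx1.
Qed.

Lemma gram_moment_comb k (T : 'M[R]_k) (F G : 'I_k -> H2 R) : T *m T^T = 1%:M ->
  (forall p, G p = \sum_r T p r *: F r) -> gram_moment G = gram_moment F.
Proof.
move=> TT GE; have T'T := mulmx1C TT.
apply/matrixP => a b; rewrite !mxE (gram_comb a.+1 GE) (gram_comb b.+1 GE) !trmx_mul trmxK.
rewrite !mulmxA mxtrace_mulC !mulmxA T'T mul1mx.
by rewrite -(mulmxA _ T^T T) T'T mulmx1.
Qed.

Lemma qcomp_ip (x y : quat R) : \sum_(a < 4) qcomp a x * qcomp a y = qre (x * qconj y).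
Proof. by rewrite coordM !coordC !big_ord_recl big_ord0 /qcomp /=; ring. Qed.

Lemma qcomp_isometry q (x y : quat R) : Sp1 R q ->
  \sum_(a < 4) qcomp a (qconj q * x * q) * qcomp a (qconj q * y * q) =
  \sum_(a < 4) qcomp a x * qcomp a y.
Proof.
move=> qq; rewrite !qcomp_ip !qconjM qconjK !mulrA -(mulrA _ q (qconj q)) (qmulVr qq) mulr1.
by rewrite qre_mulC !mulrA (qmulVr qq) mul1r.
Qed.

Lemma gram_square_spact k (F : 'I_k -> H2 R) A q : Sp2 R A -> Sp1 R q ->
  gram_square (fun p => spact A q (F p)) = gram_square F.
Proof.
move=> AA qq; apply/matrixP => p r; rewrite /gram_square !summxE.
transitivity (\sum_l \sum_(a < 4) qcomp a (K (spact A q (F p)) (spact A q (F l))) *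
    qcomp a (K (spact A q (F r)) (spact A q (F l)))).
  by rewrite exchange_big; apply: eq_bigr => a _; rewrite !mxE; apply: eq_bigr => l _; rewrite !mxE.
transitivity (\sum_l \sum_(a < 4) qcomp a (K (F p) (F l)) * qcomp a (K (F r) (F l))).
  by apply: eq_bigr => l _; rewrite !KspactE // qcomp_isometry.
by rewrite exchange_big; apply: eq_bigr => a _; rewrite !mxE; apply: eq_bigr => l _; rewrite !mxE.
Qed.

(** The rotation of the imaginary quaternions given by conjugation with [q]. *)
Definition rotation q : 'M[R]_3 :=
  \matrix_(a, c) qcomp a.+1 (qconj q * qunit c.+1 * q).

Lemma rotationE q x (a : 'I_3) : Sp1 R q ->
  qcomp a.+1 (qconj q * x * q) = \sum_(c < 3) rotation q a c * qcomp c.+1 x.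
Proof.
move=> qq; pose y : quat R := \sum_(c < 3) qcomp c.+1 x *: qunit c.+1.
have -> : x = qre x *: 1 + y.
  by rewrite /y !big_ord_recl big_ord0; apply: quatP; rewrite !coordE /qcomp /=; ring.
rewrite mulrDr mulrDl -scalerAr -scalerAl mulr1 qq qcompD qcompZ.
have -> : qcomp a.+1 1 = 0 by case: a => -[|[|[|//]]].
rewrite mulr0 add0r /y mulr_sumr mulr_suml qcomp_sum; apply: eq_bigr => c _.
rewrite -scalerAr -scalerAl qcompZ mxE mulrC; congr (_ * _).
rewrite qcompD qcompZ (_ : qcomp c.+1 1 = 0) ?mulr0 ?add0r; last by case: c => -[|[|[|//]]].
rewrite qcomp_sum (bigD1 c) //= big1 ?addr0 => [|d dc]; rewrite qcompZ.
  by rewrite (_ : qcomp c.+1 (qunit c.+1) = 1) ?mulr1 //; case: c => -[|[|[|//]]].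
rewrite (_ : qcomp c.+1 (qunit d.+1) = 0) ?mulr0 //.
by move: dc; rewrite -val_eqE; case: c => -[|[|[|//]]] ?; case: d => -[|[|[|//]]] ?.
Qed.

Lemma rotation_orth q : Sp1 R q -> rotation q *m (rotation q)^T = 1%:M.
Proof.
move=> qq; apply: mulmx1C; apply/matrixP => c d; rewrite !mxE.
have := qcomp_isometry (qunit c.+1) (qunit d.+1) qq.
have re0 : qcomp 0 (qconj q * qunit c.+1 * q) = 0.
  rewrite -[LHS]/(qre (qconj q * qunit c.+1 * q)) qre_mulC mulrA (qmulVr qq) mul1r.
  by case: c => -[|[|[|//]]].
rewrite big_ord_recl re0 mul0r add0r => h.
transitivity (\sum_(a < 4) qcomp a (qunit c.+1) * qcomp a (qunit d.+1)).
  by rewrite -h; apply: eq_bigr => a _; rewrite !mxE.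
rewrite !big_ord_recl big_ord0 -val_eqE.
by case: c {h re0} => -[|[|[|//]]] ?; case: d => -[|[|[|//]]] ?; rewrite /qcomp /=; ring.
Qed.

Lemma gram_moment_spact k (F : 'I_k -> H2 R) A q : Sp2 R A -> Sp1 R q ->
  gram_moment (fun p => spact A q (F p)) =
  rotation q *m gram_moment F *m (rotation q)^T.
Proof.
move=> AA qq; pose g c := gram c F.
have gE (a : 'I_3) : gram a.+1 (fun p => spact A q (F p)) = \sum_(c < 3) rotation q a c *: g c.+1.
  apply/matrixP => p r; rewrite mxE KspactE // rotationE // summxE.
  by apply: eq_bigr => c _; rewrite !mxE.
apply/matrixP => a b; rewrite !mxE !gE (raddf_sum (@trmx R k k)) /= mulmx_sumr raddf_sum /=.
apply: eq_bigr => d _; rewrite !mxE mulr_suml mulmx_suml raddf_sum /=; apply: eq_bigr => c _.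
by rewrite !mxE linearZ /= -scalemxAr -scalemxAl !mxtraceZ; ring.
Qed.

(** For a normal frame the quaternions [K (v_p, v_l)] and [K (v_r, v_l)] are multiples of
    [conj(e_p) e_l] and [conj(e_r) e_l], which are orthogonal for [p <> r]. *)
Lemma gram_square_normal k (t : 'rV[R]_k) : (k <= 4)%N ->
  gram_square (normal_frame t) =
  \matrix_(p, r) ((\sum_l cos (t 0 p - t 0 l) ^+ 2) *+ (p == r)).
Proof.
move=> k4; apply/matrixP => p r; rewrite /gram_square summxE [RHS]mxE.
transitivity (\sum_l \sum_(a < 4) qcomp a (K (normal_frame t p) (normal_frame t l)) *
    qcomp a (K (normal_frame t r) (normal_frame t l))).
  by rewrite exchange_big; apply: eq_bigr => a _; rewrite !mxE; apply: eq_bigr => l _; rewrite !mxE.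
transitivity (\sum_l (cos (t 0 p - t 0 l) * cos (t 0 r - t 0 l)) * (p == r)%:R).
  apply: eq_bigr => l _; rewrite qcomp_ip /normal_frame !K_line_vec qconjZ qconjM qconjK.
  rewrite -scalerAl -scalerAr scalerA coordZ !mulrA -(mulrA _ (qunit l)) qunit_conjr mulr1.
  by rewrite qunit_orth ?(leq_trans (ltn_ord _)).
rewrite -mulr_suml; case: eqVneq => [->|_]; rewrite ?mulr1 ?mulr0 //.
Qed.

Lemma qunit_M_unit (p r : nat) : (p < 4)%N -> (r < 4)%N ->
  qconj (qunit p) * qunit r = if p == r then 1 else M_unit R p r.
Proof.
by case: p => [|[|[|[|//]]]] _; case: r => [|[|[|[|//]]]] _ /=;
  apply: quatP; rewrite !coordE /=; ring.
Qed.

(** For a normal frame the component of each imaginary unit is carried by two disjoint pairs of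
    indices, and different units use different pairs. *)
Lemma gram_moment_normal (t : 'rV[R]_4) (c2 := fun p r : 'I_4 => cos (t 0 p - t 0 r) ^+ 2)
    (i1 := lift ord0 (ord0 : 'I_3) : 'I_4) (i2 := lift ord0 (lift ord0 (ord0 : 'I_2)) : 'I_4)
    (i3 := lift ord0 (lift ord0 (lift ord0 (ord0 : 'I_1))) : 'I_4) :
  gram_moment (normal_frame t) =
  \matrix_(a, b) (2 * [:: c2 ord0 i1 + c2 i2 i3; c2 ord0 i2 + c2 i1 i3; c2 ord0 i3 + c2 i1 i2]`_a
     *+ (a == b)).
Proof.
have c2C p r : c2 p r = c2 r p by rewrite /c2 -cosN opprB.
apply/matrixP => a b; rewrite !mxE.
transitivity (\sum_p \sum_r c2 p r *
   (qcomp a.+1 (if p == r then 1 else M_unit R p r) *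
    qcomp b.+1 (if p == r then 1 else M_unit R p r))).
  apply: eq_bigr => p _; rewrite !mxE; apply: eq_bigr => r _; rewrite !mxE.
  by rewrite /normal_frame K_line_vec qunit_M_unit // !qcompZ /c2 expr2 mulrACA.
rewrite !big_ord_recl !big_ord0 /= -/i1 -/i2 -/i3.
rewrite -val_eqE; case: a => -[|[|[|//]]] ? /=; case: b => -[|[|[|//]]] ? /=;
  rewrite /qcomp /= ?coordE /= ?(c2C i1 ord0) ?(c2C i2 ord0) ?(c2C i3 ord0) ?(c2C i2 i1)
   ?(c2C i3 i1) ?(c2C i3 i2); ring.
Qed.

End Invariants.

(** * Inequivalent angles give different orbits *)

Section Injectivity.
Context {R : realType}.

Definition dbl_cos k (t : 'rV[R]_k) p := cos (2 * t 0 p).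
Definition dbl_sin k (t : 'rV[R]_k) p := sin (2 * t 0 p).

Lemma dot_cos2 k (t : 'rV[R]_k) p r :
  dot (dbl_cos t) (dbl_sin t) p r = 2 * cos (t 0 p - t 0 r) ^+ 2 - 1.
Proof. by rewrite -cos_double mulrBr cosB. Qed.

Lemma dot_unit k (t : 'rV[R]_k) p : dot (dbl_cos t) (dbl_sin t) p p = 1.
Proof. by rewrite dot_cos2 subrr cos0; ring. Qed.

Lemma angle_equiv_of_dot k (t u : 'rV[R]_k) (s : 'S_k) :
  (forall p r, dot (dbl_cos t) (dbl_sin t) p r = dot (dbl_cos u) (dbl_sin u) (s p) (s r)) ->
  angle_equiv t u.
Proof.
move=> sE; apply: angle_equiv_sym; apply/angle_equivP; exists s => p r.
by have := sE p r; rewrite !dot_cos2; lra.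
Qed.

(** This links the eigenvalues of [gram_square] to the configuration of doubled angles. *)
Lemma row_sum_dot k (t : 'rV[R]_k) p :
  \sum_r dot (dbl_cos t) (dbl_sin t) p r = 2 * \sum_l cos (t 0 p - t 0 l) ^+ 2 - k%:R.
Proof.
under eq_bigr do rewrite dot_cos2.
by rewrite sumrB sumr_const card_ord -mulr_sumr.
Qed.

(** A congruence of two normal planes relates their orthonormal frames by a matrix [T] in [O(k)].
    The eigenvalues of [gram_square] then agree, that is, the row sums of the Gram matrices of the
    doubled angles agree up to a permutation. If the doubled unit vectors have nonzero sum, this
    determines them. If the sum is zero, they are rigid for two or three angles, and for four the
    eigenvalues of [gram_moment] determine them. *)
Lemma normal_class_inj k (k4 : (k <= 4)%N) (t u : 'rV[R]_k) : (2 <= k)%N ->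
  normal_class k4 t = normal_class k4 u -> angle_equiv t u.
Proof.
move=> k2 /normal_class_eqP[A [q [AA qq FG]]].
have ot := normal_frame_orthonormal t k4; have ou := normal_frame_orthonormal u k4.
pose G p := spact A q (normal_frame t p).
pose T : 'M[R]_k := \matrix_(p, r) ip (G p) (normal_frame u r).
have GE p : G p = \sum_r T p r *: normal_frame u r.
  have /(orthonormal_span _ ou) h := FG p; apply: (eq_trans h).
  by apply: eq_bigr => r _; rewrite mxE.
have TT : T *m T^T = 1%:M.
  apply/matrixP => p r; rewrite mxE [RHS]mxE.
  have <- : ip (G p) (G r) = (p == r)%:R by rewrite ip_spact // ot.
  rewrite (GE p) ip_suml; apply: eq_bigr => l _.
  by rewrite ipZl ipC !mxE.
have sqE : gram_square (normal_frame t) = T *m gram_square (normal_frame u) *m T^T.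
  by rewrite -(gram_square_comb TT GE) gram_square_spact.
rewrite !gram_square_normal // in sqE.
have [s sE] := diag_conj_perm TT sqE.
have rowE p : \sum_r dot (dbl_cos t) (dbl_sin t) p r = \sum_r dot (dbl_cos u) (dbl_sin u) (s p) r.
  by rewrite !row_sum_dot sE.
have [e0|e0] := eqVneq (\sum_p \sum_r dot (dbl_cos u) (dbl_sin u) p r) 0; last first.
  have [s' s'E] := config_nonzero k4 (dot_unit u) (dot_unit t) rowE e0.
  exact: (angle_equiv_of_dot s'E).
have e0' : \sum_p \sum_r dot (dbl_cos t) (dbl_sin t) p r = 0.
  by rewrite (eq_bigr _ (fun p _ => rowE p)) -[RHS]e0 [RHS](reindex_inj (@perm_inj _ s)).
have const (c : R) : (forall p r, p != r -> dot (dbl_cos t) (dbl_sin t) p r = c) ->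
    (forall p r, p != r -> dot (dbl_cos u) (dbl_sin u) p r = c) -> angle_equiv t u.
  move=> tc uc; apply: (@angle_equiv_of_dot _ _ _ 1%g) => p r; rewrite !perm1.
  by case: (eqVneq p r) => [->|pr]; rewrite ?dot_unit // tc // uc.
(* Sum zero: opposite vectors for k = 2, an equilateral triangle for k = 3. *)
have [k_2|k_2] := eqVneq k 2%N.
  by subst k; apply: (const (-1)); apply: config_zero2 => //; exact: dot_unit.
have [k_3|k_3] := eqVneq k 3%N.
  by subst k; apply: (const (- 2^-1)); apply: config_zero3 => //; exact: dot_unit.
have k_4 : k = 4%N by move: k_2 k_3 k2 k4; case: (k) => [|[|[|[|[|]]]]].
subst k; have mE : gram_moment (normal_frame u) =
    rotation q *m gram_moment (normal_frame t) *m (rotation q)^T.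
  by rewrite -(gram_moment_spact _ AA qq) -(gram_moment_comb TT GE).
rewrite !gram_moment_normal in mE.
have [s' s'E] := diag_conj_perm (rotation_orth qq) mE.
pose i1 : 'I_4 := lift ord0 (ord0 : 'I_3).
pose i2 : 'I_4 := lift ord0 (lift ord0 (ord0 : 'I_2)).
pose i3 : 'I_4 := lift ord0 (lift ord0 (lift ord0 (ord0 : 'I_1))).
pose c2 (v : 'rV[R]_4) p r := cos (v 0 p - v 0 r) ^+ 2.
(* For sum zero the two pairs of one imaginary unit have equal inner products, so the
   diagonal entries of the moment matrix are affine functions of the inner products with
   the first vector. *)
have momE (v : 'rV[R]_4) : \sum_p \sum_r dot (dbl_cos v) (dbl_sin v) p r = 0 -> forall a : 'I_3,
    2 * [:: c2 v ord0 i1 + c2 v i2 i3; c2 v ord0 i2 + c2 v i1 i3; c2 v ord0 i3 + c2 v i1 i2]`_a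
    = 2 + 2 * dot (dbl_cos v) (dbl_sin v) ord0 (lift ord0 a).
  move=> v0 a; have z4 := config_zero4 (dot_unit v) v0.
  have := z4 ord0 (lift ord0 ord0) isT; have := z4 ord0 (lift ord0 (lift ord0 ord0)) isT.
  have := z4 (lift ord0 ord0) (lift ord0 (lift ord0 ord0)) isT.
  have row0 : \sum_r dot (dbl_cos v) (dbl_sin v) ord0 r = 0.
    have [sx sy] := config_zero_sum v0.
    by rewrite big_split /= -!mulr_sumr sx sy !mulr0 addr0.
  move: row0; rewrite !big_ord_recl big_ord0 dot_unit !dot_cos2.
  have lE (b : 'I_3) (i : 'I_3) : (b == i :> nat) -> b = i by move=> /eqP/val_inj.
  case: a => -[|[|[|//]]] ai /=; rewrite /c2 /i1 /i2 /i3.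
  - rewrite (lE (Ordinal ai) ord0) //; lra.
  - rewrite (lE (Ordinal ai) (lift ord0 ord0)) //; lra.
  - rewrite (lE (Ordinal ai) (lift ord0 (lift ord0 ord0))) //; lra.
apply: angle_equiv_sym.
have [a|s4 s4E] := config_zero4_perm (s := s') (dot_unit t) (dot_unit u) e0' e0.
  by have := s'E a; rewrite !momE //; lra.
exact: (angle_equiv_of_dot s4E).
Qed.

End Injectivity.

(** * A determinant that is maximal along a circle *)

Section Critical.
Context {R : realType}.

Lemma pow1D_le n (x : R) : 0 <= x <= 1 -> (1 + x) ^+ n <= 1 + (3 ^ n)%:R * x.
Proof.
move=> /andP[x0 x1]; elim: n => [|n IH]; first by rewrite expr0 mul1r lerDl.
have c1 : 1 <= (3 ^ n)%:R :> R by rewrite ler1n expn_gt0.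
rewrite exprSr expnS natrM; set c : R := (3 ^ n)%:R in IH c1 *.
apply: (le_trans (ler_wpM2r _ IH)); first lra.
have cx : c * x * x <= c * x by rewrite ler_piMr // mulr_ge0 //; lra.
have xc : x <= c * x by rewrite ler_peMl.
lra.
Qed.

(** The function [det (c + s B)^2] on the circle equals 1 at [(1, 0)] and is maximal there, so its
    derivative [2 tr B] vanishes. The proof normalizes a point of slope [s] and compares
    [(1 + s tr B + O(s^2))^2 <= (1 + s^2)^n] for small [s]. *)
Lemma trace_critical m (B : 'M[R]_m.+2) :
  (forall c s : R, c ^+ 2 + s ^+ 2 = 1 -> \det (c%:M + s *: B) ^+ 2 <= 1) -> \tr B = 0.
Proof.
move=> Bmax; set n := m.+2.
pose chi := char_poly B.
(* The terms of degree at least two of det (1 + s B), divided by the square of s. *)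
pose r (s : R) := \sum_(i < m.+1) chi`_i * (- s) ^+ (m - i).
have detE (s : R) : s != 0 -> \det (1%:M + s *: B) = 1 + s * \tr B + s ^+ 2 * r s.
  move=> s0.
  have chiE : chi.[- s^-1] = \det ((- s^-1)%:M - B).
    rewrite /chi /char_poly -horner_evalE -det_map_mx; congr (\det _).
    apply/matrixP => i j; rewrite /char_poly_mx !mxE /= /horner_eval.
    by rewrite hornerD hornerN hornerC hornerMn hornerX.
  have -> : 1%:M + s *: B = - s *: ((- s^-1)%:M - B).
    by rewrite scalerBr scale_scalar_mx mulrNN divff // scaleNr opprK.
  have lead : chi`_n = 1.
    by have := char_poly_monic B; rewrite monicE lead_coefE size_char_poly => /eqP.
  have sub : chi`_m.+1 = - \tr B by exact: (@char_poly_trace _ n B isT).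
  have powE i : (i <= n)%N -> (- s) ^+ n * (chi`_i * (- s^-1) ^+ i) = chi`_i * (- s) ^+ (n - i).
    move=> i_n; rewrite mulrCA -{1}(subnK i_n) exprD -mulrA -exprMn mulrNN divff // expr1n mulr1 //.
  rewrite detZ -chiE (@horner_coef_wide _ n.+1) ?size_char_poly // mulr_sumr.
  rewrite (eq_bigr (fun i : 'I_n.+1 => chi`_i * (- s) ^+ (n - i))); last first.
    by move=> i _; rewrite powE // -ltnS.
  rewrite big_ord_recr [X in X + _ = _]big_ord_recr /=.
  transitivity (s ^+ 2 * r s + s * \tr B + 1); last by ring.
  congr (_ + _ + _).
  - rewrite /r mulr_sumr; apply: eq_bigr => i _.
    rewrite /n -addn2 addnC -addnBA; last by rewrite -ltnS.
    by rewrite exprD sqrrN mulrCA.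
  - by rewrite sub subSnn expr1 mulrNN mulrC.
  - by rewrite lead subnn expr0 mulr1.
pose M := \sum_(i < m.+1) `|chi`_i|.
have M0 : 0 <= M by apply: sumr_ge0.
have rM s : `|s| <= 1 -> `|r s| <= M.
  move=> s1; apply: (le_trans (ler_norm_sum _ _ _)); apply: ler_sum => i _.
  by rewrite normrM ler_piMr // normrX normrN exprn_ile1.
pose C : R := 2 * M + (3 ^ n)%:R.
have C0 : 0 < C by rewrite /C ltr_wpDl ?mulr_ge0 // ltr0n expn_gt0.
have key (s : R) : s != 0 -> `|s| <= 1 -> 2 * (s * \tr B) <= C * s ^+ 2.
  move=> s0 s1; have s2 : 0 <= s ^+ 2 := sqr_ge0 s.
  have s21 : s ^+ 2 <= 1 by rewrite -sqr_normr exprn_ile1.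
  pose d := Num.sqrt (1 + s ^+ 2).
  have d0 : 0 < d by rewrite sqrtr_gt0; lra.
  have dd : d ^+ 2 = 1 + s ^+ 2 by rewrite sqr_sqrtr //; lra.
  have := Bmax d^-1 (s / d) _; rewrite expr_div_n exprVn dd.
  rewrite -[X in X + _]mul1r -mulrDl divff; last by rewrite gt_eqF //; lra.
  move=> /(_ erefl).
  rewrite (_ : d^-1%:M + (s / d) *: B = d^-1 *: (1%:M + s *: B)); last first.
    by rewrite scalerDr scalerA scalemx1 [d^-1 * s]mulrC.
  rewrite detZ exprMn -exprM mulnC exprM exprVn dd exprVn mulrC.
  rewrite ler_pdivrMr ?exprn_gt0 ?mul1r; try lra.
  move=> /le_trans/(_ (pow1D_le _ _))-/(_ (introT andP (conj s2 s21))).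
  rewrite detE //; set y := s * \tr B; have := rM s s1; rewrite ler_norml => /andP[r1 r2].
  have rs : - M * s ^+ 2 <= r s * s ^+ 2 by rewrite ler_wpM2r.
  have : (1 + y + s ^+ 2 * r s) ^+ 2 >= 1 + 2 * (y + s ^+ 2 * r s).
    by have := sqr_ge0 (y + s ^+ 2 * r s); rewrite !expr2; lra.
  rewrite /C; lra.
apply/eqP/negP => /negP t0.
have [s [s0 s1 st]] : exists s, [/\ s != 0, `|s| <= 1 & C * s ^+ 2 < 2 * (s * \tr B)].
  (* A value of s with the sign of the trace and small enough for the linear term to win. *)
  pose T := \tr B; pose e : R := `|T| / (C + `|T|).
  have T0 : 0 < `|T| by rewrite normr_gt0.
  have e0 : 0 < e by rewrite divr_gt0 //; lra.
  have e1 : e <= 1 by rewrite ler_pdivrMr; lra.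
  have Ce : C * e < 2 * `|T|.
    rewrite mulrA ltr_pdivrMr; last lra.
    have : 0 < `|T| * `|T| by rewrite mulr_gt0.
    have : 0 < C * `|T| by rewrite mulr_gt0.
    lra.
  exists (Num.sg T * e); split.
  - by apply: mulf_neq0; [rewrite sgr_eq0|exact: lt0r_neq0].
  - by rewrite normrM normr_sg t0 mul1r (gtr0_norm e0) e1.
  - rewrite exprMn sqr_sg t0 mul1r -/T.
    rewrite (_ : Num.sg T * e * T = `|T| * e); last by rewrite normrEsg mulrAC.
    have h : C * e * e < 2 * `|T| * e by rewrite (ltr_pM2r e0).
    by move: h; clear -e; clearbody e T; rewrite expr2; lra.
by have := key s s0 s1; rewrite leNgt st.
Qed.

End Critical.

(** * Dual bases in maximal position *)

Section DualBasis.
Context {R : realType}.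

(** The slopes [r] differ for different units; this makes the linear equations at a maximum
    independent. *)
Definition test_vec (r : nat) : H2 R := (qunit r, r%:R *: qunit r).

(** Left multiplication by the matrix [S u], which is skew-hermitian for [S] symmetric and [u]
    imaginary. *)
Definition left_gen (S : 'M[R]_2) (u : quat R) (x : H2 R) : H2 R :=
  (S 0 0 *: (u * x.1) + S 0 1 *: (u * x.2), S 1 0 *: (u * x.1) + S 1 1 *: (u * x.2)).
Definition right_gen (u : quat R) (x : H2 R) : H2 R := (x.1 * u, x.2 * u).

(** For [N] skew-hermitian with square [-1], the exponentials of [N] are [c + s N]. *)
Lemma Sp2_rotation (N : 'M[quat R]_2) (c s : R) :
  adjointmx N = - N -> N *m N = - 1%:M -> c ^+ 2 + s ^+ 2 = 1 ->
  Sp2 R (\matrix_(i, j) (c *: (1%:M : 'M[quat R]_2) i j + s *: N i j)).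
Proof.
move=> aN NN cs; apply/matrixP => i j; rewrite !mxE.
pose one := 1%:M : 'M[quat R]_2.
have aE a b : qconj (N a b) = - N b a.
  by have := congr1 (fun M : 'M_2 => M b a) aN; rewrite !mxE.
have oneC (a b : 'I_2) : qconj ((a == b)%:R : quat R) = (b == a)%:R.
  by rewrite eq_sym; case: eqP; rewrite ?qconj1 ?qconj0.
transitivity ((c ^+ 2) *: (one *m one) i j + (c * s) *: (one *m N) i j
   - (s * c) *: (N *m one) i j - (s ^+ 2) *: (N *m N) i j).
  rewrite ![in RHS]mxE !scaler_sumr -!sumrN -!big_split /=; apply: eq_bigr => l _.
  rewrite !mxE qconjD !qconjZ oneC aE.
  rewrite mulrDl !mulrDr -!scalerAl -!scalerAr !scalerA !mulNr !scalerN.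
  by rewrite -!expr2 !addrA.
have -> : (N *m N) i j = - (i == j)%:R by rewrite NN !mxE.
have -> : (one *m one) i j = (i == j)%:R by rewrite mulmx1 mxE.
by rewrite mulmx1 mul1mx [c * s]mulrC addrK scalerN opprK -scalerDl cs scale1r.
Qed.

Lemma left_motion (S : 'M[R]_2) (u : quat R) (c s : R) :
  qconj u = - u -> u * u = -1 -> S^T = S -> S *m S = 1%:M -> c ^+ 2 + s ^+ 2 = 1 ->
  exists A, Sp2 R A /\ forall x, spact A 1 x = c *: x + s *: left_gen S u x.
Proof.
move=> uc uu ST SSE cs; pose N : 'M[quat R]_2 := \matrix_(i, j) (S i j *: u).
exists (\matrix_(i, j) (c *: (1%:M : 'M[quat R]_2) i j + s *: N i j)); split.
  apply: Sp2_rotation cs.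
    apply/matrixP => i j; rewrite !mxE qconjZ.
    by have := congr1 (fun M : 'M_2 => M i j) ST; rewrite uc scalerN mxE => ->.
  apply/matrixP => i j; rewrite mxE.
  transitivity ((S *m S) i j *: (u * u)).
    rewrite mxE scaler_suml; apply: eq_bigr => l _.
    by rewrite !mxE -scalerAl -scalerAr scalerA.
  rewrite SSE uu !mxE.
  by case: eqP => _; rewrite ?mulr1n ?mulr0n ?scale1r ?scale0r ?oppr0.
move=> x; rewrite /spact !mxE /= !mulr1; case: x => x y /=.
rewrite /left_gen /= !mulr1n !mulr0n !scaler0 !add0r.
congr (_, _); rewrite mulrDl -!scalerAl mul1r.
  by rewrite -[RHS]/(c *: x + s *: (S 0 0 *: (u * x) + S 0 1 *: (u * y))) scalerDr addrA.
by rewrite -[RHS]/(c *: y + s *: (S 1 0 *: (u * x) + S 1 1 *: (u * y))) scalerDr addrCA.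
Qed.

Lemma right_motion (u : quat R) (c s : R) : qconj u = - u -> u * u = -1 -> c ^+ 2 + s ^+ 2 = 1 ->
  exists q, Sp1 R q /\ forall x, spact 1%:M q x = c *: x + s *: right_gen u x.
Proof.
move=> uc uu cs; exists (c *: 1 + s *: u); split.
  rewrite /Sp1 /= qconjD !qconjZ qconj1 uc mulrDl !mulrDr.
  rewrite !(=^~ scalerAl, =^~ scalerAr) !scalerA !mul1r !mulr1 mulNr uu opprK !scalerN.
  by rewrite -!expr2 [c * s]mulrC addrA addrK -scalerDl cs scale1r.
move=> x; rewrite /spact !mxE /= !mul1r !mul0r addr0 add0r /right_gen; case: x => x y /=.
by congr (_, _); rewrite mulrDr -!scalerAr mulr1.
Qed.

Section Maximal.
Variables (m : nat) (v : 'I_m.+2 -> H2 R).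
(* The frame v is in maximal position, with determinant 1. *)
Hypothesis dual : forall p r : 'I_m.+2, ip (v p) (test_vec r) = (p == r)%:R.
Hypothesis maximal : forall A q, Sp2 R A -> Sp1 R q ->
  \det (\matrix_(p, r < m.+2) ip (spact A q (v p)) (test_vec r)) ^+ 2 <= 1.

(** Along the rotation generated by [xi], the pairing with the test vectors is [c + s B] with
    [B] the pairing of [xi v_p] with the test vectors. *)
Lemma critical_motion (xi : H2 R -> H2 R) :
  (forall c s, c ^+ 2 + s ^+ 2 = 1 -> exists A q,
    [/\ Sp2 R A, Sp1 R q & forall x, spact A q x = c *: x + s *: xi x]) ->
  \sum_p ip (xi (v p)) (test_vec p) = 0.
Proof.
move=> xiP; pose B : 'M[R]_m.+2 := \matrix_(p, r) ip (xi (v p)) (test_vec r).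
have <- : \tr B = \sum_p ip (xi (v p)) (test_vec p).
  by apply: eq_bigr => p _; rewrite mxE.
apply: trace_critical => c s cs; have [A [q [AA qq AE]]] := xiP c s cs.
have := maximal AA qq; congr (_ ^+ 2 <= 1); congr (\det _).
by apply/matrixP => p r; rewrite !mxE AE ipDl !ipZl dual mulr_natr.
Qed.

Lemma critical_left S u :
  qconj u = - u -> u * u = -1 -> S^T = S -> S *m S = 1%:M ->
  \sum_p ip (left_gen S u (v p)) (test_vec p) = 0.
Proof.
move=> uc uu ST SS; apply: critical_motion => c s cs.
have [A [AA AE]] := left_motion uc uu ST SS cs.
by exists A, 1; split=> //; rewrite /Sp1 /= qconj1 mulr1.
Qed.

Lemma critical_right u : qconj u = - u -> u * u = -1 ->
  \sum_p ip (right_gen u (v p)) (test_vec p) = 0.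
Proof.
move=> uc uu; apply: critical_motion => c s cs; have [q [qq qE]] := right_motion uc uu cs.
by exists 1%:M, q; split=> //; rewrite /Sp2 /= adjointmx1 mulmx1.
Qed.


Hypothesis m2 : (m <= 2)%N.

Lemma ip_test (z : H2 R) (r : nat) : (r < 4)%N ->
  ip z (test_vec r) = qcomp r z.1 + r%:R * qcomp r z.2.
Proof.
by rewrite ipE; case: r => [|[|[|[|//]]]] _; rewrite /qcomp !coordZ /=; ring.
Qed.

Lemma small_index (p : 'I_m.+2) : (p < 4)%N.
Proof. by have := ltn_ord p; move: m2; lia. Qed.

Definition sym2 (a b d : R) : 'M[R]_2 :=
  \matrix_(i, j) (if i == j then (if i == 0 then a else d) else b).

Lemma sym2_sq a b d : a * a + b * b = 1 -> b * (a + d) = 0 -> b * b + d * d = 1 ->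
  sym2 a b d *m sym2 a b d = 1%:M.
Proof.
move=> h1 h2 h3;apply/matrixP => i j; rewrite !mxE !big_ord_recl big_ord0 !mxE.
by case: (ord2_liftP i) => ->; case: (ord2_liftP j) => -> /=; rewrite ?mulr1n ?mulr0n; lra.
Qed.

Lemma sym2_eq a b d u : a * a + b * b = 1 -> b * (a + d) = 0 -> b * b + d * d = 1 ->
  qconj u = - u -> u * u = -1 ->
  \sum_(p < m.+2) ((a + p%:R * b) * qcomp p (u * (v p).1) +
                   (b + p%:R * d) * qcomp p (u * (v p).2)) = 0.
Proof.
move=> h1 h2 h3 uc uu.
have ST : (sym2 a b d)^T = sym2 a b d.
  by apply/matrixP => i j; rewrite !mxE eq_sym; case: eqP => // ->.
rewrite -[RHS](critical_left uc uu ST (sym2_sq h1 h2 h3)); apply: eq_bigr => p _.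
rewrite ip_test ?small_index // /left_gen !mxE /= !qcompD !qcompZ; ring.
Qed.

Lemma right_eq u : qconj u = - u -> u * u = -1 ->
  \sum_(p < m.+2) (qcomp p ((v p).1 * u) + p%:R * qcomp p ((v p).2 * u)) = 0.
Proof.
move=> uc uu; rewrite -[RHS](critical_right uc uu); apply: eq_bigr => p _.
by rewrite ip_test ?small_index.
Qed.

(** The conditions at a maximum for one imaginary unit [u]: left multiplication by [S u] with [S]
    the identity, [diag (1, -1)] and the exchange of coordinates, and right multiplication
    by [u]. *)
Definition unit_eqs u := [/\
  \sum_(p < m.+2) (qcomp p (u * (v p).1) + p%:R * qcomp p (u * (v p).2)) = 0,
  \sum_(p < m.+2) (qcomp p (u * (v p).1) - p%:R * qcomp p (u * (v p).2)) = 0,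
  \sum_(p < m.+2) (p%:R * qcomp p (u * (v p).1) + qcomp p (u * (v p).2)) = 0 &
  \sum_(p < m.+2) (qcomp p ((v p).1 * u) + p%:R * qcomp p ((v p).2 * u)) = 0].

Lemma unit_eqsP u : qconj u = - u -> u * u = -1 -> unit_eqs u.
Proof.
move=> uc uu; split; last exact: right_eq.
- rewrite -[RHS](@sym2_eq 1 0 1 u) //; try (by ring).
  by apply: eq_bigr => p _; ring.
- rewrite -[RHS](@sym2_eq 1 0 (-1) u) //; try (by ring).
  by apply: eq_bigr => p _; ring.
- rewrite -[RHS](@sym2_eq 0 1 0 u) //; try (by ring).
  by apply: eq_bigr => p _; ring.
Qed.

End Maximal.

Lemma qcomp_mul_units (z : quat R) :
  (qcomp 0 (ii * z) = - qcomp 1 z) * (qcomp 1 (ii * z) = qcomp 0 z) *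
  (qcomp 2 (ii * z) = - qcomp 3 z) * (qcomp 3 (ii * z) = qcomp 2 z) *
  (qcomp 0 (z * ii) = - qcomp 1 z) * (qcomp 1 (z * ii) = qcomp 0 z) *
  (qcomp 2 (z * ii) = qcomp 3 z) * (qcomp 3 (z * ii) = - qcomp 2 z) *
  (qcomp 0 (jj * z) = - qcomp 2 z) * (qcomp 2 (jj * z) = qcomp 0 z) *
  (qcomp 1 (jj * z) = qcomp 3 z) * (qcomp 3 (jj * z) = - qcomp 1 z) *
  (qcomp 0 (z * jj) = - qcomp 2 z) * (qcomp 2 (z * jj) = qcomp 0 z) *
  (qcomp 1 (z * jj) = - qcomp 3 z) * (qcomp 3 (z * jj) = qcomp 1 z) *
  (qcomp 0 (kk * z) = - qcomp 3 z) * (qcomp 3 (kk * z) = qcomp 0 z) *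
  (qcomp 1 (kk * z) = - qcomp 2 z) * (qcomp 2 (kk * z) = qcomp 1 z) *
  (qcomp 0 (z * kk) = - qcomp 3 z) * (qcomp 3 (z * kk) = qcomp 0 z) *
  (qcomp 1 (z * kk) = qcomp 2 z) * (qcomp 2 (z * kk) = - qcomp 1 z).
Proof. by do !split; rewrite /qcomp /=; ring. Qed.

Lemma unit_conj_sq : [/\ qconj ii = - ii :> quat R, ii * ii = -1 :> quat R &
  [/\ qconj jj = - jj :> quat R, jj * jj = -1 :> quat R,
   qconj kk = - kk :> quat R & kk * kk = -1 :> quat R]].
Proof. by split; [| |split]; apply: quatP; rewrite !coordE /=; ring. Qed.

Definition dual_axes k (v : 'I_k -> H2 R) := forall (p : 'I_k) (c : nat), (c < 4)%N -> c != p ->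
  qcomp c (v p).1 = 0 /\ qcomp c (v p).2 = 0.

(** For a unit [u] the equations involve, in each [v_p], only the component along the basis
    unit [e_c] with [e_c = +- u e_p]. Together with the duality relations between [v_p] and the
    test vector of [e_c], they leave only the zero solution. The same
    happens for three and four vectors. *)
Lemma dual_axes2 (v : 'I_2 -> H2 R) :
  (forall p r : 'I_2, ip (v p) (test_vec r) = (p == r)%:R) ->
  unit_eqs v ii -> unit_eqs v jj -> unit_eqs v kk -> dual_axes v.
Proof.
move=> dual; rewrite /unit_eqs !big_ord_recl !big_ord0 /= /bump /= !qcomp_mul_units.
set v0 := v ord0; set v1 := v (lift ord0 ord0).
have := dual ord0 (lift ord0 ord0); have := dual (lift ord0 ord0) ord0.
rewrite !ip_test //= /bump /= -/v0 -/v1 => d1 d0 [i1 i2 i3 i4] [j1 j2 j3 j4] [k1 k2 k3 k4].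
by move=> p c; case: (ord2_liftP p) => ->; case: c => [|[|[|[|//]]]] //= _ _;
  rewrite -/v0 -/v1; split; lra.
Qed.

Lemma dual_axes3 (v : 'I_3 -> H2 R) :
  (forall p r : 'I_3, ip (v p) (test_vec r) = (p == r)%:R) ->
  unit_eqs v ii -> unit_eqs v jj -> unit_eqs v kk -> dual_axes v.
Proof.
move=> dual; rewrite /unit_eqs !big_ord_recl !big_ord0 /= /bump /= !qcomp_mul_units.
set i0 : 'I_3 := ord0; set i1 : 'I_3 := lift ord0 ord0; set i2 : 'I_3 := lift ord0 (lift ord0 ord0).
set v0 := v i0; set v1 := v i1; set v2 := v i2.
have := dual i0 i1; have := dual i1 i0; have := dual i0 i2; have := dual i2 i0.
have := dual i1 i2; have := dual i2 i1.
rewrite !ip_test //= /bump /= -/v0 -/v1 -/v2 => d21 d12 d20 d02 d10 d01.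
move=> [a1 a2 a3 a4] [b1 b2 b3 b4] [c1 c2 c3 c4].
have three (l : 'I_3) : [\/ l = i0, l = i1 | l = i2].
  by case: l => -[|[|[|//]]] hl; [constructor 1|constructor 2|constructor 3]; apply/val_inj.
by move=> p c; case: (three p) => ->; case: c => [|[|[|[|//]]]] //= _ _;
  rewrite -/v0 -/v1 -/v2; split;
  first [clear -a1 a2 a3 a4 d01 d10; lra|clear -b1 b2 b3 b4 d02 d20; lra
        |clear -c1 c2 c3 c4 d12 d21; lra].
Qed.

Lemma dual_axes4 (v : 'I_4 -> H2 R) :
  (forall p r : 'I_4, ip (v p) (test_vec r) = (p == r)%:R) ->
  unit_eqs v ii -> unit_eqs v jj -> unit_eqs v kk -> dual_axes v.
Proof.
move=> dual; rewrite /unit_eqs !big_ord_recl !big_ord0 /= /bump /= !qcomp_mul_units.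
set i0 : 'I_4 := ord0; set i1 : 'I_4 := lift ord0 ord0; set i2 : 'I_4 := lift ord0 (lift ord0 ord0).
set i3 : 'I_4 := lift ord0 (lift ord0 (lift ord0 ord0)).
set v0 := v i0; set v1 := v i1; set v2 := v i2; set v3 := v i3.
have := dual i0 i1; have := dual i1 i0; have := dual i0 i2; have := dual i2 i0.
have := dual i1 i2; have := dual i2 i1; have := dual i0 i3; have := dual i3 i0.
have := dual i1 i3; have := dual i3 i1; have := dual i2 i3; have := dual i3 i2.
rewrite !ip_test //= /bump /= -/v0 -/v1 -/v2 -/v3.
move=> d32 d23 d31 d13 d30 d03 d21 d12 d20 d02 d10 d01.
move=> [a1 a2 a3 a4] [b1 b2 b3 b4] [c1 c2 c3 c4].
have four (l : 'I_4) : [\/ l = i0, l = i1, l = i2 | l = i3].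
  by case: l => -[|[|[|[|//]]]] hl; [constructor 1|constructor 2|constructor 3|constructor 4];
    apply/val_inj.
by move=> p c; case: (four p) => ->; case: c => [|[|[|[|//]]]] //= _ _;
  rewrite -/v0 -/v1 -/v2 -/v3; split;
  first [clear -a1 a2 a3 a4 d01 d10 d23 d32; lra|clear -b1 b2 b3 b4 d02 d20 d13 d31; lra
        |clear -c1 c2 c3 c4 d03 d30 d12 d21; lra].
Qed.

End DualBasis.

(** * Continuity of quaternionic expressions *)

Section QuaternionContinuity.
Context {R : realType} {T : topologicalType}.
Implicit Types (f g : T -> quat R) (u v : T -> H2 R).

(** Continuity is checked on real coordinates, where the field operations are continuous. *)
Definition contq f := forall a : nat, continuous (fun x => qcomp a (f x)).
Definition contH u := contq (fun x => (u x).1) /\ contq (fun x => (u x).2).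

Lemma contq_Quat (a b c d : T -> R) : continuous a -> continuous b -> continuous c ->
  continuous d -> contq (fun x => Quat (a x) (b x) (c x) (d x)).
Proof.
move=> ac bc cc dc [|[|[|[|n]]]] //=.
rewrite (_ : (fun _ => _) = fun=> 0); first exact: contC.
by apply/funext => x; rewrite /qcomp nth_default.
Qed.

Lemma contqD f g : contq f -> contq g -> contq (fun x => f x + g x).
Proof.
move=> fc gc a; rewrite (_ : (fun _ => _) = fun x => qcomp a (f x) + qcomp a (g x)).
  exact: contD.
by apply/funext => x; rewrite qcompD.
Qed.

Lemma contqZ (c : T -> R) f : continuous c -> contq f -> contq (fun x => c x *: f x).
Proof.
move=> cc fc a; rewrite (_ : (fun _ => _) = fun x => c x * qcomp a (f x)).
  exact: contM.
by apply/funext => x; rewrite qcompZ.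
Qed.

Lemma contqC (c : quat R) : contq (fun=> c).
Proof. by move=> a; exact: contC. Qed.

Lemma contqM f g : contq f -> contq g -> contq (fun x => f x * g x).
Proof.
move=> fc gc; have := (fc 0, fc 1, fc 2, fc 3, (gc 0, gc 1, gc 2, gc 3)).
rewrite /qcomp /= => -[[[[f0 f1] f2] f3] [[[g0 g1] g2] g3]].
apply: contq_Quat.
- by apply: contB; [apply: contB; [apply: contB|]|]; apply: contM.
- by apply: contB; [apply: contD; [apply: contD|]|]; apply: contM.
- by apply: contD; [apply: contD; [apply: contB|]|]; apply: contM.
- by apply: contD; [apply: contB; [apply: contD|]|]; apply: contM.
Qed.

Lemma contq_conj f : contq f -> contq (fun x => qconj (f x)).
Proof.
move=> fc; have := (fc 0, fc 1, fc 2, fc 3).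
rewrite /qcomp /= => -[[[f0 f1] f2] f3].
by apply: contq_Quat => //; apply: contN.
Qed.

Lemma contHD u v : contH u -> contH v -> contH (fun x => u x + v x).
Proof. by move=> [u1 u2] [v1 v2]; split; apply: contqD. Qed.

Lemma contHZ (c : T -> R) u : continuous c -> contH u -> contH (fun x => c x *: u x).
Proof. by move=> cc [u1 u2]; split; apply: contqZ. Qed.

Lemma contHC (c : H2 R) : contH (fun=> c).
Proof. by split; exact: contqC. Qed.

Lemma contHB u v : contH u -> contH v -> contH (fun x => u x - v x).
Proof.
move=> uc vc; rewrite (_ : (fun _ => _) = fun x => u x + (-1) *: v x).
  by apply: contHD => //; apply: contHZ => //; exact: contC.
by apply/funext => x; rewrite scaleN1r.
Qed.

Lemma contH_sum (I : Type) (r : seq I) (F : I -> T -> H2 R) :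
  (forall i, contH (F i)) -> contH (fun x => \sum_(i <- r) F i x).
Proof.
move=> Fc; elim: r => [|i r IH].
  rewrite (_ : (fun _ => _) = fun=> 0); first exact: contHC.
  by apply/funext => x; rewrite big_nil.
rewrite (_ : (fun _ => _) = fun x => F i x + \sum_(i <- r) F i x).
  exact: contHD.
by apply/funext => x; rewrite big_cons.
Qed.

Lemma cont_ip u v : contH u -> contH v -> continuous (fun x => ip (u x) (v x)).
Proof.
move=> [u1 u2] [v1 v2]; rewrite /ip /K.
exact: (contqD (contqM (contq_conj u1) v1) (contqM (contq_conj u2) v2) (a := 0%N)).
Qed.

Lemma contH_spact (A : T -> 'M[quat R]_2) (q : T -> quat R) v :
  (forall i j, contq (fun x => A x i j)) -> contq q -> contH v ->
  contH (fun x => spact (A x) (q x) (v x)).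
Proof.
move=> Ac qc [v1 v2]; split; apply: contqM => //; apply: contqD; apply: contqM => //; exact: Ac.
Qed.

Lemma contH_line_vec (t : T -> R) p : continuous t -> contH (fun x => line_vec (t x) p).
Proof.
move=> tc; split; apply: contqZ; try exact: contqC.
  by apply: cont_comp tc; exact: continuous_cos.
by apply: cont_comp tc; exact: continuous_sin.
Qed.

Lemma qcomp_eq0 (x : quat R) : (forall a, (a < 4)%N -> qcomp a x = 0) -> x = 0.
Proof.
move=> x0; apply: quatP; rewrite coord01.
- exact: (x0 0%N).
- exact: (x0 1%N).
- exact: (x0 2%N).
- exact: (x0 3%N).
Qed.

Lemma closed_contq f : contq f -> closed [set x | f x = 0].
Proof.
move=> fc; rewrite (_ : mkset _ = \bigcap_(a in `I_4) [set x | qcomp a (f x) = 0]).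
  by apply: closed_bigI => a _; apply: closed_zero; exact: fc.
apply/seteqP; split=> [x fx0 a _|x xP]; first by rewrite /= (fx0 : f x = 0) qcomp0.
by apply: qcomp_eq0 => a a4; exact: (xP a).
Qed.

Lemma closed_contH u : contH u -> closed [set x | u x = 0].
Proof.
move=> [u1 u2]; rewrite (_ : mkset _ = [set x | (u x).1 = 0] `&` [set x | (u x).2 = 0]).
  by apply: closedI; exact: closed_contq.
apply/seteqP; split=> x; rewrite /setI /mkset; case: (u x) => a b /=; first by case=> -> ->.
by case=> -> ->.
Qed.

Lemma cont_prod (I : Type) (r : seq I) (F : I -> T -> R) :
  (forall i, continuous (F i)) -> continuous (fun x => \prod_(i <- r) F i x).
Proof.
move=> Fc; elim: r => [|i r IH].
  rewrite (_ : (fun _ => _) = fun=> 1); first exact: contC.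
  by apply/funext => x; rewrite big_nil.
rewrite (_ : (fun _ => _) = fun x => F i x * \prod_(i <- r) F i x).
  exact: contM.
by apply/funext => x; rewrite big_cons.
Qed.

Lemma cont_det n (F : T -> 'M[R]_n) : (forall i j, continuous (fun x => F x i j)) ->
  continuous (fun x => \det (F x)).
Proof.
move=> Fc; apply: cont_sum => s; apply: contM; first exact: contC.
by apply: cont_prod => i; exact: Fc.
Qed.

Lemma contq_continuous f : contq f -> continuous f.
Proof.
move=> fc; apply: continuous_comp_initial; apply: continuous_mx => i j.
rewrite (_ : (fun _ => _) = fun x => qcomp j (f x)); first exact: fc.
by apply/funext => x; rewrite /= mxE.
Qed.

Lemma contH_continuous u : contH u -> continuous u.
Proof.
move=> [u1 u2]; rewrite (_ : u = fun y => ((u y).1, (u y).2)).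
  move=> x; have h1 := @contq_continuous _ u1 x; have h2 := @contq_continuous _ u2 x.
  exact: (cvg_pair h1 h2).
by apply/funext => y; rewrite -surjective_pairing.
Qed.

End QuaternionContinuity.

Section FrameContinuity.
Context {R : realType}.

Lemma contq_id : contq (fun x : quat R => x).
Proof.
move=> a; have [a4|a4] := ltnP a 4; last first.
  rewrite (_ : (fun _ => _) = fun=> 0); first exact: contC.
  by apply/funext => x; rewrite /qcomp nth_default.
rewrite (_ : (fun _ => _) = fun x => quat_coord x 0 (Ordinal a4)).
  by apply: cont_coord; exact: initial_continuous.
by apply/funext => x; rewrite mxE.
Qed.

Lemma contq_comp (S T : topologicalType) (f : T -> quat R) (g : S -> T) :
  continuous g -> contq f -> contq (fun x => f (g x)).
Proof. by move=> gc fc a; exact: (continuous_compT gc (fc a)). Qed.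

Lemma contH_comp (S T : topologicalType) (f : T -> H2 R) (g : S -> T) :
  continuous g -> contH f -> contH (fun x => f (g x)).
Proof.
move=> gc [f1 f2]; split.
  exact: (@contq_comp _ _ (fun x => (f x).1) g gc f1).
exact: (@contq_comp _ _ (fun x => (f x).2) g gc f2).
Qed.

Lemma contH_id : contH (fun x : H2 R => x).
Proof.
split.
  exact: (@contq_comp (H2 R) (quat R) id fst (@cont_fst _ _) contq_id).
exact: (@contq_comp (H2 R) (quat R) id snd (@cont_snd _ _) contq_id).
Qed.

Lemma contH_frame k (p : 'I_k) : contH (fun F : frame R k => set_val F p).
Proof.
apply: (@contH_comp _ _ id (fun F : frame R k => set_val F p)) contH_id.
apply: (@continuous_compT _ _ _ set_val (fun g : {ptws 'I_k -> H2 R} => g p)).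
  exact: initial_continuous.
exact: ptws_proj_continuous.
Qed.

End FrameContinuity.

(** * A compact parametrization of the group *)

Section MotionGroup.
Context {R : realType}.

(** The group is parametrized by the sixteen real coordinates of a matrix followed by the four of
    a unit quaternion; this reads off the [n]-th quaternion. *)
Definition quat_at n (g : 'rV[R]_20) : quat R :=
  Quat (g 0 (inord (4 * n))) (g 0 (inord (4 * n + 1)))
       (g 0 (inord (4 * n + 2))) (g 0 (inord (4 * n + 3))).
Definition motion_mx (g : 'rV[R]_20) : 'M[quat R]_2 :=
  \matrix_(i, j) quat_at (2 * i + j) g.
Definition motion_quat := quat_at 4.
Definition motion (g : 'rV[R]_20) := spact (motion_mx g) (motion_quat g).

Definition motions : set 'rV[R]_20 := [set g : 'rV[R]_20 | forall i, -1 <= g 0 i <= 1] `&`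
  [set g | Sp2 R (motion_mx g) /\ Sp1 R (motion_quat g)].

Lemma contq_quat_at n : contq (quat_at n).
Proof. by apply: contq_Quat; apply: cont_coord; exact: cont_id. Qed.

Lemma contq_motion_mx i j : contq (fun g => motion_mx g i j).
Proof.
rewrite (_ : (fun _ => _) = quat_at (2 * i + j)); first exact: contq_quat_at.
by apply/funext => g; rewrite mxE.
Qed.

(** The equations of [Sp(2)] and [Sp(1)] are closed conditions on a box. *)
Lemma motions_compact : compact motions.
Proof.
apply: (@subclosed_compact _ _ [set g : 'rV[R]_20 | forall i, -1 <= g 0 i <= 1]).
- apply: closedI.
    rewrite (_ : mkset _ = \bigcap_(i in [set: 'I_20])
        (fun g : 'rV[R]_20 => g 0 i) @^-1` [set x | -1 <= x <= 1]).
      apply: closed_bigI => i _; apply: preimage_closed.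
        by move=> g _; exact: coord_continuous.
      rewrite (_ : mkset _ = [set x : R | -1 <= x] `&` [set x | x <= 1]).
        by apply: closedI; [exact: closed_ge|exact: closed_le].
      by apply/seteqP; split=> x; rewrite /setI /mkset; [case/andP|case=> -> ->].
    by apply/seteqP; split=> [g gb i _|g gb i]; [exact: gb|exact: (gb i I)].
  have cA : closed [set g : 'rV[R]_20 | Sp2 R (motion_mx g)].
    rewrite (_ : mkset _ = \bigcap_(ij in [set: 'I_2 * 'I_2]) [set g |
      \sum_l qconj (motion_mx g l ij.1) * motion_mx g l ij.2 - (ij.1 == ij.2)%:R = 0]).
      apply: closed_bigI => -[i j] _; apply: closed_contq.
      apply: contqD; last exact: contqC.
      rewrite (_ : (fun _ => _) = fun g => qconj (motion_mx g 0 i) * motion_mx g 0 j +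
        qconj (motion_mx g 1 i) * motion_mx g 1 j).
        by apply: contqD; apply: contqM; try apply: contq_conj; exact: contq_motion_mx.
      apply/funext => g; rewrite !big_ord_recl big_ord0 addr0.
      by rewrite (_ : lift ord0 ord0 = 1) //; exact/val_inj.
    apply/seteqP; split=> [g gA -[i j] _ /=|g gA].
      have := congr1 (fun M : 'M_2 => M i j) gA; rewrite !mxE => <-.
      by apply/eqP; rewrite subr_eq0; apply/eqP; apply: eq_bigr => l _; rewrite !mxE.
    apply/matrixP => i j; have /eqP := gA (i, j) I; rewrite subr_eq0 => /eqP /= gij.
    by rewrite [RHS]mxE -gij !mxE; apply: eq_bigr => l _; rewrite !mxE.
  have cq : closed [set g : 'rV[R]_20 | Sp1 R (motion_quat g)].
    rewrite (_ : mkset _ = [set g | qconj (motion_quat g) * motion_quat g - 1 = 0]).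
      apply: closed_contq; apply: contqD; last exact: contqC.
      by apply: contqM; try apply: contq_conj; exact: contq_quat_at.
    apply/seteqP; split=> g; rewrite /mkset /Sp1 /=; first by move=> ->; rewrite subrr.
    by move/eqP; rewrite subr_eq0 => /eqP.
  exact: (closedI cA cq).
- exact: compact_box.
- by move=> g [].
Qed.

Lemma qcomp_bound a (x : quat R) : qre (qconj x * x) <= 1 -> -1 <= qcomp a x <= 1.
Proof.
have bound (y : R) : y * y <= 1 -> -1 <= y <= 1 by move=> y1; apply/andP; split; nra.
rewrite !coordE; case: x => x y z w /= h; have := (sqr_ge0 x, sqr_ge0 y, (sqr_ge0 z, sqr_ge0 w)).
rewrite !expr2 => -[[x0 y0] [z0 w0]].
case: a => [|[|[|[|a]]]]; last by rewrite /qcomp nth_default //; apply: bound; lra.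
all: by apply: bound; rewrite /qcomp /=; lra.
Qed.

Lemma Sp2_entry (A : 'M[quat R]_2) i j : Sp2 R A -> qre (qconj (A i j) * A i j) <= 1.
Proof.
move=> /(congr1 (fun M : 'M_2 => qre (M j j))); rewrite !mxE eqxx mulr1n [qre 1]coord01.
rewrite (bigD1 i) // coordD !mxE => <-; rewrite lerDl.
elim/big_rec: _ => [|l x _ x0]; first by rewrite coord01.
by rewrite coordD addr_ge0 // !mxE !coordE; nra.
Qed.

(** The columns of a matrix in [Sp(2)] are unit vectors and [q] is one, so the coordinates are in
    the box. *)
Lemma motions_surj (A : 'M[quat R]_2) q : Sp2 R A -> Sp1 R q ->
  exists2 g, motions g & motion_mx g = A /\ motion_quat g = q.
Proof.
move=> AA qq; pose c n := match n with
  0%N => A 0 0 | 1%N => A 0 1 | 2%N => A 1 0 | 3%N => A 1 1 | _ => q end.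
pose g : 'rV[R]_20 := \row_n qcomp (n %% 4) (c (n %/ 4)%N).
have gE n : (n < 5)%N -> quat_at n g = c n.
  move=> n5; rewrite /quat_at !mxE !inordK; try lia.
  have e (r : nat) : (r < 4)%N -> ((4 * n + r) %% 4 = r)%N /\ ((4 * n + r) %/ 4 = n)%N by lia.
  have [e0 e0'] := e 0%N isT; have [e1 e1'] := e 1%N isT.
  have [e2 e2'] := e 2%N isT; have [e3 e3'] := e 3%N isT.
  by rewrite -{1 2}[(4 * n)%N]addn0 e0 e0' e1 e1' e2 e2' e3 e3'; apply: quatP.
have gA : motion_mx g = A.
  by apply/matrixP => i j; rewrite mxE; case: (ord2P i) => ->; case: (ord2P j) => ->; rewrite gE.
have gq : motion_quat g = q by rewrite /motion_quat gE.
exists g; last by [].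
split; last by rewrite /mkset gA gq.
move=> i; rewrite mxE; apply: qcomp_bound; rewrite /c.
by case: (_ %/ _)%N => [|[|[|[|n]]]]; rewrite ?Sp2_entry // (qq : qconj q * q = 1) coord01.
Qed.

Lemma contH_motion (T : topologicalType) (g : T -> 'rV[R]_20) (v : T -> H2 R) :
  continuous g -> contH v -> contH (fun x => motion (g x) (v x)).
Proof.
move=> gc vc; apply: contH_spact => // [i j|].
  exact: (contq_comp gc (@contq_motion_mx i j)).
exact: (contq_comp gc (@contq_quat_at 4)).
Qed.

End MotionGroup.

(** * A generic plane is congruent to a normal plane *)

Section NormalFormExists.
Context {R : realType}.

(** A frame is generic if this matrix of inner products is nonsingular. *)
Definition test_mx k (F : 'I_k -> H2 R) : 'M[R]_k := \matrix_(p, r) ip (F p) (test_vec r).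

Lemma ip_comb k l (M : 'M[R]_(l, k)) (F : 'I_k -> H2 R) p w :
  ip (\sum_j M p j *: F j) w = \sum_j M p j * ip (F j) w.
Proof. by rewrite ip_suml; apply: eq_bigr => j _; rewrite ipZl. Qed.

Lemma test_mx_comb k (M : 'M[R]_k) (F : 'I_k -> H2 R) :
  test_mx (fun p => \sum_j M p j *: F j) = M *m test_mx F.
Proof. by apply/matrixP => p r; rewrite !mxE ip_comb; apply: eq_bigr => j _; rewrite mxE. Qed.

Lemma spact_comb k (M : 'M[R]_k) (F : 'I_k -> H2 R) A q p :
  spact A q (\sum_j M p j *: F j) = \sum_j M p j *: spact A q (F j).
Proof. by rewrite linear_sum; apply: eq_bigr => j _; rewrite linearZ. Qed.

Lemma qcomp_qunit (a p : nat) : (a < 4)%N -> (p < 4)%N -> qcomp a (qunit p : quat R) = (a == p)%:R.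
Proof. by case: a => [|[|[|[|//]]]] _; case: p => [|[|[|[|//]]]]. Qed.

Lemma quat_axis (x : quat R) (p : nat) : (p < 4)%N ->
  (forall c, (c < 4)%N -> c != p -> qcomp c x = 0) -> x = qcomp p x *: qunit p.
Proof.
move=> p4 x0; apply/eqP; rewrite -subr_eq0; apply/eqP; apply: qcomp_eq0 => c c4.
rewrite -scaleN1r qcompD !qcompZ qcomp_qunit //.
by have [->|cp] := eqVneq c p; rewrite /= ?(x0 _ c4 cp); ring.
Qed.

(** The extreme value theorem on the compact group. *)
Lemma maximal_position k (F : 'I_k -> H2 R) : exists A q, [/\ Sp2 R A, Sp1 R q &
  forall B r, Sp2 R B -> Sp1 R r ->
    \det (test_mx (fun p => spact B r (F p))) ^+ 2 <=
    \det (test_mx (fun p => spact A q (F p))) ^+ 2].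
Proof.
pose d (g : 'rV[R]_20) := \det (test_mx (fun p => motion g (F p))) ^+ 2.
have dc : continuous d.
  apply: contM; apply: cont_det => p r.
    rewrite (_ : (fun _ => _) = fun g => ip (motion g (F p)) (test_vec r)).
      apply: cont_ip; last exact: contHC.
      by apply: contH_motion; [exact: cont_id|exact: contHC].
    by apply/funext => g; rewrite mxE.
  rewrite (_ : (fun _ => _) = fun g => ip (motion g (F p)) (test_vec r)).
    apply: cont_ip; last exact: contHC.
    by apply: contH_motion; [exact: cont_id|exact: contHC].
  by apply/funext => g; rewrite mxE.
have ne : motions (R := R) !=set0.
  have I2 : Sp2 R 1%:M by rewrite /Sp2 /= adjointmx1 mulmx1.
  have I1 : Sp1 R 1 by rewrite /Sp1 /= qconj1 mulr1.
  by have [g gm _] := motions_surj I2 I1; exists g.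
have [g /set_mem[_ [gA gq]] gmax] := compact_EVT_max ne motions_compact
  (continuous_subspaceT dc).
exists (motion_mx g), (motion_quat g); split=> // B r BB rr.
have [h hm [hB hr]] := motions_surj BB rr.
by have := gmax h (mem_set hm); rewrite /d /motion hB hr.
Qed.

Lemma dual_axesP m (v : 'I_m.+2 -> H2 R) : (m <= 2)%N ->
  (forall p r : 'I_m.+2, ip (v p) (test_vec r) = (p == r)%:R) ->
  (forall A q, Sp2 R A -> Sp1 R q ->
    \det (test_mx (fun p => spact A q (v p))) ^+ 2 <= 1) ->
  dual_axes v.
Proof.
move=> m2 dual maximal; have [ci si [cj sj ck sk]] := @unit_conj_sq R.
have ei := unit_eqsP dual maximal m2 ci si.
have ej := unit_eqsP dual maximal m2 cj sj.
have ek := unit_eqsP dual maximal m2 ck sk.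
case: m m2 v dual maximal ei ej ek => [|[|[|//]]] _ v dual _ ei ej ek.
- exact: dual_axes2.
- exact: dual_axes3.
- exact: dual_axes4.
Qed.

(** The duality [x + p y = 1] shows that the vector is nonzero; normalize it and take its
    angle. *)
Lemma axis_line m (v : 'I_m.+2 -> H2 R) (p : 'I_m.+2) : (m <= 2)%N ->
  (forall p r : 'I_m.+2, ip (v p) (test_vec r) = (p == r)%:R) -> dual_axes v ->
  exists n t, v p = n *: line_vec t p.
Proof.
move=> m2 dual ax; have p4 : (p < 4)%N by have := ltn_ord p; move: m2; lia.
set x := qcomp p (v p).1; set y := qcomp p (v p).2.
have vE : v p = (x *: qunit p, y *: qunit p).
  rewrite [LHS]surjective_pairing; congr (_, _); apply: quat_axis => // c c4 cp.
    by have [] := ax p c c4 cp.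
  by have [] := ax p c c4 cp.
have xy : x + p%:R * y = 1 by rewrite -ip_test // dual eqxx.
have n0 : 0 < x ^+ 2 + y ^+ 2.
  rewrite lt_def addr_ge0 ?sqr_ge0 // andbT; apply/eqP => /eqP.
  rewrite paddr_eq0 ?sqr_ge0 // !sqrf_eq0 => /andP[/eqP x0 /eqP y0].
  by move: xy; rewrite x0 y0 mulr0 addr0 => /eqP; rewrite eq_sym oner_eq0.
pose n := Num.sqrt (x ^+ 2 + y ^+ 2).
have nn : n ^+ 2 = x ^+ 2 + y ^+ 2 by rewrite sqr_sqrtr // ltW.
have nz : n != 0 by rewrite gt_eqF // sqrtr_gt0.
have [|t _ [ct st]] := @angleP R (x / n) (y / n).
  by rewrite !expr_div_n -mulrDl -nn divff // sqrf_eq0.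
exists n, t; rewrite vE /line_vec ct st.
by congr (_, _); rewrite scalerA mulrC divfK.
Qed.

(** In maximal position the basis dual to the test vectors is again in maximal position, with
    determinant 1, so its vectors are multiples of unit vectors [line_vec]; these span the moved
    plane. *)
Lemma exists_normal m (k4 : (m.+2 <= 4)%N) (F : frame R m.+2) :
  \det (test_mx (set_val F)) != 0 ->
  exists t, \pi_(Gr_orbits R m.+2) (frame_span F) = normal_class k4 t.
Proof.
move=> F0; have m2 : (m <= 2)%N by [].
have [A [q [AA qq Amax]]] := maximal_position (set_val F).
pose G p := spact A q (set_val F p).
pose Ga := test_mx G.
have Ga0 : \det Ga ^+ 2 > 0.
  apply: lt_le_trans (Amax 1%:M 1 _ _).
  - rewrite (_ : (fun _ => _) = set_val F) ?exprn_even_gt0 //.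
    by apply/funext => p; rewrite spact1.
  - by rewrite /Sp2 /= adjointmx1 mulmx1.
  - by rewrite /Sp1 /= qconj1 mulr1.
have Gu : Ga \in unitmx by rewrite unitmxE unitfE -sqrf_eq0 gt_eqF.
pose v p := \sum_l invmx Ga p l *: G l.
have dual (p r : 'I_m.+2) : ip (v p) (test_vec r) = (p == r)%:R.
  have := congr1 (fun M : 'M_m.+2 => M p r) (test_mx_comb (invmx Ga) G).
  by rewrite mulVmx // !mxE.
have ax : dual_axes v.
  apply: dual_axesP => // B r BB rr.
  rewrite (_ : (fun _ => _) = fun p => \sum_l invmx Ga p l *: spact B r (G l)).
    rewrite test_mx_comb detM det_inv exprMn exprVn mulrC ler_pdivrMr // mul1r.
    rewrite (_ : (fun _ => _) = fun p => spact (B *m A) (q * r) (set_val F p)).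
      apply: Amax.
        by rewrite /Sp2 /= adjointmxM mulmxA -(mulmxA _ _ B) (BB : _ *m _ = _) mulmx1.
      by rewrite /Sp1 /= qconjM mulrA -(mulrA _ _ q) (qq : _ * _ = _) mulr1.
    by apply/funext => p; rewrite spactM.
  by apply/funext => p; rewrite spact_comb.
have /choice[n /choice[t tE]] (p : 'I_m.+2) := axis_line p m2 dual ax.
exists (\row_p t p); apply/orbit_eqP; exists A, q; split=> // p.
have -> : spact A q (set_val F p) = \sum_l Ga p l *: v l.
  rewrite -[LHS]/(G p).
  transitivity (\sum_j (Ga *m invmx Ga) p j *: G j).
    rewrite mulmxV // (bigD1 p) //= big1 ?addr0 => [|j jp]; first by rewrite mxE eqxx scale1r.
    by rewrite mxE eq_sym (negPf jp) scale0r.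
  under [in RHS]eq_bigr do rewrite scaler_sumr.
  rewrite exchange_big; apply: eq_bigr => j _ /=.
  by rewrite mxE scaler_suml; apply: eq_bigr => l _; rewrite scalerA.
apply: memv_suml => l _; apply: memvZ; rewrite tE; apply: memvZ.
by have := mem_normal_frame (\row_p t p) l; rewrite mxE.
Qed.

End NormalFormExists.

(** * Generic frames are dense *)

Section GenericFrames.
Context {R : realType} {k : nat}.
Hypothesis k4 : (k <= 4)%N.

Lemma free_of_test_mx (F : 'I_k -> H2 R) : \det (test_mx F) != 0 -> free (codom F).
Proof.
move=> dF; apply/codom_freeP => c c0 i.
have uF : test_mx F \in unitmx by rewrite unitmxE unitfE.
have cF : (\row_j c j) *m test_mx F = 0.
  apply/rowP => r; rewrite !mxE -[RHS](ip0l (test_vec r)) -c0 ip_suml.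
  by apply: eq_bigr => j _; rewrite ipZl !mxE.
have : \row_j c j = 0 by rewrite -[LHS]mulmx1 -(mulmxV uF) mulmxA cF mul0mx.
by move/rowP/(_ i); rewrite !mxE.
Qed.

(** This moves the matrix of inner products with the test vectors by a multiple of the
    identity. *)
Definition nudge (F : 'I_k -> H2 R) (e : R) : {ptws 'I_k -> H2 R} :=
  fun p => F p + e *: (qunit p, 0).

Lemma test_mx_nudge F e : test_mx (nudge F e) = test_mx F + e%:M.
Proof.
apply/matrixP => p r; rewrite !mxE ipDl ipZl; congr (_ + _).
have lt4 (i : 'I_k) : (i < 4)%N by exact: leq_trans (ltn_ord i) k4.
by rewrite ip_test // qcomp_qunit // qcomp0 mulr0 addr0 mulr_natr eq_sym.
Qed.

(** The determinant is a monic polynomial in the parameter, so among [k + 1] small values one is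
    not a root. *)
Lemma nudge_generic F (d : R) : 0 < d ->
  exists2 e, `|e| < d & \det (test_mx (nudge F e)) != 0.
Proof.
move=> d0; pose M := - test_mx F; pose e (i : nat) := d / i.+2%:R.
pose es := [seq e i | i <- iota 0 k.+1].
have [/allP all_root|] := boolP (all (root (char_poly M)) es).
  have /allP/max_poly_roots : {in es, forall x, root (char_poly M) x} := all_root.
  move=> /(_ (monic_neq0 (char_poly_monic M))).
  rewrite size_char_poly size_map size_iota ltnn => ne.
  have : uniq es.
    rewrite map_inj_uniq ?iota_uniq // => i j /(mulfI (lt0r_neq0 d0))/invr_inj/eqP.
    by rewrite eqr_nat => /eqP[].
  by move/ne.
move=> /allPn[_ /mapP[i _ ->]]; rewrite -eigenvalue_root_char negbK => ei.
exists (e i).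
  rewrite ger0_norm ?divr_ge0 ?ltW // ltr_pdivrMr ?ltr0n //.
  by rewrite ltr_pMr // ltr1n.
move: ei; rewrite /eigenspace kermx_eq0 row_free_unit unitmxE unitfE /M test_mx_nudge.
by rewrite -opprD -scaleN1r detZ mulf_eq0 signr_eq0.
Qed.

Lemma generic_dense (U : set (frame R k)) F : open U -> U F ->
  exists2 G : frame R k, U G & \det (test_mx (set_val G)) != 0.
Proof.
move=> [W oW <-] WF.
have gc : continuous (nudge (set_val F)).
  apply: continuous_ptws => p; apply: contH_continuous.
  by apply: contHD; [exact: contHC|apply: contHZ; [exact: cont_id|exact: contHC]].
have g0 : nudge (set_val F) 0 = set_val F.
  by apply/funext => p; rewrite /nudge scale0r addr0.
have : nbhs (0 : R) (nudge (set_val F) @^-1` W).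
  by apply: gc; apply: open_nbhs_nbhs; split=> //; rewrite g0.
move=> /nbhs_ballP[d /= d0 dW]; have [e ed eg] := nudge_generic (set_val F) d0.
exists (exist _ (nudge (set_val F) e) (mem_set (free_of_test_mx eg))) => //.
by apply: dW; rewrite /ball /= sub0r normrN.
Qed.

End GenericFrames.

(** * The orbit space as a quotient of the space of angles *)

Section GrassmannianOrbits.
Context {R : realType} {m : nat}.
Hypothesis k4 : (m.+2 <= 4)%N.
Let k := m.+2.
Implicit Types (F : frame R k) (t : 'rV[R]_k).

Lemma angle_equiv_box t : exists2 u : 'rV[R]_k, forall i, 0 <= u 0 i <= pi & angle_equiv t u.
Proof.
have p0 : 0 < pi :> R := pi_gt0R.
exists (\row_p (t 0 p + (- Num.floor (t 0 p / pi))%:~R * pi)).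
  move=> i; rewrite mxE; have := floor_itv (t 0 i / pi).
  rewrite intrD ler_pdivlMr // ltr_pdivrMr // rmorphN /= => /andP[h1 h2].
  by apply/andP; split; lra.
exists 1%g, false, 0, (fun p => - Num.floor (t 0 p / pi)) => p.
by rewrite mxE perm1 expr0 mul1r addr0.
Qed.

Lemma normal_class_memP F t : \pi_(Gr_orbits R k) (frame_span F) = normal_class k4 t <->
  exists2 g, motions g & forall p, motion g (set_val F p) -
    \sum_r ip (motion g (set_val F p)) (normal_frame t r) *: normal_frame t r = 0.
Proof.
have nfo := normal_frame_orthonormal t k4.
split=> [/orbit_eqP[A [q [AA qq AE]]]|[g [_ [gA gq]] gE]].
  have [g gm [gA gq]] := motions_surj AA qq; exists g => // p.
  rewrite /motion gA gq; apply/eqP; rewrite subr_eq0; apply/eqP.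
  exact/(orthonormal_span _ nfo)/AE.
apply/orbit_eqP; exists (motion_mx g), (motion_quat g); split=> // p.
apply/(orthonormal_span _ nfo)/eqP; rewrite -subr_eq0; apply/eqP; exact: gE.
Qed.

Definition normal_set (C : set 'rV[R]_k) : set (frame R k) :=
  [set F | exists2 t, C t & \pi_(Gr_orbits R k) (frame_span F) = normal_class k4 t].

(** Invariance of [C] allows restricting the angles to a compact box. Congruence by a given group
    element to a given normal plane is a closed condition, and both parameters range over
    compact sets. *)
Lemma closed_normal_set (C : set 'rV[R]_k) : closed C ->
  (forall t u, angle_equiv t u -> C t -> C u) -> closed (normal_set C).
Proof.
move=> cC Cw; pose P := ('rV[R]_k * 'rV[R]_20)%type.
pose nf (x : frame R k * P) r := normal_frame x.2.1 r.
pose mo (x : frame R k * P) p := motion x.2.2 (set_val x.1 p).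
pose E : set (frame R k * P) := [set x | C x.2.1] `&`
  \bigcap_(p in [set: 'I_k]) [set x | mo x p - \sum_r ip (mo x p) (nf x r) *: nf x r = 0].
have c1 : continuous (fun x : frame R k * P => x.2.1).
  exact: (continuous_compT (@cont_snd _ _) (@cont_fst _ _)).
have c2 : continuous (fun x : frame R k * P => x.2.2).
  exact: (continuous_compT (@cont_snd _ _) (@cont_snd _ _)).
have moc p : contH (fun x => mo x p).
  apply: contH_motion => //.
  exact: (@contH_comp _ _ _ (fun F : frame R k => set_val F p) fst (@cont_fst _ _) (contH_frame p)).
have nfc r : contH (fun x => nf x r).
  by apply: contH_line_vec; apply: cont_coord.
rewrite (_ : normal_set C = [set F : frame R k | exists2 x : P,
    ([set t : 'rV[R]_k | forall i, 0 <= t 0 i <= pi] `*` motions) x & E (F, x)]).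
  apply: closed_projection.
    by apply: compact_setX; [exact: compact_box|exact: motions_compact].
  apply: closedI; first by apply: preimage_closed => // x _; exact: c1.
  apply: closed_bigI => p _; apply: closed_contH; apply: contHB => //.
  by apply: contH_sum => r; apply: contHZ => //; apply: cont_ip.
apply/seteqP; split=> [F [t Ct Ft]|F [[t g] [/= _ gm] [/= Ct FE]]].
  have [u ub tu] := angle_equiv_box t.
  have /normal_class_memP[g gm gE] :
      \pi_(Gr_orbits R k) (frame_span F) = normal_class k4 u.
    by rewrite Ft; exact: normal_class_angle_equiv.
  by exists (u, g) => //; split=> [|p _] /=; [exact: Cw tu Ct|exact: gE].
exists t => //; apply/normal_class_memP; exists g => // p; exact: (FE p I).
Qed.

(** The frames congruent to normal ones form a closed set that contains the dense set of generic
    frames. *)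
Lemma normal_set_full F : exists t, \pi_(Gr_orbits R k) (frame_span F) = normal_class k4 t.
Proof.
apply: contrapT => nF; have oU : open (~` normal_set setT).
  by apply: closed_openC; apply: closed_normal_set => //; exact: closedT.
have [|G GN /(exists_normal k4)[t tE]] := generic_dense k4 oU (F := F).
  by move=> [t _ tE]; apply: nF; exists t.
by apply: GN; exists t.
Qed.

Lemma normal_point_continuous : continuous (normal_point k4 : 'rV[R]_k -> frame R k).
Proof.
apply: continuous_comp_initial; apply: continuous_ptws => p.
apply: contH_continuous; apply: contH_line_vec.
by apply: cont_coord; exact: cont_id.
Qed.

(** A set with open preimage is open because the frames over its complement form a [normal_set] of a
    closed set of angles. *)
Lemma normal_class_orbit_map : orbit_map (normal_class k4 : 'rV[R]_k -> Gr_orbits R k).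
Proof.
split=> [x|U|t u].
- have [F <-] := orbit_frame_surj x.
  by have [t tE] := normal_set_full F; exists t.
- have oE : open U = open ((fun F => \pi_(Gr_orbits R k) (frame_span F)) @^-1` U) by [].
  rewrite oE; split=> [Uo|Uo].
    apply: (@open_comp _ _ (normal_point k4 : 'rV[R]_k -> frame R k) _ _ Uo).
    by move=> t _; exact: normal_point_continuous.
  rewrite -closedC (_ : ~` _ = normal_set (~` (normal_class k4 @^-1` U))).
    apply: closed_normal_set; first exact: open_closedC.
    by move=> t u tu nU; rewrite /setC /preimage /= -(normal_class_angle_equiv k4 tu).
  apply/seteqP; split=> [F nU|F [t nU tE]]; last by rewrite /setC /preimage /= tE.
  by have [t tE] := normal_set_full F; exists t; rewrite // /setC /preimage /= -tE.
- by split; [exact: normal_class_inj|exact: normal_class_angle_equiv].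
Qed.

End GrassmannianOrbits.

(** * The homeomorphism *)

(** Quotients by the same equivalence relation are homeomorphic over the space of angles. *)
Lemma orbit_map_transfer (R : realType) k (S T : topologicalType)
    (f : 'rV[R]_k -> S) (g : 'rV[R]_k -> T) : orbit_map f -> orbit_map g ->
  exists2 h : S -> T, homeomorphism h & forall t, h (f t) = g t.
Proof.
move=> [fs fo fw] [gs go gw].
have /choice[r rE] := fs; have /choice[s sE] := gs.
have gr t : g (r (f t)) = g t by apply/gw/fw; rewrite rE.
have fs' t : f (s (g t)) = f t by apply/fw/gw; rewrite sE.
exists (fun x => g (r x)) => //; split.
  apply/continuousP => U oU; apply/fo.
  rewrite (_ : _ @^-1` _ = g @^-1` U); first exact/go.
  by apply/seteqP; split=> t; rewrite /preimage /= gr.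
exists (fun y => f (s y)); split.
- apply/continuousP => U oU; apply/go.
  rewrite (_ : _ @^-1` _ = f @^-1` U); first exact/fo.
  by apply/seteqP; split=> t; rewrite /preimage /= fs'.
- by move=> x; rewrite fs' rE.
- by move=> y; rewrite gr sE.
Qed.

Theorem theorem1 (R : realType) (k : nat) (hk : (2 <= k <= 4)%N) :
  covering_dim (Gr_orbits R k) k.-1 /\
  exists h : X R k -> Gr_orbits R k,
    homeomorphism h /\
    forall lam : Lam R k,
      exists V : Gr R k,
        \pi_(Gr_orbits R k) V = h (\pi_(X R k) lam) /\
        exists v : k.-tuple (H2 R),
          basis_of (\val V) v /\
          forall i j : 'I_k,
            K (tnth v i) (tnth v j) = M_lam (set_val lam) i j.
Proof.
case/andP: hk; case: k => [|[|m]] // _ k4.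
have om := normal_class_orbit_map (R := R) k4.
split.
  split; first exact: covering_dim_le_orbit om.
  by move=> n nm; apply: covering_dim_gt_orbit nm om.
have [h hh hE] := orbit_map_transfer (cos_class_orbit_map (R := R) k4) om.
exists h; split=> // lam; have [t _ tE] := cos_point_surj k4 lam.
exists (frame_span (normal_point k4 t)); split; first by rewrite -tE; exact/esym/hE.
exists [tuple normal_frame t p | p < m.+2]; split.
  by rewrite /basis_of eqxx; exact: orthonormal_free (normal_frame_orthonormal t k4).
move=> p q; rewrite !tnth_mktuple K_line_vec -tE M_lamE //; congr (_ *: _).
exact/esym/lam_full_cos.
Qed.
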